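(* Let $M_1,\dots,M_m$ be smooth manifolds, let $\mu_1,\dots,\mu_m$ be compactly supported Borel probability measures on $M_1,\dots,M_m$ respectively, and let $c:M_1\times\cdots\times M_m\to\mathbb{R}$ be a continuous, semi-concave cost function. Assume that $c$ is twisted on $c$-splitting sets and that $\mu_1$ is absolutely continuous with respect to local coordinates. Then the solution $\gamma$ of the problem of minimizing $\int_{M_1\times\cdots\times M_m} c(x_1,\dots,x_m)\,d\gamma$ among probability measures $\gamma$ on $M_1\times\cdots\times M_m$ which project to the $\mu_i$ induces a Monge solution, i.e. it is concentrated on the graph $\{(x_1,T(x_1))\}$ of a function $T:M_1\to M_2\times\cdots\times M_m$, and this solution $\gamma$ is unique.
   Context: A set $S\subseteq M_1\times\cdots\times M_m$ is a \emph{$c$-splitting set} if there exist Borel functions $u_i:M_i\to\mathbb{R}$, $i=1,\dots,m$, such that $\sum_{i=1}^m u_i(x_i)\le c(x_1,\dots,x_m)$ for all $(x_1,\dots,x_m)\in M_1\times\cdots\times M_m$, with equality whenever $(x_1,\dots,x_m)\in S$. A continuous, semi-concave cost $c$ is \emph{twisted on $c$-splitting sets} if for each fixed $x_1\in M_1$ and each $c$-splitting set $S\subseteq\{x_1\}\times M_2\times\cdots\times M_m$, the map $(x_2,\dots,x_m)\mapsto D_{x_1}c(x_1,x_2,\dots,x_m)$ is injective on the subset of $S$ where $c$ is differentiable with respect to $x_1$ (i.e. the subset where $D_{x_1}c(x_1,x_2,\dots,x_m)$ exists). ``Absolutely continuous with respect to local coordinates'' means absolutely continuous with respect to Lebesgue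 measure in local coordinate charts. *)

(* Defs.v *)
From HB Require Import structures.
From mathcomp Require Import all_boot all_order all_algebra.
From mathcomp Require Import all_classical all_reals all_analysis.

Set Implicit Arguments.
Unset Strict Implicit.
Unset Printing Implicit Defensive.

Import Order.TTheory GRing.Theory Num.Theory.
Import numFieldNormedType.Exports.

Local Open Scope classical_set_scope.
Local Open Scope ring_scope.

(* [Ck k U f] is meant for an open set U. *)
Fixpoint Ck (R : realType) (n p : nat) (k : nat) (U : set 'rV[R]_n)
    (f : 'rV[R]_n -> 'rV[R]_p) : Prop :=
  match k with
  | 0 => forall x, U x -> {for x, continuous f}
  | k'.+1 => (forall x, U x -> differentiable f x) /\
             (forall v : 'rV[R]_n, Ck k' U ('D_v f))
  end.

Definition smooth_on (R : realType) (n p : nat) (U : set 'rV[R]_n)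
    (f : 'rV[R]_n -> 'rV[R]_p) : Prop :=
  forall k, Ck k U f.

(* A homeomorphism between an open subset of T and an open subset of R^n; the
   values of [chart_fun] outside [chart_dom], and those of [chart_inv] outside
   the image of [chart_dom], are irrelevant. *)
Record chart (R : realType) (T : topologicalType) (n : nat) := Chart {
  chart_dom : set T ;
  chart_fun :> T -> 'rV[R]_n ;
  chart_inv : 'rV[R]_n -> T ;
  chart_dom_open : open chart_dom ;
  chart_img_open : open (chart_fun @` chart_dom) ;
  chart_funK : forall x, chart_dom x -> chart_inv (chart_fun x) = x ;
  chart_fun_continuous :
    forall x, chart_dom x -> {for x, continuous chart_fun} ;
  chart_inv_continuous :
    forall y, (chart_fun @` chart_dom) y -> {for y, continuous chart_inv}
}.

(* The carrier is pointed because the library's measurable spaces are; only the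
   empty manifold, which carries no probability measure, is lost. *)
Record smoothManifold (R : realType) := SmoothManifold {
  mfd_carrier :> ptopologicalType ;
  mfd_dim : nat ;
  mfd_atlas : set (chart R mfd_carrier mfd_dim) ;
  mfd_hausdorff : hausdorff_space mfd_carrier ;
  mfd_second_countable : @second_countable mfd_carrier ;
  mfd_cover : forall x : mfd_carrier,
    exists2 phi, mfd_atlas phi & chart_dom phi x ;
  mfd_compatible : forall phi psi, mfd_atlas phi -> mfd_atlas psi ->
    smooth_on (phi @` (chart_dom phi `&` chart_dom psi))
              (psi \o chart_inv phi)
}.

Notation borel T := (g_sigma_algebraType (@open T)).

Definition prod_mfd (R : realType) (m : nat)
    (M : 'I_m.+1 -> smoothManifold R) : Type :=
  prod_topology (fun i => M i : ptopologicalType).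

HB.instance Definition _ (R : realType) (m : nat)
    (M : 'I_m.+1 -> smoothManifold R) :=
  Topological.copy (prod_mfd M)
    (prod_topology (fun i => M i : ptopologicalType)).
HB.instance Definition _ (R : realType) (m : nat)
    (M : 'I_m.+1 -> smoothManifold R) :=
  Pointed.copy (prod_mfd M) (forall i, (M i : ptopologicalType)).

Definition msupport (R : realType) (T : ptopologicalType)
    (mu : probability (borel T) R) : set T :=
  [set x | forall U : set T, open U -> U x -> (0 < mu U)%E].

Definition compactly_supported (R : realType) (T : ptopologicalType)
    (mu : probability (borel T) R) : Prop :=
  compact (msupport mu).

Definition box (R : realType) (n : nat) (a b : 'rV[R]_n) : set 'rV[R]_n :=
  [set x | forall j, a 0 j <= x 0 j <= b 0 j].

(* The subfamily D of the boxes, possibly finite or empty, is what makes the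
   empty set negligible in R^0, where every box has volume 1. *)
Definition lebesgue_outer (R : realType) (n : nat) (A : set 'rV[R]_n)
    : \bar R :=
  ereal_inf [set v | exists (D : pred nat) (a b : nat -> 'rV[R]_n),
    [/\ forall k j, a k 0 j <= b k 0 j,
        A `<=` \bigcup_(k in [set k | D k]) box (a k) (b k)
      & v = (\sum_(0 <= k <oo | D k) (\prod_j (b k 0 j - a k 0 j))%:E)%E]].

Definition abs_continuous_in_charts (R : realType) (M : smoothManifold R)
    (mu : probability (borel M) R) : Prop :=
  forall phi, mfd_atlas phi ->
  forall A : set (borel M), measurable A -> A `<=` chart_dom phi ->
    lebesgue_outer (phi @` A) = 0%E -> mu A = 0%E.

(* Around each point, in product coordinates, c is a concave function plus
   K times the squared Euclidean norm. Balls of 'rV[R]_n are cubes (sup norm),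
   so that the domain of concavity is a convex product of cubes. *)
Definition semiconcave (R : realType) (m : nat)
    (M : 'I_m.+1 -> smoothManifold R) (c : prod_mfd M -> R) : Prop :=
  forall (x : prod_mfd M) (phi : forall i, chart R (M i) (mfd_dim (M i))),
    (forall i, mfd_atlas (phi i) /\ chart_dom (phi i) (x i)) ->
  exists (r K : R), 0 < r /\
    let B := [set y : forall i, 'rV[R]_(mfd_dim (M i)) |
                forall i, ball (phi i (x i)) r (y i)] in
    let F := fun y : (forall i, 'rV[R]_(mfd_dim (M i))) =>
      c (fun i => chart_inv (phi i) (y i)) - K * \sum_i \sum_j y i 0 j ^+ 2 in
    (forall y, B y -> forall i, (phi i @` chart_dom (phi i)) (y i)) /\
    (forall y z (t : R), B y -> B z -> 0 <= t <= 1 ->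
      t * F y + (1 - t) * F z <= F (fun i => t *: y i + (1 - t) *: z i)).

Definition c_splitting (R : realType) (m : nat)
    (M : 'I_m.+1 -> smoothManifold R) (c : prod_mfd M -> R)
    (S : set (prod_mfd M)) : Prop :=
  exists u : forall i, M i -> R,
    [/\ forall i, measurable_fun setT (u i : borel (M i) -> R),
        forall x : prod_mfd M, \sum_i u i (x i) <= c x
      & forall x, S x -> \sum_i u i (x i) = c x].

(* The function x_1 |-> c(x_1, x_2, ..., x_m) read in the chart phi of M_1;
   its differential represents the covector D_{x_1} c in these coordinates. *)
Definition first_slice (R : realType) (m : nat)
    (M : 'I_m.+1 -> smoothManifold R) (c : prod_mfd M -> R)
    (phi : chart R (M ord0) (mfd_dim (M ord0))) (x : prod_mfd M)
    : 'rV[R]_(mfd_dim (M ord0)) -> R :=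
  fun y => c (dfwith x ord0 (chart_inv phi y)).

Definition twisted_on_splitting_sets (R : realType) (m : nat)
    (M : 'I_m.+1 -> smoothManifold R) (c : prod_mfd M -> R) : Prop :=
  forall (x1 : M ord0) (S : set (prod_mfd M)),
    S `<=` [set x : prod_mfd M | x ord0 = x1] -> c_splitting c S ->
  forall phi, mfd_atlas phi -> chart_dom phi x1 ->
    set_inj (S `&` [set x : prod_mfd M | differentiable (first_slice c phi x) (phi x1)])
      (fun x => 'd (first_slice c phi x) (phi x1)
                : 'rV[R]_(mfd_dim (M ord0)) -> R).

Definition coupling (R : realType) (m : nat)
    (M : 'I_m.+1 -> smoothManifold R)
    (mu : forall i, probability (borel (M i)) R)
    (gamma : probability (borel (prod_mfd M)) R) : Prop :=
  forall i (A : set (borel (M i))), measurable A ->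
    gamma [set x : prod_mfd M | A (x i)] = mu i A.

Definition kantorovich_solution (R : realType) (m : nat)
    (M : 'I_m.+1 -> smoothManifold R)
    (mu : forall i, probability (borel (M i)) R) (c : prod_mfd M -> R)
    (gamma : probability (borel (prod_mfd M)) R) : Prop :=
  coupling mu gamma /\
  forall gamma' : probability (borel (prod_mfd M)) R, coupling mu gamma' ->
    (\int[gamma]_x (c x)%:E <= \int[gamma']_x (c x)%:E)%E.

Definition first_graph (R : realType) (m : nat)
    (M : 'I_m.+1 -> smoothManifold R)
    (T : M ord0 -> forall i : 'I_m, M (lift ord0 i)) : set (prod_mfd M) :=
  [set x : prod_mfd M | forall i : 'I_m, x (lift ord0 i) = T (x ord0) i].

Definition induces_monge (R : realType) (m : nat)
    (M : 'I_m.+1 -> smoothManifold R)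
    (gamma : probability (borel (prod_mfd M)) R) : Prop :=
  exists T : M ord0 -> forall i : 'I_m, M (lift ord0 i),
    gamma.-negligible (~` first_graph T).

(* Main.v *)
(* Idea. Apply Hahn-Banach to the value of the dual problem, a sublinear
   functional on the bounded functions on the product of the supports. The
   resulting functional is positive and has the right marginals, so inner
   regularity of the marginals makes it countably additive on the algebra
   generated by rectangles. By Caratheodory it is an optimal plan, with no
   duality gap. Along a maximizing sequence of bounded dual potentials the slack
   tends to zero on a set S of full measure for every optimal plan; an
   ultrafilter limit gives potentials u_i with sum u_i <= c, and equality on S.

   Let v be the c-conjugate of (u_i)_{i > 0}. In a chart v is concave up to a
   multiple of |y|^2; its kinks along each axis have measure zero, by counting
   grid cells, and where it has no kink it has a supergradient. At a point of S
   over such an x_1 the slice of c touches v from above, so it is differentiable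
   with a differential depending on x_1 only. Two such points over the same x_1
   form a c-splitting set (the Borel potentials being u_i at these two points and
   very negative elsewhere), so they coincide by twistedness. Hence all optimal
   plans are concentrated on one Borel graph, and on its compact subsets they are
   determined by the first marginal. *)
From HB Require Import structures.
Require Import Defs.
From mathcomp Require Import all_boot all_order all_algebra.
From mathcomp Require Import all_classical all_reals all_analysis.
From mathcomp Require Import measurable_realfun.
From mathcomp Require Import ring lra.
Import Order.TTheory GRing.Theory Num.Theory.
Import numFieldNormedType.Exports.
Local Open Scope classical_set_scope.
Local Open Scope ring_scope.

Set Implicit Arguments.
Unset Strict Implicit.
Unset Printing Implicit Defensive.

(** * Hahn-Banach *)

(** The limit potentials are pointwise limits along an ultrafilter, and nothing makes such limits
    Borel. Twistedness is therefore applied to two points at a time: a potential that keeps only two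
    of its values and is replaced by a Borel function elsewhere is Borel. Pointwise limits require
    uniform bounds, whence the truncation of near-optimal potentials to a bound that depends only on
    [c] over the supports and on the number of factors. The dual gaps are squares of a summable
    sequence, so that Markov's inequality and Borel-Cantelli apply to every optimal plan at once.
    The resulting set depends on the potentials alone, and this is what turns the graph property
    into uniqueness.

    Absolute continuity tests Borel sets only, so exceptional sets are built as countable unions of
    compact ones, one for each axis and each kink size [k.+1%:R^-1]. Slopes along the axes suffice:
    for a concave function they give a supergradient up to a first-order error, that is a bound from
    below, and concavity of the touching slice supplies the bound from above. *)

Section hahn_banach.
Variables (R : realType) (V : lmodType R) (E : set V) (p : V -> R) (x0 : V).
Hypothesis Elin : forall (a : R) x y, E x -> E y -> E (a *: x + y).
Hypothesis psub : forall x y, E x -> E y -> p (x + y) <= p x + p y.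
Hypothesis phom : forall (a : R) x, E x -> 0 <= a -> p (a *: x) = a * p x.
Hypothesis Ex0 : E x0.

Let E0 : E 0.
Proof. by have := Elin (-1) Ex0 Ex0; rewrite scaleN1r addNr. Qed.

Let EZ (a : R) x : E x -> E (a *: x).
Proof. by move=> Ex; rewrite -[_ *: _]addr0; exact: Elin. Qed.

Let ED x y : E x -> E y -> E (x + y).
Proof. by move=> Ex; rewrite -[x in x + y]scale1r; exact: Elin. Qed.

Let p0 : p 0 = 0.
Proof. by rewrite -[X in p X](scale0r x0) phom// mul0r. Qed.

(* Graph of a linear functional dominated by [p] on a subspace of [E]; it is
   automatically functional, since [r <= p 0 = 0] for all [(0, r)] in it. *)
Let dominated (H : set (V * R)) :=
  (forall z, H z -> E z.1 /\ z.2 <= p z.1) /\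
  (forall a z z', H z -> H z' -> H (a *: z.1 + z'.1, a * z.2 + z'.2)).

Let line : set (V * R) := [set z | exists t, z = (t *: x0, t * p x0)].

Let dominated_line : dominated line.
Proof.
split=> [_ [t ->]/=|a _ _ [t ->] [u ->]]; last first.
  by exists (a * t + u); rewrite /= scalerDl scalerA mulrDl mulrA.
split; first exact: EZ.
have [t0|t0] := leP 0 t; first by rewrite phom.
have := psub (EZ t Ex0) (EZ (- t) Ex0).
rewrite -scalerDl subrr scale0r p0 (phom _ (a := - t))//; last lra.
lra.
Qed.

(** The value [a] at [v] must lie above every [w.2 - p (w.1 - v)] and below every
    [p (w.1 + v) - w.2]. Subadditivity separates the two families, and the supremum of the first is
    taken. The vector [v] may already lie in the domain of [H], since domination forces
    functionality. *)
Let extend (H : set (V * R)) (v : V) : dominated H -> H !=set0 -> E v ->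
  exists a : R,
    dominated [set z | exists w t, H w /\ z = (w.1 + t *: v, w.2 + t * a)].
Proof.
move=> [Hp Hl] [h0 Hh0] Ev.
pose A := [set w.2 - p (w.1 - v) | w in H].
have EB w : H w -> E (w.1 - v).
  by move=> /Hp[Ew _]; rewrite -scaleN1r; apply: ED => //; exact: EZ.
have Aub w' : H w' -> ubound A (p (w'.1 + v) - w'.2).
  move=> Hw' _ [w Hw <-].
  have [_] := Hp _ (Hl 1 _ _ Hw Hw'); rewrite /= scale1r mul1r => le1.
  have := psub (EB _ Hw) (ED (Hp _ Hw').1 Ev).
  rewrite addrACA addNr addr0; lra.
have Asup : has_sup A.
  split; first by exists (h0.2 - p (h0.1 - v)); exists h0.
  by exists (p (h0.1 + v) - h0.2); exact: Aub.
have supP w : H w -> w.2 - p (w.1 - v) <= sup A.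
  by move=> Hw; apply: ub_le_sup; [case: Asup | exists w].
have Psup w : H w -> sup A <= p (w.1 + v) - w.2.
  by move=> Hw; apply: ge_sup; [case: Asup | exact: Aub].
have H00 : H (0, 0).
  have := Hl (-1) _ _ Hh0 Hh0.
  by rewrite scaleN1r mulN1r !addNr.
have HZ a w : H w -> H (a *: w.1, a * w.2).
  by move=> Hw; have := Hl a _ _ Hw H00; rewrite /= !addr0.
exists (sup A); split=> [_ [w [t [Hw ->]]]/=|
  a _ _ [w [t [Hw ->]]] [w' [t' [Hw' ->]]]]; last first.
  exists (a *: w.1 + w'.1, a * w.2 + w'.2), (a * t + t'); split; first exact: Hl.
  by rewrite /= !scalerDr scalerDl scalerA addrACA; congr pair; ring.
split; first by apply: ED; [exact: (Hp _ Hw).1 | exact: EZ].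
have [t0|t0|->] := ltgtP t 0; last first.
- by rewrite scale0r mul0r !addr0; exact: (Hp _ Hw).2.
(* Homogeneity reduces positive [t] to the coefficient 1, and in the next case negative [t] to the
   coefficient -1. *)
- have /= := Psup _ (HZ t^-1 _ Hw).
  have -> : w.1 + t *: v = t *: (t^-1 *: w.1 + v).
    by rewrite scalerDr scalerA divff ?gt_eqF// scale1r.
  rewrite phom; [|by apply: ED => //; apply: EZ; exact: (Hp _ Hw).1|exact: ltW].
  rewrite -(ler_pM2l t0) mulrBr mulrA divff ?gt_eqF// mul1r; lra.
- have tN : 0 < - t by lra.
  have /= := supP _ (HZ (- t)^-1 _ Hw).
  have -> : w.1 + t *: v = - t *: ((- t)^-1 *: w.1 - v).
    by rewrite scalerBr scalerA divff ?gt_eqF// scale1r scaleNr opprK.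
  rewrite (phom (a := - t)); [|exact: (EB _ (HZ _ _ Hw))|exact: ltW].
  rewrite -(ler_pM2l tN) mulrBr mulrA divff ?gt_eqF// mul1r; lra.
Qed.

Lemma hahn_banach : exists L : V -> R,
  [/\ forall a x y, E x -> E y -> L (a *: x + y) = a * L x + L y,
      forall x, E x -> L x <= p x & L x0 = p x0].
Proof.
(* The line through [x0] is added to every candidate: the union of an empty chain is then
   admissible, and the maximal graph takes the value [p x0] at [x0]. *)
have [|A [dA Amax]] := @Zorn_bigcup _ [set A | dominated (A `|` line)].
  move=> F FP Ftot; split=> [z|a z z'].
    case=> [[A FA Az]|lz]; last exact: dominated_line.1.
    by have [+ _] := FP _ FA; apply; left.
  case=> [[A FA Az]|lz] [[B FB Bz']|lz'].
  - have [AB|BA] := Ftot _ _ FA FB.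
    + have [_ /(_ a z z')] := FP _ FB.
      by case=> [||Bz|lz]; [left; exact: AB|left| left; exists B|right].
    + have [_ /(_ a z z')] := FP _ FA.
      by case=> [||Bz|lz]; [left|left; exact: BA|left; exists A|right].
  - have [_ /(_ a z z')] := FP _ FA.
    by case=> [||Bz|lz]; [left|right|left; exists A|right].
  - have [_ /(_ a z z')] := FP _ FB.
    by case=> [||Bz|lz'']; [right|left|left; exists B|right].
  - by right; exact: dominated_line.2.
set H := A `|` line in dA.
have lH : line `<=` H by move=> ? ?; right.
have Hx0 : H (x0, p x0) by apply: lH; exists 1; rewrite scale1r mul1r.
have Htot v : E v -> exists r, H (v, r).
  move=> Ev; have [a dH'] := extend dA (ex_intro _ _ Hx0) Ev.
  set H' := [set z | _] in dH'.
  have HH' : H `<=` H'.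
    by move=> w Hw; exists w, 0; rewrite scale0r mul0r !addr0 -surjective_pairing.
  exists a; apply: contrapT => nH.
  apply: (Amax H').
    split; first by move=> w Aw; apply: HH'; left.
    move=> H'A; apply: nH; left; apply: H'A; exists (0, 0), 1.
    rewrite /= !add0r scale1r mul1r; split=> //.
    by apply: lH; exists 0; rewrite scale0r mul0r.
  by rewrite /= setUidl// => z /lH /HH'.
have Hfun v r r' : H (v, r) -> H (v, r') -> r = r'.
  move=> Hr Hr'.
  have := (dA.1 _ (dA.2 (-1) _ _ Hr Hr')).2.
  have := (dA.1 _ (dA.2 (-1) _ _ Hr' Hr)).2.
  rewrite /= scaleN1r addNr p0; lra.
pose L v := xget 0 [set r | H (v, r)].
have HL v : E v -> H (v, L v).
  by move=> /Htot[r Hr]; rewrite /L; case: xgetP => // /(_ r).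
exists L; split=> [a x y Ex Ey|x Ex|].
- by apply: (Hfun (a *: x + y)); [apply/HL/Elin|exact: (dA.2 a _ _ (HL _ Ex) (HL _ Ey))].
- exact: (dA.1 _ (HL _ Ex)).2.
- exact: (Hfun x0 _ _ (HL _ Ex0) Hx0).
Qed.
End hahn_banach.

(** * Measures from finitely additive set functions *)

Section algebra_extension.
Variables (R : realType) (T : pointedType) (AA : set (set T)) (g : set T -> R).
Hypotheses (AA0 : AA set0) (AAU : setU_closed AA) (AAC : setC_closed AA).
Hypothesis g_ge0 : forall A, 0 <= g A.
Hypothesis gD : forall A B, A `&` B = set0 -> g (A `|` B) = g A + g B.
Hypothesis gT : g setT = 1.
Hypothesis g_sub : forall A (F : nat -> set T), AA A -> (forall n, AA (F n)) ->
  A `<=` \bigcup_n F n -> ((g A)%:E <= \sum_(n <oo) (g (F n))%:E)%E.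

Definition setalg : Type := T.

HB.instance Definition _ := Pointed.copy setalg T.
HB.instance Definition _ :=
  @isAlgebraOfSets.Build default_measure_display setalg AA AA0 AAU AAC.

Definition premeasure (A : set setalg) : \bar R := (g A)%:E.

Let premeasure_ge0 A : (0 <= premeasure A)%E.
Proof. by rewrite lee_fin g_ge0. Qed.

Let g0 : g set0 = 0.
Proof.
have := gD (setI0 set0); rewrite setU0 => /eqP.
by rewrite -subr_eq0 opprD addNKr oppr_eq0 => /eqP.
Qed.

Let premeasure_semi_additive : measure_function.semi_additive premeasure.
Proof.
move=> F n _ Ft _; rewrite /premeasure sumEFin; congr EFin.
elim: n => [|n IH]; first by rewrite !big_ord0 g0.
rewrite !big_ord_recr/= gD ?IH// -subset0 => x [].
rewrite -bigcup_mkord => -[k /= kn Fk] Fn.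
have := Ft k n I I; rewrite (_ : F k `&` F n !=set0 = True); last first.
  by apply/propext; split=> // _; exists x.
by move=> /(_ I) kE; rewrite kE ltnn in kn.
Qed.

HB.instance Definition _ := isContent.Build _ _ _ premeasure
  premeasure_ge0 premeasure_semi_additive.

Let premeasure_sub : measurable_subset_sigma_subadditive premeasure.
Proof. by move=> A F mF mA; exact: g_sub. Qed.

HB.instance Definition _ :=
  Content_SigmaSubAdditive_isMeasure.Build _ _ _ premeasure premeasure_sub.

Definition algebra_measure := measure_extension premeasure.

HB.instance Definition _ :=
  Measure.copy algebra_measure (measure_extension premeasure).

Let algebra_measureE A : AA A -> algebra_measure A = (g A)%:E.
Proof.
by move=> mA; rewrite /algebra_measure /measure_extension measurable_mu_extE.
Qed.

Let algebra_measureT : algebra_measure setT = 1%E.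
Proof. by rewrite algebra_measureE ?gT// -setC0; exact: AAC. Qed.

HB.instance Definition _ :=
  Measure_isProbability.Build _ _ _ algebra_measure algebra_measureT.

(** The extension lives on the sigma-algebra generated by [AA], over the copy [setalg] of [T];
    pushing forward along [f] transports it to the measurable structure of [S]. *)
Lemma algebra_extension d (S : measurableType d) (f : T -> S) :
    (forall B, measurable B -> <<s AA >> (f @^-1` B)) ->
  exists P : probability S R,
    forall B, measurable B -> AA (f @^-1` B) -> P B = (g (f @^-1` B))%:E.
Proof.
move=> mf.
have mfun_f : measurable_fun setT
    (f : g_sigma_algebraType (@measurable _ setalg) -> S).
  by move=> _ B mB; rewrite setTI; exact: mf.
pose F : {mfun g_sigma_algebraType (@measurable _ setalg) >-> S} :=
  HB.pack (f : _ -> _) (isMeasurableFun.Build _ _ _ _ _ mfun_f).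
exists (distribution algebra_measure F) => B mB AAB.
exact: algebra_measureE.
Qed.
End algebra_extension.

(** * Compact bases *)

(* The sets [Z k] turn a countable base into a countable supply of compact
   neighbourhoods. *)
Definition compact_base (T : topologicalType) (B Z : nat -> set T) : Prop :=
  [/\ forall k, open (B k), forall k, compact (Z k), forall k, closed (Z k),
      forall k, B k `<=` Z k
    & forall (U : set T) x, open U -> U x -> exists2 k, B k x & Z k `<=` U].

Definition has_compact_base (T : topologicalType) : Prop :=
  exists B Z : nat -> set T, compact_base B Z.

(** An injection [f] of the base into the naturals is inverted by [e], keeping only base sets with
    compact closure. These still form a base: a base set inside a compact neighbourhood has its
    closure there by the Hausdorff property. *)
Lemma second_countable_compact_base (T : topologicalType) :
  hausdorff_space T -> @second_countable T ->
  (forall (U : set T) x, open U -> U x ->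
     exists Z, [/\ compact Z, nbhs x Z & Z `<=` U]) ->
  has_compact_base T.
Proof.
move=> hT [BB /countable_injP[f finj] [BBo BBx]] lc.
pose e k := xget set0 [set V | [/\ BB V, f V = k & compact (closure V)]].
have eP k : e k = set0 \/ [/\ BB (e k), f (e k) = k & compact (closure (e k))].
  by rewrite /e; case: xgetP => [V _ []|_]; [right|left].
exists e, (fun k => closure (e k)); split=> [k|k|k|k|U x oU Ux].
- by have [->|[/BBo]] := eP k; first exact: open0.
- by have [->|[]//] := eP k; rewrite closure0; exact: compact0.
- exact: closed_closure.
- exact: subset_closure.
- have [Z [cZ xZ ZU]] := lc U x oU Ux.
  have [V [BV Vx] VZ] := BBx x Z xZ.
  have cVZ : closure V `<=` Z.
    by rewrite closureE; apply: smallest_sub => //; exact: compact_closed.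
  have cV : compact (closure V).
    by apply: subclosed_compact cZ cVZ; exact: closed_closure.
  suff eV : e (f V) = V.
    by exists (f V); rewrite eV//; exact: subset_trans ZU.
  rewrite /e; case: xgetP => [W _ [BW fW _]|/(_ V)]; last by case.
  by apply: finj; rewrite ?inE.
Qed.

Definition cube (R : realType) n (p : 'rV[R]_n) (r : R) : set 'rV[R]_n :=
  [set y | forall j, `|y 0 j - p 0 j| <= r].

Lemma compact_cube (R : realType) n (p : 'rV[R]_n) r : compact (cube p r).
Proof.
rewrite (_ : cube p r =
    [set y | forall j, `[p 0 j - r, p 0 j + r]%classic (y ord0 j)]).
  apply: (@rV_compact R n (fun j => `[p 0 j - r, p 0 j + r]%classic)) => j.
  exact: segment_compact.
by apply/seteqP; split=> y yp j; have := yp j; rewrite /= in_itv/= ler_distl.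
Qed.

Lemma ball_rVP (R : realType) n (p : 'rV[R]_n) r y : 0 < r ->
  ball p r y <-> forall j, `|y 0 j - p 0 j| < r.
Proof.
move=> r0; split=> [[_ bp] j|bp]; first by have := bp 0 j; rewrite /ball/= distrC.
by split=> // i j; rewrite ord1 /ball/= distrC.
Qed.

Lemma nbhs_cubeP (R : realType) n (p : 'rV[R]_n) (A : set 'rV[R]_n) :
  nbhs p A <-> exists2 r, 0 < r & cube p r `<=` A.
Proof.
split=> [/nbhs_ballP[r /= r0 rA]|[r r0 rA]].
  exists (r / 2); first by rewrite divr_gt0.
  move=> y yp; apply: rA; apply/ball_rVP => // j.
  by rewrite (le_lt_trans (yp j))// ltr_pdivrMr// ltr_pMr// ltr1n.
apply/nbhs_ballP; exists r => //= y /(ball_rVP _ _ r0) yp.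
by apply: rA => j; exact/ltW.
Qed.

Lemma manifold_compact_base (R : realType) (M : smoothManifold R) :
  has_compact_base M.
Proof.
apply: second_countable_compact_base;
  [exact: mfd_hausdorff|exact: mfd_second_countable|move=> U x oU Ux].
have [phi _ dx] := mfd_cover x.
have ix : (phi @` chart_dom phi) (phi x) by exists x.
have invx := chart_inv_continuous ix.
have : nbhs (phi x) ((phi @` chart_dom phi) `&` (chart_inv phi @^-1` U)).
  apply: filterI; first by apply: open_nbhs_nbhs; split=> //; exact: chart_img_open.
  by apply: invx; rewrite chart_funK//; exact: open_nbhs_nbhs.
move=> /nbhs_cubeP[r r0 rU].
exists (chart_inv phi @` cube (phi x) r); split.
- apply: continuous_compact.
    apply/continuous_in_subspaceT => y; rewrite inE => /rU[yi _].
    exact: chart_inv_continuous.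
  exact: compact_cube.
- have nx : nbhs x (chart_dom phi `&` phi @^-1` (cube (phi x) r)).
    apply: filterI; first by apply: open_nbhs_nbhs; split=> //; exact: chart_dom_open.
    by apply: chart_fun_continuous => //; by apply/nbhs_cubeP; exists r.
  apply: filterS nx => y [dy by_]; exists (phi y) => //; exact: chart_funK.
- by move=> _ [y /rU[_ Uy] <-].
Qed.

(** The sets that contain an open box around [x] form a filter converging to [x] in each coordinate
    topology, hence in their supremum, the product topology. *)
Lemma nbhs_prod_topology (I : eqType) (T : I -> topologicalType)
    (x : prod_topology T) (U : set (prod_topology T)) :
  nbhs x U -> exists V : forall i, set (T i),
    [/\ forall i, open (V i), forall i, V i (x i)
      & [set y : prod_topology T | forall i, V i (y i)] `<=` U].
Proof.
pose F : set_system (prod_topology T) := [set U | exists V : forall i, set (T i),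
    [/\ forall i, open (V i), forall i, V i (x i)
      & [set y : prod_topology T | forall i, V i (y i)] `<=` U]].
have FF : Filter F.
  split.
  - by exists (fun=> setT); split=> // i; exact: openT.
  - move=> A B [V [oV Vx VA]] [W [oW Wx WB]].
    exists (fun i => V i `&` W i); split=> [i|i|y VWy]; first exact: openI.
    + by split.
    + by split; [apply: VA => i; have [] := VWy i|apply: WB => i; have [] := VWy i].
  - by move=> A B AB [V [oV Vx VA]]; exists V; split=> //; exact: subset_trans AB.
suff : F --> x by move=> /(_ U).
apply/cvg_sup => i A; rewrite nbhsE /= => -[_ [[W oW <-] Wx] WA].
exists (@dfwith _ _ (fun i => setT) i W).
split=> [j|j|y Wy]; last by apply: WA; have := Wy i; rewrite dfwithin.
- by case: dfwithP => // *; exact: openT.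
- by case: dfwithP.
Qed.

Lemma closed_rectangle (I : eqType) (T : I -> topologicalType)
    (V : forall i, set (T i)) : (forall i, closed (V i)) ->
  closed [set y : prod_topology T | forall i, V i (y i)].
Proof.
move=> cV.
rewrite (_ : [set _ | _] =
    \bigcap_i ((fun y : prod_topology T => y i) @^-1` V i)); last first.
  by apply/seteqP; split=> [y Vy i _ /=|y Vy i]; exact: Vy.
apply: closed_bigI => i _; apply: closed_comp => // y _.
exact: (@proj_continuous _ T i).
Qed.

Lemma open_rectangle (I : finType) (T : I -> topologicalType)
    (V : forall i, set (T i)) : (forall i, open (V i)) ->
  open [set y : prod_topology T | forall i, V i (y i)].
Proof.
move=> oV; rewrite openE => y Vy; rewrite /interior.
have := @filter_forall _ _ (fun i => [set z : prod_topology T | V i (z i)]) (nbhs y).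
apply=> i; by apply: (@proj_continuous _ T i); exact: open_nbhs_nbhs.
Qed.

(** Rectangles are indexed by finite functions from [I] to the naturals, coded as numbers by
    [pickle]; numbers that code nothing give the empty set. *)
Lemma product_compact_base (I : finType) (T : I -> topologicalType) :
  (forall i, has_compact_base (T i)) -> has_compact_base (prod_topology T).
Proof.
move=> /fin_all_exists[B /fin_all_exists[Z BZ]].
pose rect (E : forall i, nat -> set (T i)) k : set (prod_topology T) :=
  if unpickle k is Some f
  then [set y | forall i, E i ((f : {ffun I -> nat}) i) (y i)] else set0.
exists (rect B), (rect Z); split=> [k|k|k|k|U x oU Ux].
- rewrite /rect; case: (unpickle k) => [f|]; last exact: open0.
  by apply: (@open_rectangle I T (fun i => B i (f i))) => i; have [] := BZ i.
- rewrite /rect; case: (unpickle k) => [f|]; last exact: compact0.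
  by apply: (@tychonoff I T (fun i => Z i (f i))) => i; have [] := BZ i.
- rewrite /rect; case: (unpickle k) => [f|]; last exact: closed0.
  by apply: (@closed_rectangle I T (fun i => Z i (f i))) => i; have [] := BZ i.
- rewrite /rect; case: (unpickle k) => [f y By i|//].
  by have [_ _ _ + _] := BZ i; apply; exact: By.
- have [V [oV Vx VU]] := nbhs_prod_topology (open_nbhs_nbhs (conj oU Ux)).
  have /choice[f fP] : forall i, exists k, B i k (x i) /\ Z i k `<=` V i.
    move=> i; have [_ _ _ _ /(_ (V i) (x i) (oV i) (Vx i))[k Bk Zk]] := BZ i.
    by exists k.
  exists (pickle [ffun i => f i]); rewrite /rect pickleK.
    by move=> i; rewrite ffunE; exact: (fP i).1.
  by move=> y Zy; apply: VU => i; apply: (fP i).2; have := Zy i; rewrite ffunE.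
Qed.

(** * Regularity of Borel probabilities *)

Section borel_probability.
Variables (R : realType) (T : ptopologicalType) (mu : probability (borel T) R).

Lemma borel_open (U : set (borel T)) : open (U : set T) -> measurable U.
Proof. by move=> oU; exact: sub_sigma_algebra. Qed.

Lemma borel_closed (F : set (borel T)) : closed (F : set T) -> measurable F.
Proof.
by move=> /closed_openC oF; rewrite -[F]setCK; apply: measurableC; exact: borel_open.
Qed.

Lemma bigcup_tail_small (C : nat -> set (borel T)) (e : R) :
  (forall k, measurable (C k)) -> 0 < e ->
  exists N, (mu (\bigcup_k C k `\` \big[setU/set0]_(k < N) C k) < e%:E)%E.
Proof.
move=> mC e0.
pose F N := \bigcup_k C k `\` \big[setU/set0]_(k < N) C k.
have mF N : measurable (F N).
  by apply: measurableD; [exact: bigcup_measurable | exact: bigsetU_measurable].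
have F0 : \bigcap_N F N = set0.
  rewrite -subset0 => x Fx; have [[k _ Ck] _] := Fx 0%N I.
  by have [_ []] := Fx k.+1 I; rewrite big_ord_recr/=; right.
have : mu \o F @ \oo --> mu (\bigcap_N F N).
  apply: nonincreasing_cvg_mu => //; last 1 first.
  - move=> M N MN; apply/subsetPset; apply: setDS.
    rewrite -!bigcup_mkord => x [k /= kM Ck]; exists k => //=.
    exact: leq_trans kM MN.
  - by rewrite (le_lt_trans (probability_le1 mu (mF 0%N)))// ltry.
  - by rewrite F0; exact: measurable0.
rewrite F0 measure0 => /fine_cvgP[_] /cvgrPdist_lt /(_ _ e0)[N _ /(_ N)].
rewrite /= leqnn => /(_ isT) HN; exists N.
rewrite -[X in (X < _)%E]fineK ?fin_num_measure//; last exact: mF.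
by rewrite lte_fin (le_lt_trans _ HN)// sub0r normrN ler_norm.
Qed.

Lemma measure_diff_trans (A B C : set (borel T)) :
  measurable A -> measurable B -> measurable C ->
  (mu (A `\` C) <= mu (A `\` B) + mu (B `\` C))%E.
Proof.
move=> mA mB mC.
apply: (@le_trans _ _ (mu ((A `\` B) `|` (B `\` C)))).
  apply: le_measure; rewrite ?inE.
  - exact: measurableD.
  - by apply: measurableU; exact: measurableD.
  - move=> x [Ax nCx]; have [Bx|nBx] := pselect (B x); [by right|by left].
exact: measureU2 (measurableD mA mB) (measurableD mB mC).
Qed.

Hypothesis cT : has_compact_base T.

Lemma open_bigcup_closed (U : set T) : open U ->
  exists C : nat -> set T, (forall k, closed (C k)) /\ U = \bigcup_k C k.
Proof.
move=> oU; have [B [Z [_ _ cZ BZ BU]]] := cT.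
exists (fun k => if `[< Z k `<=` U >] then Z k else set0); split.
  by move=> k; case: ifP => // _; exact: closed0.
apply/seteqP; split=> [x Ux|x [k _]]; last by case: ifPn => // /asboolP; apply.
have [k Bk ZU] := BU U x oU Ux; exists k => //.
by rewrite ifT; [exact: BZ|exact/asboolP].
Qed.

(** The sets that can be squeezed in this way form a sigma-algebra, and open sets qualify as
    countable unions of closed sets. *)
Lemma borel_regular (A : set (borel T)) (e : R) : measurable A -> 0 < e ->
  exists F U : set (borel T), [/\ closed (F : set T), open (U : set T),
    F `<=` A, A `<=` U & (mu (U `\` F) < e%:E)%E].
Proof.
pose reg (A : set (borel T)) := forall e : R, 0 < e ->
  exists F U : set (borel T), [/\ closed (F : set T), open (U : set T),
    F `<=` A, A `<=` U & (mu (U `\` F) < e%:E)%E].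
move=> mA; suff : <<s (@open T) >> `<=` reg by move=> /(_ A mA); apply.
apply: smallest_sub; first split.
- move=> {}e e0; exists set0, set0; split=> //;
    [exact: closed0|exact: open0|by rewrite setD0 measure0 lte_fin].
- move=> B rB {}e e0; have [F [U [cF oU FB BU UF]]] := rB e e0.
  exists (~` U), (~` F); rewrite setTD; split;
    [exact: open_closedC|exact: closed_openC|exact: subsetC|exact: subsetC|].
  by rewrite setDE setCK setIC -setDE.
- move=> B rB {}e e0.
  (* A quarter of [e] pays for cutting the union of the closed sets to a finite, hence closed, one;
     another quarter pays for the gaps between [F k] and [U k]. The half left over makes the
     inequality strict. *)
  have e20 : 0 < e / 2 / 2 by rewrite !divr_gt0.
  have ek k : 0 < e / 2 / 2 / (2 ^ k.+1)%:R.
    by rewrite divr_gt0// ltr0n expn_gt0.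
  have /choice[F /choice[U FU]] := fun k => rB k _ (ek k).
  have mF k : measurable (F k).
    by have [cF _ _ _ _] := FU k; exact: borel_closed.
  have mU k : measurable (U k).
    by have [_ oU _ _ _] := FU k; exact: borel_open.
  have [N HN] := bigcup_tail_small mF e20.
  exists (\big[setU/set0]_(k < N) F k), (\bigcup_k U k); split.
  + by apply: closed_bigsetU => k _; have [] := FU k.
  + by apply: bigcup_open => k _; have [] := FU k.
  + apply: (subset_trans (@bigsetU_bigcup _ _ _)).
    by apply: subset_bigcup => k _; have [] := FU k.
  + by apply: subset_bigcup => k _; have [] := FU k.
  apply: (@le_lt_trans _ _ ((e / 2 / 2)%:E + (e / 2 / 2)%:E)%E); last first.
    by rewrite -EFinD lte_fin -splitr ltr_pdivrMr// ltr_pMr// ltr1n.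
  apply: (le_trans (@measure_diff_trans _ (\bigcup_k F k) _ _ _ _)).
  + exact: bigcup_measurable.
  + exact: bigcup_measurable.
  + exact: bigsetU_measurable.
  apply: leeD (ltW HN).
  have mD k : measurable (U k `\` F k) by exact: measurableD.
  apply: (@le_trans _ _ (\sum_(k <oo) mu (U k `\` F k))%E).
    apply: measure_sigma_subadditive => //.
      by apply: measurableD; exact: bigcup_measurable.
    by move=> x [[k _ Uk] nF]; exists k => //; split=> // Fk; apply: nF; exists k.
  apply: le_trans (epsilon_trick0 _ (ltW e20)).
  by apply: lee_nneseries => // k _; have [_ _ _ _ /ltW] := FU k.
- move=> U oU {}e e0; have [C [cC UE]] := open_bigcup_closed oU.
  have [N] := bigcup_tail_small (fun k => borel_closed (cC k)) e0.
  rewrite -UE => HN; exists (\big[setU/set0]_(k < N) C k), U; split=> //.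
    by apply: closed_bigsetU => k _.
  by rewrite UE; exact: bigsetU_bigcup.
Qed.

(** A closed approximation is cut down by finitely many of the compact sets [Z k], which together
    exhaust the space up to measure [e / 2]. *)
Lemma inner_regular (A : set (borel T)) (e : R) : measurable A -> 0 < e ->
  exists C : set (borel T), [/\ compact (C : set T), closed (C : set T),
    C `<=` A & (mu (A `\` C) < e%:E)%E].
Proof.
move=> mA e0.
have e20 : 0 < e / 2 by rewrite divr_gt0.
have [F [U [cF oU FA AU UF]]] := borel_regular mA e20.
have [B [Z [_ kZ cZ BZ BU]]] := cT.
have [N HN] := bigcup_tail_small (fun k => borel_closed (cZ k)) e20.
have ZT : \bigcup_k Z k = setT.
  rewrite -subTset => x _; have [k Bk _] := BU setT x openT I.
  by exists k => //; exact: BZ.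
set W := \big[setU/set0]_(k < N) Z k in HN.
have cW : closed (W : set T) by apply: closed_bigsetU => k _.
have kW : compact (W : set T) by apply: bigsetU_compact => k _.
exists (F `&` W); split.
- by apply: subclosed_compact kW _ => //; exact: closedI.
- exact: closedI.
- by move=> x [/FA].
have mF := borel_closed cF; have mW := borel_closed cW.
have mU := borel_open oU.
apply: le_lt_trans (measure_diff_trans mA mF (measurableI _ _ mF mW)) _.
rewrite (splitr e) EFinD; apply: lte_leD => //.
- by rewrite fin_num_measure//; apply: measurableD => //; exact: measurableI.
- apply: le_lt_trans UF; apply: le_measure; rewrite ?inE;
    [exact: measurableD|exact: measurableD|exact: setSD].
- apply: le_trans (ltW HN); apply: le_measure; rewrite ?inE.
  + by apply: measurableD => //; exact: measurableI.
  + by apply: measurableD => //; rewrite ZT; exact: measurableT.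
  + by rewrite ZT => x [Fx nFW]; split=> // Wx; exact: nFW.
Qed.

Lemma closed_msupport : closed (msupport mu).
Proof.
rewrite -[msupport mu]setCK; apply: open_closedC; rewrite openE => x.
move=> /existsNP[U /not_implyP[oU /not_implyP[Ux U0]]].
rewrite /interior nbhsE; exists U => // y Uy /(_ U oU Uy).
exact: U0.
Qed.

(** A point off the support has a null neighbourhood, hence a null basic one, and there are only
    countably many basic sets. *)
Lemma msupport_full : mu (~` msupport mu) = 0%E.
Proof.
have [B [Z [oB _ _ BZ BU]]] := cT.
have mB k : measurable (B k : set (borel T)) by exact: borel_open.
suff : mu.-negligible (~` msupport mu).
  move=> /negligibleP; apply; apply: measurableC.
  exact: borel_closed closed_msupport.
pose N k : set (borel T) := if mu (B k) == 0%E then B k else set0.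
have nN : mu.-negligible (\bigcup_k N k).
  apply: negligible_bigcup => k; rewrite /N; case: eqP => [Bk0|_].
    exact/negligibleP.
  exact: negligible_set0.
apply: negligibleS nN => x /existsNP[U /not_implyP[oU /not_implyP[Ux]]].
rewrite measure_gt0 => /negP/negPn/eqP U0.
have [k Bk ZU] := BU U x oU Ux; exists k => //; rewrite /N ifT//.
rewrite eq_le measure_ge0 andbT -U0; apply: le_measure; rewrite ?inE//.
  exact: borel_open.
exact: subset_trans ZU.
Qed.
End borel_probability.

(** * The Kantorovich functional *)

Definition bounded_measurable d (T : measurableType d) (R : realType)
    (u : T -> R) : Prop :=
  measurable_fun setT u /\ exists B, forall x, `|u x| <= B.

Section bounded_measurable.
Context d (T : measurableType d) (R : realType) (mu : probability T R).

Lemma bounded_measurable_integrable (D : set T) (u : T -> R) :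
  measurable D -> bounded_measurable u -> mu.-integrable D (EFin \o u).
Proof.
move=> mD [mu_ [B uB]]; apply: measurable_bounded_integrable => //.
- by rewrite (le_lt_trans (probability_le1 mu mD))// ltry.
- exact: measurable_funTS.
- exists B; split=> [|r Br x _]; first exact: num_real.
  exact: le_trans (uB x) (ltW Br).
Qed.

Lemma bounded_measurable_lin (a : R) (u v : T -> R) :
  bounded_measurable u -> bounded_measurable v ->
  bounded_measurable (fun x => a * u x + v x).
Proof.
move=> [mu_ [B uB]] [mv [C vC]]; split.
  by apply: measurable_funD => //; exact: measurable_funM.
exists (`|a| * B + C) => x; apply: le_trans (ler_normD _ _) _.
by rewrite normrM lerD// ler_wpM2l.
Qed.

Lemma bounded_measurable_cst (a : R) : bounded_measurable (fun _ : T => a).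
Proof. by split; [exact: measurable_cst|exists `|a|]. Qed.

Lemma bounded_measurableZ (a : R) (u : T -> R) :
  bounded_measurable u -> bounded_measurable (fun x => a * u x).
Proof.
move=> bu; have := bounded_measurable_lin a bu (bounded_measurable_cst 0).
by under [X in bounded_measurable X -> _]eq_fun do rewrite addr0.
Qed.

Lemma bounded_measurable_indic (A : set T) : measurable A ->
  bounded_measurable (\1_A : T -> R).
Proof.
move=> mA; split; first exact: measurable_indic.
by exists 1 => x; rewrite indicE; case: (_ \in _); rewrite ?normr1 ?normr0.
Qed.
End bounded_measurable.

Section kantorovich_functional.
Context (R : realType) (I : finType) (d : I -> measure_display).
Context (T : forall i, measurableType (d i)).
Variables (mu : forall i, probability (T i) R) (K : forall i, set (T i)).
Arguments K : clear implicits.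
Hypothesis mK : forall i, measurable (K i).
Variable i0 : I.
Hypothesis Kfull : forall i, mu i (K i) = 1%E.

Local Notation X := (forall i, T i).
Let PK : set X := [set x | forall i, K i (x i)].
Let E i (u : T i -> R) : R := \int[mu i]_(x in K i) u x.

Let E_lin i (a : R) (u v : T i -> R) :
  bounded_measurable u -> bounded_measurable v ->
  E (fun x => a * u x + v x) = a * E u + E v.
Proof.
move=> bu bv; rewrite /E RintegralD//; last 2 first.
- apply: (@bounded_measurable_integrable _ _ _ _ _ (fun x => a * u x)) => //.
  exact: bounded_measurableZ.
- exact: bounded_measurable_integrable.
by rewrite RintegralZl//; exact: bounded_measurable_integrable.
Qed.

Let E_cst i (a : R) : E (fun _ : T i => a) = a.
Proof.
rewrite /E Rintegral_cst//.
by rewrite [X in fine X](Kfull i) mulr1.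
Qed.

Let E_le i (u v : T i -> R) : bounded_measurable u -> bounded_measurable v ->
  (forall x, K i x -> u x <= v x) -> E u <= E v.
Proof.
by move=> bu bv uv; apply: le_Rintegral => //; exact: bounded_measurable_integrable.
Qed.

Let E_attained i (u : T i -> R) (e : R) : bounded_measurable u -> 0 < e ->
  exists2 x, K i x & u x <= E u + e.
Proof.
move=> bu e0; apply: contrapT => nx.
have : E (fun _ : T i => E u + e) <= E u.
  apply: E_le => //; first exact: bounded_measurable_cst.
  by move=> x Kx; rewrite leNgt; apply/negP => xe; apply: nx; exists x => //; exact: ltW.
rewrite E_cst; lra.
Qed.

(** These potentials dominate [f] from above. As the functional is to be computed at [- c], this is
    the usual dual constraint with the sign reversed. *)
Let pot (f : X -> R) : set (forall i, T i -> R) :=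
  [set u | (forall i, bounded_measurable (u i)) /\
           forall x, PK x -> f x <= \sum_i u i (x i)].
Let val (f : X -> R) : set R := [set \sum_i E (u i) | u in pot f].
Let bnd (f : X -> R) : Prop := exists B, forall x, PK x -> `|f x| <= B.

(** Weak duality without any coupling: each coordinate is chosen where [u i] is at most its mean
    plus [e'], and the constraint is used at that single point. *)
Let val_lb f b : (forall x, PK x -> b <= f x) -> lbound (val f) b.
Proof.
move=> fb _ [u [bu uf] <-]; apply/ler_addgt0Pr => e e0.
have n0 : 0 < #|I|%:R + 1 :> R by rewrite ltr_wpDl.
pose e' := e / (#|I|%:R + 1).
have e'0 : 0 < e' by rewrite divr_gt0.
have /fin_all_exists2[x Kx xe] := fun i => E_attained (bu i) e'0.
apply: le_trans (fb x Kx) _; apply: le_trans (uf x Kx) _.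
apply: le_trans (ler_sum _ (fun i _ => xe i)) _.
rewrite big_split/= lerD2l sumr_const -mulr_natl mulrCA.
by apply: ler_piMr; [exact: ltW|rewrite ler_pdivrMr// mul1r lerDl].
Qed.

Let val_inf f : bnd f -> has_inf (val f).
Proof.
move=> [B fB]; split; last first.
  by exists (- B); apply: val_lb => x /fB; rewrite ler_norml => /andP[].
pose u i : T i -> R := fun _ => if i == i0 then B else 0.
exists (\sum_i E (u i)), u => //; split=> [i|x PKx].
  exact: bounded_measurable_cst.
rewrite (bigD1 i0)//= big1 ?addr0 /u ?eqxx; last by move=> i /negbTE ->.
exact: le_trans (ler_norm _) (fB x PKx).
Qed.

Let p f := inf (val f).

Let p_le f v : bnd f -> val f v -> p f <= v.
Proof. by move=> /val_inf[_ lf] fv; exact: ge_inf. Qed.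

Let le_p f b : bnd f -> lbound (val f) b -> b <= p f.
Proof. by move=> /val_inf[vf _]; exact: lb_le_inf. Qed.

Let bnd_lin (a : R) f g : bnd f -> bnd g -> bnd (fun x => a * f x + g x).
Proof.
move=> [B fB] [C gC]; exists (`|a| * B + C) => x PKx.
by rewrite (le_trans (ler_normD _ _))// normrM lerD ?gC// ler_wpM2l// fB.
Qed.

Let bnd_cst (a : R) : bnd (fun=> a).
Proof. by exists `|a|. Qed.

Let bndZ (a : R) f : bnd f -> bnd (fun x => a * f x).
Proof.
by move=> /(bnd_lin a)/(_ (bnd_cst 0)); under eq_fun do rewrite addr0.
Qed.

Let bndD f g : bnd f -> bnd g -> bnd (fun x => f x + g x).
Proof. by move=> /(bnd_lin 1) H /H; under eq_fun do rewrite mul1r. Qed.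

Let p_sub f g : bnd f -> bnd g -> p (fun x => f x + g x) <= p f + p g.
Proof.
move=> bf bg; rewrite -lerBlDr; apply: le_p => // _ [u [bu uf] <-].
rewrite lerBlDr addrC -lerBlDr; apply: le_p => // _ [w [bw wg] <-].
rewrite lerBlDr; apply: p_le; first exact: bndD.
exists (fun i x => 1 * w i x + u i x).
  split=> [i|x PKx]; first exact: bounded_measurable_lin.
  rewrite big_split/= addrC lerD ?uf//.
  by under eq_bigr do rewrite mul1r; exact: wg.
by under eq_bigr do rewrite E_lin// mul1r; rewrite big_split.
Qed.

Let pZ_le (a : R) f : bnd f -> 0 < a -> p (fun x => a * f x) <= a * p f.
Proof.
move=> bf a0; rewrite mulrC -ler_pdivrMr//; apply: le_p => // _ [u [bu uf] <-].
rewrite ler_pdivrMr//; apply: p_le; first exact: bndZ.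
exists (fun i x => a * u i x + 0).
  split=> [i|x PKx].
    by apply: (@bounded_measurable_lin _ _ _ _ _ (fun=> 0)) => //;
      exact: bounded_measurable_cst.
  by under eq_bigr do rewrite addr0; rewrite -mulr_sumr ler_pM2l// uf.
under eq_bigr => i _.
  rewrite E_lin//; last exact: bounded_measurable_cst.
  by rewrite E_cst addr0; over.
by rewrite -mulr_sumr mulrC.
Qed.

Let p0 : p (fun=> 0) = 0.
Proof.
apply/eqP; rewrite eq_le; apply/andP; split; last first.
  by apply: le_p; [exact: bnd_cst|exact: val_lb].
apply: p_le; first exact: bnd_cst.
exists (fun i _ => 0); last by rewrite big1// => i _; rewrite E_cst.
by split=> [i|x _]; [exact: bounded_measurable_cst|rewrite big1].
Qed.

Let pZ (a : R) f : bnd f -> 0 <= a -> p (fun x => a * f x) = a * p f.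
Proof.
move=> bf; rewrite le_eqVlt => /predU1P[<-|a0].
  by rewrite mul0r -[RHS]p0; congr p; apply/funext => x; rewrite mul0r.
apply/eqP; rewrite eq_le pZ_le//= -ler_pdivlMl//.
have : p (fun x => a^-1 * (a * f x)) <= a^-1 * p (fun x => a * f x).
  by apply: pZ_le; [exact: bndZ|rewrite invr_gt0].
by under eq_fun do rewrite mulKf ?gt_eqF//.
Qed.

(* Hahn-Banach is applied to the value [p] of the dual problem, so that the
   value of the functional at [- c] is exactly the dual value. *)
Lemma kantorovich_functional (c : X -> R) :
    (exists B, forall x, PK x -> `|c x| <= B) ->
  exists L : (X -> R) -> R,
  [/\ forall a f g, bnd f -> bnd g ->
        L (fun x => a * f x + g x) = a * L f + L g,
      forall f g, bnd f -> bnd g -> (forall x, PK x -> f x <= g x) ->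
        L f <= L g,
      forall i (u : T i -> R), bounded_measurable u ->
        L (fun x => u (x i)) = \int[mu i]_(x in K i) u x
    & forall e, 0 < e -> exists u : forall i, T i -> R,
      [/\ forall i, bounded_measurable (u i),
          forall x, PK x -> \sum_i u i (x i) <= c x
        & L c - e <= \sum_i \int[mu i]_(x in K i) u i x]].
Proof.
move=> bc; have bNc : bnd (fun x => -1 * c x) by exact: bndZ.
have [||||L [Llin Lp Lc]] :=
  @hahn_banach R (X -> R^o) bnd p (fun x => -1 * c x).
- by move=> a f g; exact: bnd_lin.
- by move=> f g; exact: p_sub.
- by move=> a f; exact: pZ.
- exact: bNc.
have LD a f g : bnd f -> bnd g -> L (fun x => a * f x + g x) = a * L f + L g.
  exact: Llin.
have L0 : L (fun=> 0) = 0.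
  have := LD (-1) _ _ (bnd_cst 0) (bnd_cst 0); rewrite mulr0 addr0; lra.
have LZ a f : bnd f -> L (fun x => a * f x) = a * L f.
  move=> bf; have := LD a _ _ bf (bnd_cst 0); rewrite L0 [RHS]addr0 => <-.
  by congr L; apply/funext => x; rewrite addr0.
have p_marg i (u : T i -> R) : bounded_measurable u -> p (fun x => u (x i)) <= E u.
  move=> bu; have [_ [B uB]] := bu; apply: p_le; first by exists B.
  pose w := @dfwith _ (fun j => T j -> R) (fun j _ => 0) i u.
  have wi : w i = u by exact: dfwithin.
  have wj j : j != i -> w j = fun=> 0.
    by move=> ji; rewrite /w dfwithout// eq_sym.
  exists w.
    split=> [j|x PKx].
      have [->|/wj ->] := eqVneq j i; first by rewrite wi.
      exact: bounded_measurable_cst.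
    by rewrite (bigD1 i)//= wi big1 ?addr0// => j /wj ->.
  by rewrite (bigD1 i)//= wi big1 ?addr0// => j /wj ->; rewrite E_cst.
exists L; split=> // [f g bf bg fg|i u bu|e e0].
(* Positivity: [f - g] is dominated on [PK] by the zero potentials, so its value under [p] is at
   most 0. *)
- have bh : bnd (fun x => -1 * g x + f x) by exact: bnd_lin.
  have : L (fun x => -1 * g x + f x) <= 0.
    apply: le_trans (Lp _ bh) _; apply: p_le => //.
    exists (fun i _ => 0); last by rewrite big1// => i _; rewrite E_cst.
    split=> [i|x PKx]; first exact: bounded_measurable_cst.
    by rewrite big1//; have := fg x PKx; lra.
  rewrite LD//; lra.
(* Domination by [p] at [u] and at [- u] bounds the functional by the mean from both sides. *)
- have [_ [B uB]] := bu.
  have bf : bnd (fun x => u (x i)) by exists B.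
  apply/eqP; rewrite eq_le; apply/andP; split.
    exact: le_trans (Lp _ bf) (p_marg _ _ bu).
  have bNu : bounded_measurable (fun x => -1 * u x + 0).
    by apply: (@bounded_measurable_lin _ _ _ _ _ (fun=> 0)) => //;
      exact: bounded_measurable_cst.
  have := p_marg _ _ bNu.
  rewrite E_lin//; last exact: bounded_measurable_cst.
  rewrite E_cst; have := Lp _ (bndZ (-1) bf); rewrite LZ//.
  under [in X in _ <= X -> _]eq_fun do rewrite -[_ * _]addr0.
  by rewrite /E; lra.
- have [vc _] := val_inf bNc.
  have [_ [u [bu uc] <-] up] := inf_adherent e0 (val_inf bNc).
  exists (fun i x => -1 * u i x + 0); split=> [i|x PKx|].
  + by apply: (@bounded_measurable_lin _ _ _ _ _ (fun=> 0)) => //;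
      exact: bounded_measurable_cst.
  + under eq_bigr do rewrite addr0; rewrite -mulr_sumr.
    by have := uc x PKx; lra.
  + rewrite (eq_bigr (fun i => -1 * E (u i))); last first.
      move=> i _; rewrite -[LHS]/(E (fun x => -1 * u i x + 0)) E_lin//.
        by rewrite E_cst addr0.
      exact: bounded_measurable_cst.
    rewrite -mulr_sumr; have := LZ (-1) c bc; rewrite Lc.
    by move: up; rewrite -/(p _); lra.
Qed.
(** Adding constants of sum zero gives all potentials the same supremum [a] on the [K i]; it is at
    most [B] because the suprema add up to at most [B]. The potentials are then cut from below at
    [- A]. Where one of them is cut, the others add at most [#|I| - 1] times [B], so the sum is at
    most [- 2 * B], which is below [c]. On the [K i] the cut only raises potentials, so the dual
    value does not drop. *)
Lemma potentials_truncation (c : X -> R) (B : R) (u : forall i, T i -> R) :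
    0 <= B -> (forall x, PK x -> `|c x| <= B) ->
    (forall i, bounded_measurable (u i)) ->
    (forall x, PK x -> \sum_i u i (x i) <= c x) ->
  exists w : forall i, T i -> R,
  [/\ forall i, bounded_measurable (w i),
      forall i x, `|w i x| <= (#|I|%:R + 1) * B,
      forall x, PK x -> \sum_i w i (x i) <= c x
    & \sum_i \int[mu i]_(x in K i) u i x <=
      \sum_i \int[mu i]_(x in K i) w i x].
Proof.
move=> B0 cB bu uc.
have I0 : (0 < #|I|)%N by apply/card_gt0P; exists i0.
have I1 : 1 <= #|I|%:R :> R by rewrite ler1n.
have In0 : #|I|%:R != 0 :> R by rewrite gt_eqF// (lt_le_trans ltr01).
have K_neq0 i : exists x, K i x.
  by have [x Kx _] := E_attained (bounded_measurable_cst (T i) 0) ltr01; exists x.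
pose s i := sup (u i @` K i).
have hs i : has_sup (u i @` K i).
  split; first by have [x Kx] := K_neq0 i; exists (u i x), x.
  have [_ [b ub]] := bu i; exists b => _ [x _ <-].
  exact: le_trans (ler_norm _) (ub x).
have us i x : K i x -> u i x <= s i.
  by move=> Kx; apply: ub_le_sup; [case: (hs i)|exists x].
have sB : \sum_i s i <= B.
  apply/ler_addgt0Pr => e e0; have e'0 : 0 < e / #|I|%:R.
    by rewrite divr_gt0// (lt_le_trans ltr01).
  have /fin_all_exists2[x Kx xs] : forall i, exists2 x, K i x & s i <= u i x + e / #|I|%:R.
    move=> i; have [_ [x Kx <-] sx] := sup_adherent e'0 (hs i).
    by exists x => //; rewrite -lerBlDr ltW.
  apply: le_trans (ler_sum _ (fun i _ => xs i)) _.
  rewrite big_split/= sumr_const -[X in _ + X]mulr_natr divfK// lerD2r.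
  apply: le_trans (uc x Kx) _; exact: le_trans (ler_norm _) (cB x Kx).
pose a := (\sum_i s i) / #|I|%:R.
have aB : a <= B by rewrite ler_pdivrMr ?(lt_le_trans ltr01)//; nra.
pose v i x := u i x + (a - s i).
have vK i x : K i x -> v i x <= B.
  by move=> /us; rewrite /v; lra.
have va : \sum_i (a - s i) = 0.
  by rewrite sumrB sumr_const -[X in X - _]mulr_natr divfK// subrr.
pose A := (#|I|%:R + 1) * B.
have BA : B <= A by rewrite /A; nra.
(* The upper cut at [B] acts only off [K i], where nothing else keeps [v i] below [B]. *)
pose w i x := Num.max (Num.min (v i x) B) (- A).
have wA i x : - A <= w i x <= B.
  rewrite le_max lexx orbT ge_max ge_min lexx orbT/=; lra.
have bv i : bounded_measurable (v i).
  have := bounded_measurable_lin 1 (bu i) (bounded_measurable_cst (T i) (a - s i)).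
  by under [X in bounded_measurable X -> _]eq_fun do rewrite mul1r.
have bw i : bounded_measurable (w i).
  split; last by exists A => x; rewrite ler_norml; have := wA i x; lra.
  by apply: measurable_maxr => //; apply: measurable_minr => //; have [] := bv i.
exists w; split=> //.
- by move=> i x; rewrite -/A ler_norml; have := wA i x; lra.
- move=> x PKx; have [vA|/existsNP[j vA]] := pselect (forall i, - A <= v i (x i)).
    rewrite (eq_bigr (fun i => v i (x i))); last first.
      by move=> i _; rewrite /w min_l ?vK// max_l.
    by rewrite big_split/= va addr0; exact: uc.
  move: vA => /negP; rewrite -ltNge => vA.
  have wj : w j (x j) = - A by rewrite /w min_l ?vK// max_r// ltW.
  rewrite (bigD1 j)//= wj.
  have : \sum_(i | i != j) w i (x i) <= \sum_(i | i != j) B.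
    by apply: ler_sum => i _; case/andP: (wA i (x i)).
  have : \sum_(i : I) B = #|I|%:R * B by rewrite sumr_const mulr_natl.
  rewrite (bigD1 j)//=.
  by have := cB x PKx; rewrite ler_norml /A; lra.
- apply: (@le_trans _ _ (\sum_i (E (u i) + (a - s i)))).
    by rewrite big_split/= va addr0.
  apply: ler_sum => i _; rewrite -[leRHS]/(E (w i)).
  have := E_lin 1 (bu i) (bounded_measurable_cst (T i) (a - s i)).
  rewrite E_cst mul1r => <-; apply: E_le => //.
    exact: bounded_measurable_lin (bounded_measurable_cst _ _).
  move=> x Kx; rewrite mul1r /w min_l ?vK//.
  by rewrite le_max lexx.
Qed.

End kantorovich_functional.

(** * The product of the supports *)

Lemma continuous_measurable_borel (T U : ptopologicalType) (f : T -> U) :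
  continuous f -> measurable_fun setT (f : borel T -> borel U).
Proof.
move=> /continuousP cf.
apply: (@measurability _ _ (borel T) (borel U) setT f (@open U)) => //.
move=> _ [V oV <-]; rewrite setTI; by apply: borel_open; exact: cf.
Qed.

Lemma continuous_measurable_real (R : realType) (T : ptopologicalType)
    (f : T -> R) :
  continuous f -> measurable_fun setT (f : borel T -> R).
Proof.
move=> /continuousP cf; apply: (measurability _ (RGenOpens.measurableE R)).
move=> _ [_ [a [b ->] <-]]; rewrite setTI; apply: borel_open; apply: cf.
exact: interval_open.
Qed.

Lemma prod_mfd_compact_base (R : realType) m
    (M : 'I_m.+1 -> smoothManifold R) : has_compact_base (prod_mfd M).
Proof.
exact: (@product_compact_base _ (fun i => M i : topologicalType)
  (fun i => manifold_compact_base (M i))).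
Qed.

Lemma prod_mfd_hausdorff (R : realType) m
    (M : 'I_m.+1 -> smoothManifold R) : hausdorff_space (prod_mfd M).
Proof.
exact: (@hausdorff_product _ (fun i => M i : topologicalType)
  (fun i => @mfd_hausdorff _ (M i))).
Qed.

Lemma prod_mfd_proj_continuous (R : realType) m
    (M : 'I_m.+1 -> smoothManifold R) i :
  continuous (fun x : prod_mfd M => x i).
Proof. exact: (@proj_continuous _ (fun i => M i : topologicalType) i). Qed.

Lemma prod_mfd_proj_measurable (R : realType) m
    (M : 'I_m.+1 -> smoothManifold R) i :
  measurable_fun setT ((fun x => x i) : borel (prod_mfd M) -> borel (M i)).
Proof. exact: continuous_measurable_borel (@prod_mfd_proj_continuous _ _ M i). Qed.

Lemma measurable_coordinate (R : realType) m
    (M : 'I_m.+1 -> smoothManifold R) i (u : borel (M i) -> R) :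
  measurable_fun setT u ->
  measurable_fun setT ((fun x => u (x i)) : borel (prod_mfd M) -> R).
Proof.
by move=> mu; exact: measurableT_comp mu (@prod_mfd_proj_measurable _ _ M i).
Qed.

Lemma continuous_bounded_rect (R : realType) m
    (M : 'I_m.+1 -> smoothManifold R) (c : prod_mfd M -> R)
    (K : forall i, set (M i)) : continuous c -> (forall i, compact (K i)) ->
  exists B, forall x : prod_mfd M, (forall i, K i (x i)) -> `|c x| <= B.
Proof.
move=> cc kK; pose rect := [set x : prod_mfd M | forall i, K i (x i)].
have kP : compact rect.
  exact: (@tychonoff _ (fun i => M i : topologicalType) K).
have /compact_bounded[B [_ HB]] : compact (c @` rect).
  by apply: continuous_compact kP; exact: continuous_subspaceT.
exists (B + 1) => x Kx; apply: HB; first by rewrite ltrDl.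
by exists x.
Qed.

Section support_product.
Context (R : realType) (m : nat) (M : 'I_m.+1 -> smoothManifold R).
Variable mu : forall i, probability (borel (M i)) R.
Arguments mu : clear implicits.

Definition prod_support : set (prod_mfd M) :=
  [set x | forall i, msupport (mu i) (x i)].

Lemma measurable_msupport i : measurable (msupport (mu i) : set (borel (M i))).
Proof. by apply: borel_closed; exact: closed_msupport. Qed.

Lemma msupport1 i : mu i (msupport (mu i)) = 1%E.
Proof.
have := msupport_full (mu i) (manifold_compact_base (M i)).
rewrite probability_setC; last exact: measurable_msupport.
have : mu i (msupport (mu i)) \is a fin_num.
  by rewrite fin_num_measure//; exact: measurable_msupport.
move=> /fineK <-; rewrite -EFinB => -[/eqP].
by rewrite subr_eq0 => /eqP <-.
Qed.

Lemma measurable_prod_support :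
  measurable (prod_support : set (borel (prod_mfd M))).
Proof.
apply: borel_closed.
exact: (@closed_rectangle _ (fun i => M i : topologicalType)
  (fun i => msupport (mu i)) (fun i => @closed_msupport _ _ (mu i))).
Qed.

Lemma coupling_prod_support (gamma : probability (borel (prod_mfd M)) R) :
  coupling mu gamma -> gamma (~` prod_support) = 0%E.
Proof.
move=> cg; pose N i : set (borel (prod_mfd M)) := [set x | (~` msupport (mu i)) (x i)].
have mN i : measurable (N i).
  rewrite -[N i]setTI.
  apply: (@prod_mfd_proj_measurable _ _ M i measurableT (~` msupport (mu i))).
  by apply: measurableC; exact: measurable_msupport.
have N0 i : gamma (N i) = 0%E.
  rewrite cg; last by apply: measurableC; exact: measurable_msupport.
  by apply: msupport_full; exact: manifold_compact_base.
have : gamma.-negligible (\big[setU/set0]_(i < m.+1) N i).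
  apply: big_ind => [|A B|i _]; [exact: negligible_set0|exact: negligibleU|].
  by apply/(negligibleP _ (mN i)); exact: N0.
move=> /(negligibleS _) nS; 
apply/negligibleP; first by apply: measurableC; exact: measurable_prod_support.
apply: nS => x /existsNP[i nKi]; rewrite -bigcup_seq; exists i => //=.
by rewrite mem_index_enum.
Qed.

Hypothesis mu_compact : forall i, compactly_supported (mu i).

Lemma compact_prod_support : compact prod_support.
Proof.
exact: (@tychonoff _ (fun i => M i : topologicalType) (fun i => msupport (mu i))).
Qed.

Lemma prod_support_bounded (c : prod_mfd M -> R) : continuous c ->
  exists B, forall x, prod_support x -> `|c x| <= B.
Proof.
by move=> cc; exact: continuous_bounded_rect cc mu_compact.
Qed.

Lemma prod_support_neq0 : prod_support !=set0.
Proof.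
have /fin_all_exists[x Kx] : forall i, exists x, msupport (mu i) x.
  move=> i; apply: contrapT => /forallNP nK; have := msupport1 i.
  rewrite (_ : msupport _ = set0) ?measure0.
    by move=> /eqP; rewrite eqe eq_sym oner_eq0.
  by rewrite -subset0 => x /nK.
by exists x.
Qed.
End support_product.

Section full_support_integrals.
Context (R : realType) (d : measure_display) (T : measurableType d).
Variables (P : probability T R) (K : set T).
Hypotheses (mK : measurable K) (K0 : P (~` K) = 0%E).

Lemma measure_full_support (A : set T) : measurable A -> P (A `&` K) = P A.
Proof.
move=> mA; have /= := measureDI P mA mK => ->.
suff -> : P (A `\` K) = 0%E by rewrite add0e.
apply/eqP; rewrite -measure_le0 -K0; apply: le_measure; rewrite ?inE.
- exact: measurableD.
- exact: measurableC.
- by move=> x [].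
Qed.

Lemma Rintegral_full_support_indic (A : set T) : measurable A ->
  \int[P]_(x in K) \1_A x = fine (P A).
Proof.
move=> mA; rewrite /Rintegral integral_indic//; congr fine.
exact: measure_full_support.
Qed.

End full_support_integrals.

Section prod_support_integral.
Context (R : realType) (m : nat) (M : 'I_m.+1 -> smoothManifold R).
Local Notation X := (prod_mfd M).
Variable mu : forall i, probability (borel (M i)) R.
Arguments mu : clear implicits.
Hypothesis mu_compact : forall i, compactly_supported (mu i).
Variable gamma : probability (borel X) R.
Hypothesis gamma_coupling : coupling mu gamma.
Local Notation PK := (prod_support mu).

Lemma coupling_prod_support1 : gamma PK = 1%E.
Proof.
have PK0 := coupling_prod_support gamma_coupling.
have := measure_full_support (measurable_prod_support mu) PK0 measurableT.
by rewrite setTI probability_setT.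
Qed.

Lemma prod_support_integrable (c : borel X -> R) : continuous (c : X -> R) ->
  gamma.-integrable PK (EFin \o c).
Proof.
move=> cc; have [B cB] := prod_support_bounded mu_compact cc.
have mPK := measurable_prod_support mu.
apply: measurable_bounded_integrable => //.
- by rewrite (le_lt_trans (probability_le1 gamma mPK))// ltry.
- by apply: measurable_funTS; exact: continuous_measurable_real.
- exists B; split=> [|r Br x PKx]; first exact: num_real.
  exact: le_trans (cB x PKx) (ltW Br).
Qed.

Lemma coupling_integral_support (f : borel X -> R) :
  measurable_fun setT f -> gamma.-integrable PK (EFin \o f) ->
  (\int[gamma]_x (f x)%:E = (\int[gamma]_(x in PK) f x)%:E)%E.
Proof.
move=> mf jf; have PK0 := coupling_prod_support gamma_coupling.
have mPK := measurable_prod_support mu.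
have mN : measurable (~` PK : set (borel X)) by exact: measurableC.
have jf' : gamma.-integrable setT (EFin \o f).
  apply/(negligible_integrable mN) => //; first exact/measurable_EFinP.
  by rewrite setTD setCK.
rewrite (negligible_integral mN measurableT jf' PK0) setTD setCK.
by rewrite /Rintegral fineK//; exact: integrable_fin_num.
Qed.

Lemma coupling_marginal i (u : borel (M i) -> R) : bounded_measurable u ->
  \int[gamma]_(x in PK) u (x i) = \int[mu i]_(x in msupport (mu i)) u x.
Proof.
move=> bu; have mPK := measurable_prod_support mu.
have mpi := @prod_mfd_proj_measurable _ _ M i.
have bui : bounded_measurable (fun x : borel X => u (x i)).
  have [mu_ [B uB]] := bu; split; last by exists B.
  exact: measurable_coordinate.
have := coupling_integral_support bui.1 (bounded_measurable_integrable gamma mPK bui).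
move=> /(congr1 fine)/= <-.
have mK := @measurable_msupport _ _ _ mu i.
have mN := measurableC mK.
have K0 : mu i (~` msupport (mu i)) = 0%E.
  by apply: msupport_full; exact: manifold_compact_base.
have ju := bounded_measurable_integrable (mu i) measurableT bu.
rewrite /Rintegral; congr fine.
have := negligible_integral mN measurableT ju K0.
rewrite setTD setCK => <-.
pose phi : {mfun borel X >-> borel (M i)} :=
  HB.pack (fun x : borel X => x i) (isMeasurableFun.Build _ _ _ _ _ mpi).
rewrite (@eq_measure_integral _ _ _ _ (pushforward gamma phi)).
  rewrite (integral_pushforward (phi := phi)) ?preimage_setT//.
    by apply/measurable_EFinP; exact: bu.1.
  exact: (bounded_measurable_integrable gamma measurableT bui).
by move=> A mA _; exact/esym/gamma_coupling.
Qed.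
End prod_support_integral.

(** * Rectangles and the Borel sets of the product *)

Section rectangle_algebra.
Context (R : realType) (m : nat) (M : 'I_m.+1 -> smoothManifold R).
Local Notation X := (prod_mfd M).

(* The sets decided by finitely many measurable bits of information about each
   coordinate: the algebra generated by the measurable rectangles. *)
Definition rectangle_algebra : set (set X) := [set A |
  exists (F : finType) (f : forall i, M i -> F),
    (forall i k, measurable (f i @^-1` [set k] : set (borel (M i)))) /\
    exists Q : set ('I_m.+1 -> F), A = [set x : X | Q (fun i => f i (x i))]].

Lemma rectangle_algebra0 : rectangle_algebra set0.
Proof.
exists unit, (fun _ _ => tt); split; last by exists set0.
move=> i k; rewrite (_ : _ @^-1` _ = setT) ?preimage_setT//.
by apply/seteqP; split=> // x _ /=; case: k.
Qed.

Lemma rectangle_algebraC : setC_closed rectangle_algebra.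
Proof.
move=> _ [F [f [mf [Q ->]]]]; exists F, f; split=> //.
by exists (~` Q).
Qed.

Lemma rectangle_algebraU : setU_closed rectangle_algebra.
Proof.
move=> _ _ [F [f [mf [Q ->]]]] [F' [f' [mf' [Q' ->]]]].
exists (F * F')%type, (fun i x => (f i x, f' i x)); split=> [i [k k']|].
  rewrite (_ : _ @^-1` _ = f i @^-1` [set k] `&` f' i @^-1` [set k']).
    exact: measurableI.
  by apply/seteqP; split=> x /= [] => [-> ->|-> ->].
by exists [set q : 'I_m.+1 -> F * F' |
  Q (fun i => (q i).1) \/ Q' (fun i => (q i).2)].
Qed.

Lemma rectangle_algebraI : setI_closed rectangle_algebra.
Proof.
move=> A B /rectangle_algebraC AC /rectangle_algebraC BC.
by rewrite -[A `&` B]setCK setCI; apply/rectangle_algebraC/rectangle_algebraU.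
Qed.

Lemma rectangle_algebraT : rectangle_algebra setT.
Proof. by rewrite -setC0; exact/rectangle_algebraC/rectangle_algebra0. Qed.

Lemma rectangle_algebra_rect (V : forall i, set (M i)) :
  (forall i, measurable (V i : set (borel (M i)))) ->
  rectangle_algebra [set x : X | forall i, V i (x i)].
Proof.
move=> mV; exists bool, (fun i y => `[< V i y >]); split=> [i b|].
  case: b.
    rewrite (_ : _ @^-1` _ = V i)//.
    by apply/seteqP; split=> x /asboolP.
  rewrite (_ : _ @^-1` _ = ~` V i); first exact: measurableC.
  by apply/seteqP; split=> x /=; [move=> /negbT/asboolPn|move=> /asboolPn/negbTE].
exists [set q : 'I_m.+1 -> bool | forall i, q i]; apply/seteqP; split=> x /= Vx i.
  exact/asboolP.
exact/asboolP/Vx.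
Qed.

Lemma rectangle_algebra_proj i (V : set (M i)) :
  measurable (V : set (borel (M i))) -> rectangle_algebra [set x : X | V (x i)].
Proof.
move=> mV.
pose W := @dfwith _ (fun j => set (M j)) (fun j => setT) i V.
rewrite (_ : [set x : X | V (x i)] = [set x : X | forall j, W j (x j)]).
  by apply: rectangle_algebra_rect => j; rewrite /W; case: dfwithP.
apply/seteqP; split=> x /=.
  by move=> Vx j; rewrite /W; case: dfwithP.
by move=> /(_ i); rewrite /W dfwithin.
Qed.

Lemma measurable_rect (V : forall i, set (M i)) :
  (forall i, measurable (V i : set (borel (M i)))) ->
  measurable ([set x | forall i, V i (x i)] : set (borel X)).
Proof.
move=> mV; rewrite (_ : mkset _ = \bigcap_i ((fun x : X => x i) @^-1` V i)).
  apply: fin_bigcap_measurable => // i _; rewrite -[_ @^-1` _]setTI.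
  exact: (@prod_mfd_proj_measurable _ _ M i measurableT (V i) (mV i)).
by apply/seteqP; split=> [x Vx i _ /=|x Vx i]; exact: Vx.
Qed.

Lemma rectangle_algebra_measurable (A : set X) :
  rectangle_algebra A -> measurable (A : set (borel X)).
Proof.
move=> [F [f [mf [Q ->]]]].
rewrite (_ : mkset _ = \bigcup_(q in [set q : {ffun 'I_m.+1 -> F} | Q q])
    [set x : X | forall i, (f i @^-1` [set q i]) (x i)]).
  apply: fin_bigcup_measurable => // q _.
  by apply: (@measurable_rect (fun i => f i @^-1` [set q i])) => i.
apply/seteqP; split=> [x /= Qx|x [q /= Qq fq]].
  exists [ffun i => f i (x i)] => [|i]; last by rewrite /= ffunE.
  by move: Qx; congr Q; apply/funext => i; rewrite ffunE.
by move: Qq; congr Q; apply/funext => i; rewrite [RHS]fq.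
Qed.

Lemma open_countable_rect : exists V : nat -> forall i, set (M i),
  (forall k i, open (V k i)) /\
  forall (U : set X) x, open U -> U x -> exists2 k, forall i, V k i (x i)
    & [set y : X | forall i, V k i (y i)] `<=` U.
Proof.
have /fin_all_exists[B /fin_all_exists[Z BZ]] :=
  fun i => manifold_compact_base (M i).
exists (fun k i => if unpickle k is Some f
                   then B i ((f : {ffun 'I_m.+1 -> nat}) i) else set0).
split=> [k i|U x oU Ux].
  by case: (unpickle k) => [f|]; [have [] := BZ i|exact: open0].
have [V [oV Vx VU]] := @nbhs_prod_topology _ (fun i => M i : topologicalType)
  x U (open_nbhs_nbhs (conj oU Ux)).
have /fin_all_exists2[f Bf Zf] : forall i, exists2 k, B i k (x i) & Z i k `<=` V i.
  by move=> i; have [_ _ _ _] := BZ i; apply.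
exists (pickle [ffun i => f i]); rewrite pickleK.
  by move=> i; rewrite ffunE.
move=> y By.
apply: VU => i; apply: Zf; have [_ _ _ + _] := BZ i; apply.
by have := By i; rewrite ffunE.
Qed.

(** Countability is the point: an open set is the union of those members of a countable family of
    open rectangles that it contains. *)
Lemma borel_sub_rectangle_algebra (B : set (borel X)) :
  measurable B -> <<s rectangle_algebra >> B.
Proof.
move=> mB; suff : <<s (@open X) >> `<=` <<s rectangle_algebra >> by exact.
apply: smallest_sub; first exact: smallest_sigma_algebra.
move=> U oU; have [V [oV VU]] := open_countable_rect.
pose W k : set X := [set y | forall i, V k i (y i)].
have -> : U = \bigcup_k (if `[< W k `<=` U >] then W k else set0).
  apply/seteqP; split=> [x Ux|x [k _]]; last by case: ifPn => // /asboolP; apply.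
  have [k Vx kU] := VU U x oU Ux; exists k => //.
  by rewrite ifT//; exact/asboolP.
apply: (@bigcupT_measurable _ (g_sigma_algebraType rectangle_algebra)) => k.
apply: sub_sigma_algebra; case: ifP => _; last exact: rectangle_algebra0.
by apply: rectangle_algebra_rect => i; apply: borel_open.
Qed.

End rectangle_algebra.

(** * The optimal plan *)

Section kantorovich_measure.
Context (R : realType) (m : nat) (M : 'I_m.+1 -> smoothManifold R).
Local Notation X := (prod_mfd M).
Variable mu : forall i, probability (borel (M i)) R.
Arguments mu : clear implicits.
Hypothesis mu_compact : forall i, compactly_supported (mu i).

Let PK : set X := prod_support mu.
Let bnd (f : X -> R) := exists B, forall x, PK x -> `|f x| <= B.

Variable L : (X -> R) -> R.
Hypothesis L_lin : forall (a : R) f g, bnd f -> bnd g ->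
  L (fun x => a * f x + g x) = a * L f + L g.
Hypothesis L_le : forall f g, bnd f -> bnd g ->
  (forall x, PK x -> f x <= g x) -> L f <= L g.
Hypothesis L_marg : forall i (u : borel (M i) -> R), bounded_measurable u ->
  L (fun x => u (x i)) = \int[mu i]_(x in msupport (mu i)) u x.

Let bnd_cst (a : R) : bnd (fun=> a).
Proof. by exists `|a|. Qed.

Let bnd_lin (a : R) f g : bnd f -> bnd g -> bnd (fun x => a * f x + g x).
Proof.
move=> [B fB] [C gC]; exists (`|a| * B + C) => x PKx.
by rewrite (le_trans (ler_normD _ _))// normrM lerD ?gC// ler_wpM2l// fB.
Qed.

Let bndD f g : bnd f -> bnd g -> bnd (fun x => f x + g x).
Proof. by move=> /(bnd_lin 1) H /H; under eq_fun do rewrite mul1r. Qed.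

Let bnd_indic (A : set X) : bnd (\1_A : X -> R).
Proof.
by exists 1 => x _; rewrite indicE; case: (_ \in _); rewrite ?normr1 ?normr0.
Qed.

Let bndM f g : bnd f -> bnd g -> bnd (fun x => f x * g x).
Proof.
move=> [B fB] [C gC]; exists (B * C) => x PKx.
by rewrite normrM ler_pM ?fB ?gC.
Qed.

Let LD f g : bnd f -> bnd g -> L (fun x => f x + g x) = L f + L g.
Proof.
move=> bf bg; rewrite -[in RHS](mul1r (L f)) -L_lin//.
by congr L; apply/funext => x; rewrite mul1r.
Qed.

Let L0 : L (fun=> 0) = 0.
Proof. by have := LD (bnd_cst 0) (bnd_cst 0); rewrite addr0; lra. Qed.

Let LZ a f : bnd f -> L (fun x => a * f x) = a * L f.
Proof.
move=> bf; have := L_lin a bf (bnd_cst 0); rewrite L0 [RHS]addr0 => <-.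
by congr L; apply/funext => x; rewrite addr0.
Qed.

Let L_sum (J : Type) (s : seq J) (h : J -> X -> R) : (forall j, bnd (h j)) ->
  bnd (fun x => \sum_(j <- s) h j x) /\
  L (fun x => \sum_(j <- s) h j x) = \sum_(j <- s) L (h j).
Proof.
move=> bh; elim: s => [|j s [bs IH]].
  have -> : (fun x => \sum_(j <- [::]) h j x) = fun=> 0.
    by apply/funext => x; rewrite big_nil.
  by rewrite big_nil L0.
have -> : (fun x => \sum_(j0 <- j :: s) h j0 x) =
          (fun x => h j x + \sum_(j0 <- s) h j0 x).
  by apply/funext => x; rewrite big_cons.
by rewrite big_cons -IH LD//; split=> //; exact: bndD.
Qed.

(** Since [L] acts on all functions bounded on [PK], [g] is additive on arbitrary sets, and compact
    sets outside the rectangle algebra may enter the estimates. *)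
Let g (A : set X) : R := L (\1_A : X -> R).

Let g_ge0 A : 0 <= g A.
Proof.
by rewrite -L0; apply: L_le.
Qed.

Let gD A B : A `&` B = set0 -> g (A `|` B) = g A + g B.
Proof.
move=> AB; rewrite /g -LD//; congr L; apply/funext => x.
rewrite !indicE in_setU; case: (boolP (x \in A)) => [/set_mem Ax|_] /=.
  rewrite memNset ?addr0// => Bx; have : (A `&` B) x by split.
  by rewrite AB.
by rewrite add0r.
Qed.

Let g_marg i (A : set (borel (M i))) : measurable A ->
  g [set x : X | A (x i)] = fine (mu i A).
Proof.
move=> mA; have K0 := msupport_full (mu i) (manifold_compact_base (M i)).
have mK := @measurable_msupport _ _ _ mu i.
rewrite -(Rintegral_full_support_indic mK K0 mA) -L_marg//.
exact: bounded_measurable_indic.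
Qed.

Let gT : g setT = 1.
Proof.
have -> : [set: X] = [set x : X | [set: M ord0] (x ord0)] by apply/seteqP.
by rewrite g_marg ?probability_setT//; exact: measurableT.
Qed.

Let L1 a : L (fun=> a) = a.
Proof.
rewrite -[RHS]mulr1 -gT /g -LZ//; congr L; apply/funext => x.
by rewrite indicT mulr1.
Qed.

Let AA := @rectangle_algebra R m M.

(** A set of the algebra is a finite union of rectangles whose sides are level sets of the [f i].
    Each level set is shrunk to a compact part. A point lost has some coordinate in a level set but
    off its compact part, and [g] of this event is a marginal mass, below [e / n]. *)
Let AA_inner A (e : R) : AA A -> 0 < e ->
  exists C : set X, [/\ compact C, closed C, C `<=` A & g (A `\` C) <= e].
Proof.
move=> [F [f [mf [Q ->]]]] e0.
set A' := mkset _; pose n : R := #|{: 'I_m.+1 * F}|%:R + 1.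
have n0 : 0 < n by rewrite ltr_wpDl.
have en : 0 < e / n by rewrite divr_gt0.
have /fin_all_exists[C CP] : forall i, exists C : F -> set (M i), forall k,
    [/\ compact (C k), closed (C k), C k `<=` f i @^-1` [set k]
      & (mu i ((f i @^-1` [set k]) `\` C k : set (borel (M i))) < (e / n)%:E)%E].
  move=> i; have /choice[C CP] := fun k =>
    @inner_regular _ _ (mu i) (manifold_compact_base (M i)) _ _ (mf i k) en.
  by exists C.
pose rect (q : {ffun 'I_m.+1 -> F}) : set X :=
  [set x : X | forall i, C i (q i) (x i)].
have crect q : compact (rect q).
  apply: (@tychonoff _ (fun i => M i : topologicalType) (fun i => C i (q i))) => i.
  by have [] := CP i (q i).
exists (\big[setU/set0]_(q : {ffun 'I_m.+1 -> F} | `[< Q q >]) rect q).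
have cC : compact (\big[setU/set0]_(q : {ffun 'I_m.+1 -> F} | `[< Q q >]) rect q).
  exact: bigsetU_compact.
split=> //.
- exact: compact_closed (@prod_mfd_hausdorff _ _ M) cC.
- rewrite -bigcup_seq_cond => x [q /= /andP[_ /asboolP Qq] qx].
  move: Qq; rewrite /A' /=; congr Q; apply/funext => i.
  by have [_ _ /(_ _ (qx i))/= <-] := CP i (q i).
pose h (p : 'I_m.+1 * F) : X -> R :=
  \1_[set x : X | ((f p.1 @^-1` [set p.2]) `\` C p.1 p.2) (x p.1)].
have bh p : bnd (h p) by exact: bnd_indic.
have [bs Ls] := L_sum (index_enum _) bh.
apply: (@le_trans _ _ (\sum_p L (h p))); last first.
  apply: (@le_trans _ _ (\sum_(p : 'I_m.+1 * F) (e / n))).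
    apply: ler_sum => -[i k] _; have [_ cCik _ /ltW CPik] := CP i k.
    have mN : measurable ((f i @^-1` [set k]) `\` C i k : set (borel (M i))).
      by apply: measurableD => //; exact: borel_closed.
    rewrite (_ : L (h (i, k)) = fine (mu i (f i @^-1` [set k] `\` C i k))).
      by rewrite -lee_fin fineK ?fin_num_measure.
    exact: g_marg mN.
  rewrite sumr_const -mulr_natl mulrCA.
  by apply: ler_piMr; [exact: ltW|rewrite ler_pdivrMr// mul1r lerDl].
rewrite -Ls; apply: L_le => // x _.
have h0 p : 0 <= h p x by rewrite /h indicE; case: (_ \in _).
rewrite indicE; case: (boolP (_ \in _)) => [/set_mem[A'x nCx]|_]; last exact: sumr_ge0.
pose q : {ffun 'I_m.+1 -> F} := [ffun i => f i (x i)].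
have Qq : Q q by move: A'x; congr Q; apply/funext => i; rewrite ffunE.
have /existsNP[i nCi] : ~ rect q x.
  move=> rx; apply: nCx; rewrite -bigcup_seq_cond; exists q => //=.
  by rewrite mem_index_enum; exact/asboolP.
rewrite (bigD1 (i, q i))//= -[leLHS]addr0; apply: lerD; last exact: sumr_ge0.
by rewrite /h indicE mem_set//=; split=> //=; rewrite ffunE.
Qed.

(** Compactness turns finite additivity into countable subadditivity: a compact [C] inside [A] is
    covered by the complements of closed sets [D n], which are open and only slightly larger than
    the [F n], and finitely many of them suffice. *)
Let g_sub A (F : nat -> set X) : AA A -> (forall n, AA (F n)) ->
  A `<=` \bigcup_n F n -> ((g A)%:E <= \sum_(n <oo) (g (F n))%:E)%E.
Proof.
move=> AA_A AA_F AF; apply/lee_addgt0Pr => e e0.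
have e20 : 0 < e / 2 by rewrite divr_gt0.
have ek n : 0 < e / 2 / (2 ^ n.+1)%:R by rewrite divr_gt0// ltr0n expn_gt0.
have [C [kC cC CA gC]] := AA_inner AA_A e20.
have /choice[D DP] : forall n, exists D, [/\ closed D, D `<=` ~` F n &
    g ((~` F n) `\` D) <= e / 2 / (2 ^ n.+1)%:R].
  move=> n; have [D [_ cD DF gD']] := AA_inner (rectangle_algebraC (AA_F n)) (ek n).
  by exists D.
have gV n : g (~` D n) <= g (F n) + e / 2 / (2 ^ n.+1)%:R.
  have [_ _ gDn] := DP n; apply: le_trans (lerD (lexx _) gDn).
  rewrite /g -LD//; apply: L_le => //; first exact: bndD.
  move=> x _; rewrite !indicE.
  case: (boolP (x \in ~` D n)) => [/set_mem Dx|_]; last first.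
    by rewrite addr_ge0.
  have [Fx|Fx] := pselect (F n x).
    by rewrite (mem_set (A := F n))// lerDl; case: (_ \in _).
  rewrite (mem_set (A := (~` F n) `\` D n))// lerDr; by case: (_ \in _).
have [S _ CS] : finite_subset_cover [set: nat] (fun n => ~` D n) C.
  move: kC; rewrite compact_cover; apply=> [n _|x /CA/AF[n _ Fn]].
    by apply: closed_openC; have [] := DP n.
  by exists n => // Dx; have [_ /(_ x Dx)] := DP n.
pose N := (\max_(n <- finmap.enum_fset S) n).+1.
have gA : g A <= g (A `\` C) + \sum_(0 <= n < N) g (~` D n).
  have [bs <-] := L_sum (index_iota 0 N) (fun n => bnd_indic (~` D n)).
  rewrite -LD//; apply: L_le => //; first exact: bndD.
  move=> x _; rewrite !indicE.
  have s0 (P : pred nat) : 0 <= \sum_(0 <= n < N | P n) \1_(~` D n) x :> R.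
    by apply: sumr_ge0 => n _; rewrite indicE; case: (_ \in _).
  case: (boolP (x \in A)) => [/set_mem Ax|_]; last first.
    by rewrite addr_ge0//; case: (_ \in _).
  have [Cx|nCx] := pselect (C x); last first.
    by rewrite (mem_set (A := A `\` C))// lerDl.
  rewrite (@le_trans _ _ (\sum_(0 <= n < N) \1_(~` D n) x))//; last first.
    by rewrite lerDr; case: (_ \in _).
  have [n nS Dn] := CS x Cx.
  rewrite (bigD1_seq n) ?iota_uniq//=; last first.
    by rewrite mem_index_iota/= ltnS; exact: leq_bigmax_seq.
  by rewrite indicE mem_set//= -[leLHS]addr0 lerD.
apply: (@le_trans _ _ ((e / 2)%:E +
    \sum_(0 <= n < N) (g (F n) + e / 2 / (2 ^ n.+1)%:R)%:E)%E).
  rewrite sumEFin -EFinD lee_fin; apply: le_trans gA (lerD gC _).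
  by apply: ler_sum.
have := @epsilon_trick R (fun n => (g (F n))%:E) (e / 2) xpredT
  (fun n => g_ge0 (F n)) (ltW e20).
move=> /(le_trans _) H.
rewrite [in leRHS](splitr e) [in leRHS]EFinD addeA [leRHS]addeC; apply: leeD => //.
apply: H; apply: nneseries_lim_ge => n _ _.
by rewrite lee_fin; apply: addr_ge0; [exact: g_ge0|exact/ltW].
Qed.

Let gamma_exists : exists gamma : probability (borel X) R,
  forall A, AA A -> gamma A = (g A)%:E.
Proof.
have [|P PE] := @algebra_extension R X AA g (@rectangle_algebra0 _ _ M)
  (@rectangle_algebraU _ _ M) (@rectangle_algebraC _ _ M) g_ge0 gD gT g_sub
  _ (borel X) id.
  by move=> B; exact: borel_sub_rectangle_algebra.
exists P => A AA_A; apply: PE => //; exact: rectangle_algebra_measurable.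
Qed.

Section integral.
Variable gamma : probability (borel X) R.
Hypothesis gammaE : forall A, AA A -> gamma A = (g A)%:E.

Lemma kantorovich_measure_coupling : coupling mu gamma.
Proof.
move=> i A mA; rewrite gammaE; last exact: rectangle_algebra_proj.
by rewrite g_marg// fineK// fin_num_measure.
Qed.

Let mPK : measurable (PK : set (borel X)).
Proof. exact: measurable_prod_support. Qed.

Let J (h : X -> R) : R := \int[gamma]_(x in PK) h x.

Let J_indic A : AA A -> J \1_A = g A.
Proof.
move=> AA_A; rewrite /J (@Rintegral_full_support_indic _ _ _ gamma PK)//.
- by rewrite gammaE.
- exact: coupling_prod_support kantorovich_measure_coupling.
- exact: rectangle_algebra_measurable.
Qed.

Let J_lin a (f h : borel X -> R) : bounded_measurable f -> bounded_measurable h ->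
  J (fun x => a * f x + h x) = a * J f + J h.
Proof.
move=> bf bh; rewrite /J RintegralD//; last 2 first.
- apply: (@bounded_measurable_integrable _ _ _ _ _ (fun x => a * f x)) => //.
  exact: bounded_measurableZ.
- exact: bounded_measurable_integrable.
by rewrite RintegralZl//; exact: bounded_measurable_integrable.
Qed.

(* Step functions over the algebra, for which [L] and the integral agree even
   after localization to a set of the algebra. *)
Let step (h : borel X -> R) : Prop := bounded_measurable h /\
  forall B, AA B -> L (fun x => h x * \1_B x) = J (fun x => h x * \1_B x).

Let step0 : step (fun=> 0).
Proof.
split=> [|B _]; first exact: bounded_measurable_cst.
have -> : (fun x => 0 * \1_B x) = fun _ : X => 0 :> R.
  by apply/funext => x; rewrite mul0r.
by rewrite L0 /J Rintegral_cst// mul0r.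
Qed.

Let mulb (h : borel X -> R) (B : set X) : bounded_measurable h ->
  AA B -> bounded_measurable (fun x => h x * \1_B x).
Proof.
move=> [mh [b hb]] /rectangle_algebra_measurable mB; split.
  by apply: measurable_funM => //; exact: measurable_indic.
exists b => x; rewrite indicE; case: (_ \in _); rewrite ?mulr1// mulr0 normr0.
exact: le_trans (hb x).
Qed.

Let stepU h A a : step h -> AA A ->
  step (fun x => a * \1_A x + h x * \1_(~` A) x).
Proof.
move=> [bh hE] AA_A; have AA_C := rectangle_algebraC AA_A.
have b1 : bounded_measurable (\1_A : borel X -> R).
  exact: bounded_measurable_indic (rectangle_algebra_measurable AA_A).
split=> [|B AA_B]; first by apply: bounded_measurable_lin => //; exact: mulb.
have AA_AB := rectangle_algebraI AA_A AA_B.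
have AA_CB := rectangle_algebraI AA_C AA_B.
have E : (fun x => (a * \1_A x + h x * \1_(~` A) x) * \1_B x) =
         (fun x => a * \1_(A `&` B) x + h x * \1_(~` A `&` B) x).
  by apply/funext => x; rewrite !indicI/=; ring.
have bhx D : bnd (fun x => h x * \1_D x).
  apply: bndM => //; case: bh => _ [b hb]; by exists b.
rewrite E L_lin// hE// J_lin//; last 2 first.
- exact: bounded_measurable_indic (rectangle_algebra_measurable AA_AB).
- exact: mulb.
by rewrite J_indic.
Qed.

(** The measure is tied to [L] through the algebra only. Compactness of the supports gives a step
    function uniformly close to [c] on them, and both [L] and the integral are monotone and fix
    constants. *)
Lemma kantorovich_measure_integral c : continuous c ->
  (\int[gamma]_x (c x)%:E = (L c)%:E)%E.
Proof.
move=> cc.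
have bc : bnd c by exact: prod_support_bounded.
have ic := prod_support_integrable mu_compact gamma cc.
have JPK := coupling_prod_support1 kantorovich_measure_coupling.
have J1 a : J (fun=> a) = a.
  by rewrite /J Rintegral_cst// [X in fine X]JPK mulr1.
suff JL : J c = L c.
  rewrite (coupling_integral_support kantorovich_measure_coupling _ ic) -?JL//.
  exact: continuous_measurable_real.
apply/eqP; rewrite -subr_eq0 -normr_le0; apply/ler_addgt0Pr => e' e'0.
pose e := e' / 2; have e0 : 0 < e by rewrite divr_gt0.
have /choice[V VP] : forall x : X, exists V : forall i, set (M i),
    [/\ forall i, open (V i), forall i, V i (x i)
      & forall y : X, (forall i, V i (y i)) -> `|c y - c x| <= e].
  move=> x; have /cvgrPdist_le/(_ _ e0) := cc x.
  move=> /(@nbhs_prod_topology _ (fun i => M i : topologicalType))[V [oV Vx VU]].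
  by exists V; split=> // y /VU /=; rewrite distrC.
pose W x : set X := [set y : X | forall i, V x i (y i)].
have AA_W x : AA (W x).
  apply: rectangle_algebra_rect => i; apply: borel_open.
  by have [] := VP x.
(* Each new rectangle [W x] overwrites [h] by the constant [c x], which is within [e] of [c] there;
   the earlier values stay elsewhere. *)
have stepc (s : seq X) : exists2 h, step h &
    forall y, (exists2 x, x \in s & W x y) -> `|c y - h y| <= e.
  elim: s => [|x s [h sh hc]]; first by exists (fun=> 0) => // y [].
  exists (fun y => c x * \1_(W x) y + h y * \1_(~` W x) y).
    exact: stepU.
  move=> y [z zs Wz]; rewrite indicC indicE.
  case: (boolP (y \in W x)) => [/set_mem Wy|nWy].
    by rewrite mulr1 mulr0 addr0; have [_ _] := VP x; apply.
  rewrite mulr0 mulr1 add0r; apply: hc; exists z => //.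
  move: zs; rewrite inE => /predU1P[zx|//].
  by move/negP: nWy; rewrite -zx; case; exact: mem_set.
have [S _ KS] : finite_subset_cover [set: X] W PK.
  have := compact_prod_support mu_compact; rewrite compact_cover.
  apply=> [x _|x _].
    apply: (@open_rectangle _ (fun i => M i : topologicalType)) => i.
    by have [] := VP x.
  by exists x => // i; have [] := VP x.
have [h [bh hE] hc] := stepc (finmap.enum_fset S).
have hcK y : PK y -> `|c y - h y| <= e.
  by move=> /KS[x xS Wx]; apply: hc; exists x.
have hLJ : L h = J h.
  have := hE setT (@rectangle_algebraT _ _ M).
  have -> // : (fun x => h x * \1_[set: X] x) = h.
  by apply/funext => x; rewrite indicT mulr1.
have bnh : bnd h by case: bh => _ [b hb]; exists b.
have ih := @bounded_measurable_integrable _ _ _ gamma PK h mPK bh.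
have dL : `|L c - L h| <= e.
  have Lle f1 f2 : bnd f1 -> bnd f2 ->
      (forall x, PK x -> f1 x <= f2 x + e) -> L f1 <= L f2 + e.
    move=> b1 b2 f12; rewrite -[X in _ + X](L1 e) -LD//.
    by apply: L_le => //; exact: bndD.
  rewrite ler_distlC; apply/andP; split; last first.
    by apply: Lle => // x /hcK; rewrite ler_distlC => /andP[].
  by rewrite lerBlDr; apply: Lle => // x /hcK; rewrite ler_distl lerBlDr => /andP[].
have dJ : `|J c - J h| <= e.
  have Jle (f1 f2 : borel X -> R) : gamma.-integrable PK (EFin \o f1) ->
      gamma.-integrable PK (EFin \o f2) ->
      (forall x, PK x -> f1 x <= f2 x + e) -> J f1 <= J f2 + e.
    move=> i1 i2 f12.
    have ie : gamma.-integrable PK (EFin \o (fun=> e)).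
      apply: bounded_measurable_integrable => //; exact: bounded_measurable_cst.
    rewrite -[X in _ + X](J1 e) /J -RintegralD//.
    apply: le_Rintegral => //.
    by have := integrableD mPK i2 ie; apply: eq_integrable.
  rewrite ler_distlC; apply/andP; split; last first.
    by apply: Jle => // x /hcK; rewrite ler_distlC => /andP[].
  by rewrite lerBlDr; apply: Jle => // x /hcK; rewrite ler_distl lerBlDr => /andP[].
rewrite add0r (splitr e').
rewrite (_ : J c - L c = (J c - J h) - (L c - L h)); last by rewrite hLJ; ring.
by apply: le_trans (ler_normB _ _) _; exact: lerD.
Qed.
End integral.

Lemma kantorovich_measure : exists gamma : probability (borel X) R,
  coupling mu gamma /\
  forall c, continuous c -> (\int[gamma]_x (c x)%:E = (L c)%:E)%E.
Proof.
have [gamma gammaE] := gamma_exists; exists gamma; split.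
  exact: kantorovich_measure_coupling.
exact: kantorovich_measure_integral.
Qed.

End kantorovich_measure.

(** * Optimal potentials *)

Lemma bounded_measurable_sum d (T : measurableType d) (R : realType)
    (mu : probability T R) (D : set T) (J : Type) (s : seq J) (h : J -> T -> R) :
  measurable D -> (forall j, bounded_measurable (h j)) ->
  bounded_measurable (fun x => \sum_(j <- s) h j x) /\
  \int[mu]_(x in D) (\sum_(j <- s) h j x) = \sum_(j <- s) \int[mu]_(x in D) h j x.
Proof.
move=> mD bh; elim: s => [|j s [bs IH]].
  rewrite (_ : (fun x => _) = fun=> 0); last by apply/funext => x; rewrite big_nil.
  by rewrite big_nil Rintegral_cst// mul0r; split=> //; exact: bounded_measurable_cst.
rewrite (_ : (fun x => _) = (fun x => 1 * h j x + \sum_(j0 <- s) h j0 x)); last first.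
  by apply/funext => x; rewrite big_cons mul1r.
split; first exact: bounded_measurable_lin.
under eq_Rintegral do rewrite mul1r.
by rewrite big_cons -IH RintegralD//; exact: bounded_measurable_integrable.
Qed.

(** The image filter has a cluster point in the compact segment, and for an ultrafilter a cluster
    point is a limit. *)
Lemma ultra_bounded_cvg (R : realType) (T : Type) (U : set_system T)
    (f : T -> R) (B : R) : UltraFilter U -> (forall t, `|f t| <= B) ->
  exists2 l : R, `|l| <= B & f t @[t --> U] --> l.
Proof.
move=> UU fB.
have UF : ProperFilter U by exact: ultra_proper.
have [|l [lB cl]] := @segment_compact R (- B) B (f @ U) (fmap_proper_filter _ UF).
  apply: (@filterE _ U _ (f @^-1` `[- B, B]%classic)) => t /=.
  by rewrite in_itv/= -ler_norml.
exists l; first by move: lB; rewrite /= in_itv/= -ler_norml.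
move=> V Vl; have [//|UV] := in_ultra_setVsetC (f @^-1` V) UU.
have [y [nVy Vy]] := cl (~` V) V UV Vl.
by [].
Qed.

Section optimal_plans.
Context (R : realType) (m : nat) (M : 'I_m.+1 -> smoothManifold R).
Local Notation X := (prod_mfd M).
Variable mu : forall i, probability (borel (M i)) R.
Arguments mu : clear implicits.
Hypothesis mu_compact : forall i, compactly_supported (mu i).
Variable c : X -> R.
Hypothesis c_continuous : continuous c.
Local Notation PK := (prod_support mu).

Let coupling_sum (gamma : probability (borel X) R) (w : forall i, M i -> R) :
  coupling mu gamma ->
  (forall i, bounded_measurable (w i : borel (M i) -> R)) ->
  gamma.-integrable PK (EFin \o (fun x : borel X => \sum_i w i (x i))) /\
  \int[gamma]_(x in PK) (\sum_i w i (x i)) =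
  \sum_i \int[mu i]_(x in msupport (mu i)) w i x.
Proof.
move=> cg bw; have mPK := measurable_prod_support mu.
have bwx i : bounded_measurable (fun x : borel X => w i (x i)).
  have [mw [B wB]] := bw i; split; last by exists B.
  exact: (@measurable_coordinate _ _ M i (w i)).
have [bs ->] := bounded_measurable_sum gamma (index_enum 'I_m.+1) mPK bwx.
split; first exact: bounded_measurable_integrable.
by apply: eq_bigr => i _; exact: coupling_marginal.
Qed.

(** The measure representing [L] has cost [L c], while any coupling costs at least the sum of the
    means of admissible potentials, hence at least [L c - e]. So it is optimal, and the slack of
    near-optimal potentials has a small integral under every optimal plan. *)
Lemma exists_optimal_plan : exists gamma : probability (borel X) R,
  kantorovich_solution mu c gamma /\
  exists (w : nat -> forall i, M i -> R) (A : R),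
  [/\ forall k i, bounded_measurable (w k i : borel (M i) -> R),
      forall k i x, `|w k i x| <= A,
      forall k x, PK x -> \sum_i w k i (x i) <= c x
    & forall gamma', kantorovich_solution mu c gamma' -> forall k,
        \int[gamma']_(x in PK) (c x - \sum_i w k i (x i)) <=
        2^-1 ^+ k.+1 * 2^-1 ^+ k.+1].
Proof.
have mK i := @measurable_msupport _ _ _ mu i.
have K1 i := @msupport1 _ _ _ mu i.
have mPK := measurable_prod_support mu.
have [B0 cB0] := prod_support_bounded mu_compact c_continuous.
pose B := Num.max B0 0.
have cB x : PK x -> `|c x| <= B by move=> /cB0; rewrite le_max => ->.
have B_ge0 : 0 <= B by rewrite le_max lexx orbT.
have [L [Llin Lle Lmarg Lval]] :=
  @kantorovich_functional R 'I_m.+1 _ (fun i => borel (M i)) mu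
    (fun i => msupport (mu i)) mK ord0 K1 c (ex_intro _ B cB).
have [gamma [cg Lint]] := @kantorovich_measure R m M mu mu_compact L Llin Lle Lmarg.
have mc : measurable_fun setT (c : borel X -> R).
  exact: continuous_measurable_real.
have JE (gamma' : probability (borel X) R) : coupling mu gamma' ->
    (\int[gamma']_x (c x)%:E = (\int[gamma']_(x in PK) c x)%:E)%E.
  move=> cg'; apply: (coupling_integral_support cg' mc).
  exact: prod_support_integrable.
exists gamma; split.
  split=> // gamma' cg'; rewrite Lint// JE// lee_fin.
  apply/ler_addgt0Pr => e e0; rewrite -lerBlDr.
  have [u [bu uc uL]] := Lval e e0; apply: le_trans uL _.
  have [iu <-] := coupling_sum cg' bu.
  by apply: le_Rintegral => //; exact: prod_support_integrable.
(* The square prepares Markov's inequality: the slack then exceeds [2^-1 ^+ k.+1] only on a set of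
   mass at most [2^-1 ^+ k.+1], which is summable. *)
have e0 k : 0 < 2^-1 ^+ k.+1 * 2^-1 ^+ k.+1 :> R by rewrite mulr_gt0// exprn_gt0.
pose A := (#|'I_m.+1|%:R + 1) * B.
have /choice[w wP] : forall k, exists w : forall i, M i -> R,
    [/\ forall i, bounded_measurable (w i : borel (M i) -> R),
        forall i x, `|w i x| <= A, forall x, PK x -> \sum_i w i (x i) <= c x
      & L c - 2^-1 ^+ k.+1 * 2^-1 ^+ k.+1 <=
        \sum_i \int[mu i]_(x in msupport (mu i)) w i x].
  move=> k; have [u [bu uc uL]] := Lval _ (e0 k).
  have [w [bw wA wc uw]] := @potentials_truncation R 'I_m.+1 _
    (fun i => borel (M i)) mu (fun i => msupport (mu i)) mK ord0 K1 c B u B_ge0 cB bu uc.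
  by exists w; split=> //; exact: le_trans uw.
exists w, A; split=> [k i|k i x|k x|gamma' [cg' og'] k].
- by have [] := wP k.
- by have [_ + _ _] := wP k; apply.
- by have [_ _ + _] := wP k; apply.
have [bw _ _ wL] := wP k; have [iw sw] := coupling_sum cg' bw.
rewrite RintegralB//; last exact: prod_support_integrable.
rewrite sw; have := og' _ cg; rewrite Lint// JE// lee_fin; lra.
Qed.

Lemma optimal_potentials : exists gamma : probability (borel X) R,
  kantorovich_solution mu c gamma /\
  exists (S : set (borel X)) (u : forall i, M i -> R) (A : R),
  [/\ measurable S, S `<=` PK, forall i x, `|u i x| <= A,
      forall x, PK x -> \sum_i u i (x i) <= c x
    & forall x, S x -> \sum_i u i (x i) = c x] /\
    forall gamma', kantorovich_solution mu c gamma' -> gamma' (~` S) = 0%E.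
Proof.
have [gamma [og [w [A [bw wA wc wint]]]]] := exists_optimal_plan.
exists gamma; split=> //.
have mPK := measurable_prod_support mu.
pose D k (x : borel X) := c x - \sum_i w k i (x i).
pose F k : set (borel X) := PK `&` [set x | 2^-1 ^+ k.+1 < D k x].
have mD k : measurable_fun setT (D k).
  apply: measurable_funB; first exact: continuous_measurable_real.
  apply: measurable_sum => i; have [mw _] := bw k i.
  exact: (@measurable_coordinate _ _ M i (w k i)).
have mF k : measurable (F k).
  apply: measurableI => //.
  rewrite (_ : [set x | _] = setT `&` D k @^-1` `]2^-1 ^+ k.+1, +oo[%classic).
    exact: mD.
  by rewrite setTI; apply/seteqP; split=> x /=; rewrite in_itv/= andbT.
have e0 k : 0 < 2^-1 ^+ k.+1 :> R by rewrite exprn_gt0.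
have Fsmall gamma' k : kantorovich_solution mu c gamma' ->
    (gamma' (F k) <= (2^-1 ^+ k.+1)%:E)%E.
  move=> og'; have := wint _ og' k; have [cg' _] := og'.
  have jD : gamma'.-integrable PK (EFin \o D k).
    have [jw _] := coupling_sum cg' (bw k).
    have jc := prod_support_integrable mu_compact gamma' c_continuous.
    by have := integrableB mPK jc jw; apply: eq_integrable.
  have b1 := bounded_measurable_indic R (mF k).
  have j1 : gamma'.-integrable PK (EFin \o (fun x => 2^-1 ^+ k.+1 * \1_(F k) x)).
    by apply: bounded_measurable_integrable => //; exact: bounded_measurableZ.
  have : \int[gamma']_(x in PK) (2^-1 ^+ k.+1 * \1_(F k) x) <=
         \int[gamma']_(x in PK) D k x.
    apply: le_Rintegral => // x PKx; rewrite indicE.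
    case: (boolP (x \in F k)) => [/set_mem[_ /ltW]|_]; first by rewrite mulr1.
    by rewrite mulr0 subr_ge0 wc.
  rewrite RintegralZl//; last exact: bounded_measurable_integrable.
  rewrite (Rintegral_full_support_indic mPK (coupling_prod_support cg') (mF k)).
  move=> /le_trans H /H; rewrite ler_pM2l// -lee_fin fineK//.
  by rewrite fin_num_measure.
(* This set is cut out by the potentials alone, so it serves every optimal plan. On it the slack is
   eventually at most [2^-1 ^+ k.+1]. *)
pose S : set (borel X) := PK `\` lim_sup_set F.
have mS : measurable S.
  apply: measurableD => //; apply: bigcap_measurable => //.
  by move=> n _; exact: bigcup_measurable.
have DS x : S x -> D k x @[k --> \oo] --> 0.
  move=> [PKx] /existsNP[n /not_implyP[_ nF]].
  have D0 k : 0 <= D k x by rewrite subr_ge0 wc.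
  apply: (@squeeze_cvgr _ _ _ _ (fun=> 0) (fun k => 2^-1 ^+ k.+1 : R)).
  - near=> k; rewrite D0/= leNgt; apply/negP => Dk; apply: nF.
    by exists k => //=; near: k; exact: nbhs_infty_ge.
  - exact: cvg_cst.
  - rewrite (cvg_shiftS (fun k => 2^-1 ^+ k : R)); apply: cvg_expr.
    by rewrite ger0_norm// invf_lt1// ltr1n.
(* An ultrafilter finer than convergence to infinity gives limits at all points of all factors
   simultaneously, which extracting a subsequence would not guarantee. *)
have [U [UU oU]] := ultraFilterLemma eventually_filter.
have UP : ProperFilter U by exact: ultra_proper.
have /fin_all_exists[u uP] : forall i, exists u : M i -> R, forall x,
    `|u x| <= A /\ w k i x @[k --> U] --> u x.
  move=> i.
  have /choice[u uP] : forall x, exists l : R, `|l| <= A /\ w k i x @[k --> U] --> l.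
    by move=> x; have [l lA wl] := ultra_bounded_cvg UU (fun k => wA k i x); exists l.
  by exists u.
have usum x : \sum_i w k i (x i) @[k --> U] --> \sum_i u i (x i).
  apply: (@cvg_big R 'I_m.+1 +%R 0 xpredT) => [|i _]; first exact: add_continuous.
  by have [] := uP i (x i).
exists S, u, A; split; first split=> //.
- by move=> x [].
- by move=> i x; have [] := uP i x.
- move=> x PKx; apply: (cvgr_to_le (usum x)).
  by apply: nearW => k; exact: wc.
- move=> x Sx; apply/eqP; rewrite eq_sym -subr_eq0; apply/eqP.
  apply: (@cvg_unique R (@Rhausdorff R) (D k x @[k --> U]) _).
    by apply: cvgB; [exact: cvg_cst|exact: usum].
  by move=> V /(DS x Sx)/oU.
move=> gamma' og'; have [cg' _] := og'.
have lF : gamma' (lim_sup_set F) = 0%E.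
  apply: lim_sup_set_cvg0 => //.
  apply: (@le_lt_trans _ _ 1%E); last exact: ltry.
  apply: le_trans (epsilon_trick0 xpredT ler01).
  apply: lee_nneseries => // k _; rewrite div1r natrX -exprVn.
  exact: Fsmall.
have mlF : measurable (lim_sup_set F).
  by apply: bigcap_measurable => // n _; exact: bigcup_measurable.
rewrite /S setCD; apply/negligibleP.
  by apply: measurableU => //; exact: measurableC.
apply: negligibleU; apply/negligibleP => //; first exact: measurableC.
exact: coupling_prod_support.
Unshelve. all: by end_near. Qed.
End optimal_plans.

(** * Concave functions on cubes *)

Definition concave_on (R : realType) n (C : set 'rV[R]_n) (g : 'rV[R]_n -> R) :=
  forall y z (t : R), C y -> C z -> 0 <= t <= 1 ->
    t * g y + (1 - t) * g z <= g (t *: y + (1 - t) *: z).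

Section cube_facts.
Context (R : realType) (n : nat).
Implicit Types (p y z v : 'rV[R]_n) (r s t : R).

Lemma cube_conv p r y z t : cube p r y -> cube p r z -> 0 <= t <= 1 ->
  cube p r (t *: y + (1 - t) *: z).
Proof.
move=> py pz t01 j; rewrite !mxE; have := py j; have := pz j.
rewrite !ler_norml; nra.
Qed.

Lemma cube_trans p r s y z : cube p r y -> cube y s z -> cube p (r + s) z.
Proof.
by move=> py yz j; have := py j; have := yz j; rewrite !ler_norml; lra.
Qed.

Lemma cubeS p r s : r <= s -> cube p r `<=` cube p s.
Proof. by move=> rs y py j; exact: le_trans (py j) rs. Qed.

Lemma cube_refl p r : 0 <= r -> cube p r p.
Proof. by move=> r0 j; rewrite subrr normr0. Qed.

Lemma cube_sym p r y : cube p r y -> cube y r p.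
Proof. by move=> py j; rewrite distrC. Qed.

Lemma cube_delta p t j : cube p `|t| (p + t *: delta_mx 0 j).
Proof.
move=> l; rewrite !mxE eqxx/= [X in `|X|](_ : _ = t * (l == j)%:R); last by ring.
case: eqP => _.
  by rewrite mulr1.
by rewrite mulr0 normr0.
Qed.

Lemma cubeD p r y v : cube p r y -> cube (p + v) r (y + v).
Proof. by move=> py j; rewrite !mxE opprD addrACA subrr addr0. Qed.

End cube_facts.

(* Extending the segment from [y] to [z] by [r] beyond [z] bounds the slope. *)
Lemma concave_bounded_lipschitz (R : realType) n (p : 'rV[R]_n) (r B : R)
    (g : 'rV[R]_n -> R) :
  0 < r -> concave_on (cube p (r + r)) g ->
  (forall y, cube p (r + r) y -> `|g y| <= B) ->
  forall y z d, 0 < d -> cube p r y -> cube p r z -> cube y d z ->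
    `|g y - g z| <= 2 * B / r * d.
Proof.
move=> r0 gc gB.
have half y z d : 0 < d -> cube p r y -> cube p r z -> cube y d z ->
    g y - g z <= 2 * B / r * d.
  move=> d0 py pz yz; pose w := z + (r / d) *: (z - y).
  have pw : cube p (r + r) w.
    apply: cube_trans pz _ => j; rewrite !mxE.
    rewrite [X in `|X|](_ : _ = r / d * (z 0 j - y 0 j)); last by ring.
    rewrite normrM.
    rewrite gtr0_norm ?divr_gt0// mulrAC ler_pdivrMr//.
    exact: ler_wpM2l (ltW r0) _ _ (yz j).
  have s0 : 0 < d + r by rewrite addr_gt0.
  have sn : d + r != 0 by rewrite gt_eqF.
  have py' : cube p (r + r) y by apply: cubeS py; lra.
  have := gc w y (d / (d + r)) pw py'.
  have -> : d / (d + r) *: w + (1 - d / (d + r)) *: y = z.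
    apply/rowP => j; rewrite !mxE.
    by field; rewrite sn gt_eqF.
  have t01 : 0 <= d / (d + r) <= 1.
    by apply/andP; split; [apply: divr_ge0; exact: ltW|rewrite ler_pdivrMr//; lra].
  move=> /(_ t01) H.
  have BW := gB _ pw; have BY := gB _ py'.
  have E : g y - g z <= d / (d + r) * (g y - g w) by move: H; nra.
  apply: le_trans E _; rewrite [leRHS]mulrC.
  have -> : d * (2 * B / r) = d / r * (2 * B) by ring.
  have Bge : g y - g w <= 2 * B.
    by move: BW BY; rewrite !ler_norml; lra.
  have B0 : 0 <= 2 * B.
    by rewrite mulr_ge0// (le_trans _ BY).
  apply: (@le_trans _ _ (d / (d + r) * (2 * B))).
    by rewrite ler_wpM2l// divr_ge0// ltW.
  apply: ler_wpM2r => //; apply: ler_wpM2l; first exact: ltW.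
  by rewrite lef_pV2 ?posrE//; lra.
move=> y z d d0 py pz yz; rewrite ler_norml lerNl opprB.
by rewrite !half//; exact: cube_sym.
Qed.

(** * Counting kinks on a grid *)

Lemma lebesgue_outer_ge0 (R : realType) n (A : set 'rV[R]_n) :
  (0 <= lebesgue_outer A)%E.
Proof.
apply: le_ereal_inf_tmp => _ [D [a [b [ab _ ->]]]].
apply: nneseries_ge0 => k _ _; rewrite lee_fin; apply: prodr_ge0 => j _.
by rewrite subr_ge0.
Qed.

Lemma lebesgue_outer_seq (R : realType) n (A : set 'rV[R]_n)
    (s : seq ('rV[R]_n * 'rV[R]_n)) :
  (forall q, q \in s -> forall j, q.1 0 j <= q.2 0 j) ->
  (forall x, A x -> exists2 q, q \in s & box q.1 q.2 x) ->
  (lebesgue_outer A <= (\sum_(q <- s) \prod_j (q.2 0 j - q.1 0 j))%:E)%E.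
Proof.
move=> sle sA; apply: ereal_inf_lbound.
exists (fun k => (k < size s)%N), (fun k => (nth (0, 0) s k).1),
  (fun k => (nth (0, 0) s k).2); split=> [k j|x Ax|].
- have [ks|ks] := ltnP k (size s); first by apply: sle; exact: mem_nth.
  by rewrite nth_default.
- have [q qs qx] := sA x Ax; exists (index q s) => /=; first by rewrite index_mem.
  by rewrite nth_index.
apply/esym/lim_near_cst => //.
near=> N; have sN : (size s <= N)%N by near: N; exact: nbhs_infty_ge.
rewrite -sumEFin (big_nth (0, 0)) (big_nat_widen _ _ _ _ _ sN).
by apply: eq_bigl => k.
Unshelve. all: by end_near. Qed.

Lemma sum_shift_diff (R : realType) (d : nat -> R) (k N : nat) :
  \sum_(i < N) (d (i + k)%N - d i) = \sum_(l < k) (d (N + l)%N - d l).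
Proof.
elim: N => [|N IH].
  by rewrite big_ord0 big1// => l _; rewrite add0n subrr.
have : \sum_(l < k) d (N + l)%N + d (N + k)%N =
       d N + \sum_(l < k) d (N.+1 + l)%N.
  transitivity (\sum_(l < k.+1) d (N + l)%N); first by rewrite big_ord_recr.
  by rewrite big_ord_recl addn0; under eq_bigr do rewrite addnS.
rewrite big_ord_recr/= IH !sumrB; lra.
Qed.

(** Second differences telescope with stride [k]: only [k] increments survive at each end, each of
    size at most [D]. The bound does not grow with [N], so the number of kinked cells in a column
    stays bounded when the grid is refined. *)
Lemma sum_second_diff_ge (R : realType) (b : nat -> R) (k N : nat) (D : R) :
  (forall i, (i <= N + k)%N -> `|b (i + k)%N - b i| <= D) ->
  - (2 * k%:R * D) <=
    \sum_(i < N) (b (i + k + k)%N + b i - 2 * b (i + k)%N).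
Proof.
move=> bD; pose d i := b (i + k)%N - b i.
rewrite (eq_bigr (fun i : 'I_N => d (i + k)%N - d i)); last first.
  by move=> i _; rewrite /d; ring.
rewrite sum_shift_diff.
have -> : - (2 * k%:R * D) = \sum_(l < k) (- (2 * D)).
  by rewrite sumr_const card_ord -mulr_natl; ring.
apply: ler_sum => l _.
have := bD (N + l)%N; rewrite leq_add2l => /(_ (ltnW (ltn_ord l))).
have := bD l; rewrite (leq_trans (ltnW (ltn_ord l)) (leq_addl _ _)) => /(_ isT).
by rewrite !ler_norml /d; lra.
Qed.

Lemma grid_index (R : realType) (w s : R) (N : nat) : 0 < w -> 0 <= s ->
  s <= N.+1%:R * w -> exists i : 'I_N.+1, i%:R * w <= s <= (i%:R + 1) * w.
Proof.
move=> w0 s0; elim: N => [|N IH] sN.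
  by exists ord0; rewrite mul0r s0/= add0r.
have [/IH[i iP]|Ns] := leP s (N.+1%:R * w).
  by exists (widen_ord (leqnSn _) i).
exists ord_max; rewrite /= ltW//=.
by move: sN; rewrite -natr1.
Qed.

Section second_difference.
Context (R : realType) (n : nat) (g : 'rV[R]_n -> R) (j : 'I_n).

Definition second_diff (y : 'rV[R]_n) (h : R) :=
  g (y + h *: delta_mx 0 j) + g (y - h *: delta_mx 0 j) - 2 * g y.

(* For concave [g]: the slope along the [j]-th axis drops by at least [eps]. *)
Definition kink_set (p : 'rV[R]_n) (r eps : R) : set 'rV[R]_n :=
  [set x | cube p r x /\ forall h, 0 < h <= r -> second_diff x h <= - (eps * h)].

End second_difference.

Section kinks.
Context (R : realType) (n : nat).
Variables (p : 'rV[R]_n.+1) (r : R) (g : 'rV[R]_n.+1 -> R) (Lc : R) (j : 'I_n.+1).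
Local Notation e := (delta_mx 0 j : 'rV[R]_n.+1).
Local Notation second_diff := (second_diff g j).
Local Notation kink_set := (kink_set g j p r).

Hypothesis r0 : 0 < r.
Hypothesis Lc0 : 0 <= Lc.
Hypothesis g_lip : forall y z d, 0 < d -> cube p (r + r) y ->
  cube p (r + r) z -> cube y d z -> `|g y - g z| <= Lc * d.
Hypothesis g_mid : forall y h, 0 < h -> cube p (r + r) (y + h *: e) ->
  cube p (r + r) (y - h *: e) -> second_diff y h <= 0.

Let step_in_cube y h : cube p r y -> `|h| <= r -> cube p (r + r) (y + h *: e).
Proof.
move=> py hr; apply: cube_trans py _; apply: cubeS hr _ _.
exact: cube_delta.
Qed.

(** The factor 4 adds up the weights 1, 1 and 2 of the three values in a second difference. *)
Let second_diff_lip x y h d : 0 < d -> `|h| <= r -> cube p r x -> cube p r y ->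
  cube x d y -> second_diff y h <= second_diff x h + 4 * (Lc * d).
Proof.
move=> d0 hr px py xy.
have S (v : 'rV[R]_n.+1) : cube p (r + r) (x + v) -> cube p (r + r) (y + v) ->
    `|g (x + v) - g (y + v)| <= Lc * d.
  by move=> pxv pyv; apply: g_lip => //; exact: cubeD.
have := S (h *: e) (step_in_cube px hr) (step_in_cube py hr).
have hr' : `|- h| <= r by rewrite normrN.
have := S (- h *: e) (step_in_cube px hr') (step_in_cube py hr').
have pS z : cube p r z -> cube p (r + r) z by apply: cubeS; rewrite lerDl ltW.
have := g_lip d0 (pS _ px) (pS _ py) xy.
by rewrite !ler_norml /second_diff scaleNr; lra.
Qed.

(** For each fixed step the defining inequality is closed, as second differences are Lipschitz in
    the base point. Closedness later makes the image of this set in the manifold compact, hence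
    Borel. *)
Lemma closed_kink_set eps : closed (kink_set eps).
Proof.
rewrite -[kink_set eps]setCK; apply: open_closedC; rewrite openE => x nx.
rewrite /interior; have [px|npx] := pselect (cube p r x); last first.
  apply/nbhs_cubeP; move: npx => /existsNP[l /negP]; rewrite -ltNge => pl.
  exists ((`|x 0 l - p 0 l| - r) / 2); first by rewrite divr_gt0// subr_gt0.
  move=> y /(_ l) yx [/(_ l) yp _].
  have := ler_normB (y 0 l - p 0 l) (y 0 l - x 0 l).
  rewrite [X in `|X| <= _](_ : _ = x 0 l - p 0 l); last by ring.
  by move: yx yp pl; lra.
have /existsNP[h /not_implyP[h0r /negP]] : ~ forall h, 0 < h <= r ->
    second_diff x h <= - (eps * h) by move=> H; exact: nx.
rewrite -ltNge => xh.
have hr : `|h| <= r by rewrite gtr0_norm; case/andP: h0r.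
(* Moving the base point by [d] changes the second difference by at most half of its excess over
   [- (eps * h)]. *)
pose d := (second_diff x h + eps * h) / (4 * Lc + 1) / 2.
have L1 : 0 < 4 * Lc + 1 by have := Lc0; lra.
have d0 : 0 < d by rewrite !divr_gt0//; lra.
apply/nbhs_cubeP; exists d => // y xy [py /(_ h h0r) yh].
have := second_diff_lip d0 hr py px (cube_sym xy).
have : 4 * (Lc * d) <= (second_diff x h + eps * h) / 2.
  rewrite /d.
  have -> : 4 * (Lc * ((second_diff x h + eps * h) / (4 * Lc + 1) / 2)) =
    (4 * Lc / (4 * Lc + 1)) * ((second_diff x h + eps * h) / 2) by ring.
  by rewrite ler_piMl//; [rewrite divr_ge0//; lra|rewrite ler_pdivrMr//; lra].
lra.
Qed.

Section grid.
Variables (N k : nat) (eps : R).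
Local Notation w := (2 * r / N.+1%:R).
Hypothesis k_eps : 4 * Lc + 1 <= k%:R * eps.
Hypothesis kw : k%:R * w <= r.

Let w0 : 0 < w.
Proof. by rewrite divr_gt0// mulr_gt0. Qed.

Let Nw : N.+1%:R * w = 2 * r.
Proof. by rewrite mulrCA divff ?mulr1// pnatr_eq0. Qed.

Let k0 : 0 < k%:R :> R.
Proof.
rewrite ltr0n lt0n; apply/eqP => k00; move: k_eps Lc0; rewrite k00 mul0r; lra.
Qed.

(** Grid points of spacing [w], counted from the lowest corner of the cube: [q] selects a column
    parallel to axis [j], and the height [t] is real so that nodes below the cube make sense. *)
Let node (q : {ffun 'I_n -> 'I_N.+1}) (t : R) : 'rV[R]_n.+1 :=
  \row_l (p 0 l - r + (if unlift j l is Some l' then (q l')%:R else t) * w).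

Let nodeD q s t : node q (t + s) = node q t + (s * w) *: e.
Proof.
apply/rowP => l; rewrite !mxE eqxx/=; case: unliftP => [l' ->|->].
  by rewrite eq_sym (negbTE (neq_lift _ _)) mulr0 addr0.
by rewrite eqxx mulr1; ring.
Qed.

Let natw i : (i <= N.+1)%N -> 0 <= i%:R * w <= 2 * r.
Proof.
move=> iN; apply/andP; split; first by rewrite mulr_ge0// ltW.
by rewrite -[leRHS]Nw ler_pM2r// ler_nat.
Qed.

Let node_in q (i : nat) : (i <= N.+1)%N -> cube p r (node q i%:R).
Proof.
move=> iN l; rewrite mxE; set s := _ * w.
suff /andP[] : 0 <= s <= 2 * r by rewrite ler_norml; lra.
rewrite /s; case: unliftP => [l' _|_]; last exact: natw.
exact/natw/ltnW.
Qed.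

Let cell q (i : 'I_N.+1) : set 'rV[R]_n.+1 :=
  box (node q i%:R) (node q i%:R + const_mx w).

Let bad q i : bool := `[< exists2 x, kink_set eps x & cell q i x >].

(** By the choice of [k], the kink at step [k%:R * w], of size at least [eps * (k%:R * w)], exceeds
    by [w] the error [4 * (Lc * w)] of moving from a kinked point to the corner of its cell. *)
Let bad_diff q i : bad q i -> second_diff (node q i%:R) (k%:R * w) <= - w.
Proof.
move=> /asboolP[x [px xk] xc].
have pn : cube p r (node q i%:R) by exact/node_in/ltnW.
have kw0 : 0 < k%:R * w by rewrite mulr_gt0.
have kwr : `|k%:R * w| <= r by rewrite gtr0_norm.
have xn : cube x w (node q i%:R).
  move=> l; have := xc l; rewrite !mxE ler_norml; move: w0.
  by move: (2 * r / N.+1%:R) => W; lra.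
have := second_diff_lip w0 kwr px pn xn.
have := xk (k%:R * w); rewrite kw0 kw => /(_ isT).
have : (4 * Lc + 1) * w <= (k%:R * eps) * w by rewrite ler_pM2r.
by move: (2 * r / N.+1%:R) => W; lra.
Qed.

Let second_diff_node q (i : nat) : (i <= N.+1)%N ->
  second_diff (node q i%:R) (k%:R * w) <= 0.
Proof.
move=> iN; have kw0 : 0 < k%:R * w by rewrite mulr_gt0.
apply: g_mid => //.
  by apply: step_in_cube; [exact: node_in|rewrite gtr0_norm].
by rewrite -scaleNr; apply: step_in_cube; [exact: node_in|rewrite normrN gtr0_norm].
Qed.

(** Each bad cell adds at least [w] to minus the sum of second differences along the column, the
    other cells add something nonnegative by [g_mid], and the total is at most
    [2 * k%:R * (Lc * (k%:R * w))]. Dividing by [w] leaves a count independent of the grid. *)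
Let column_bound q : \sum_(i < N.+1) (bad q i)%:R <= 2 * k%:R * (Lc * k%:R) :> R.
Proof.
have kw0 : 0 < k%:R * w by rewrite mulr_gt0.
(* The shift by [k] gives natural indices to the second differences at the first nodes, which reach
   below the cube. *)
pose b (i : nat) := g (node q (i%:R - k%:R)).
have bE (i : nat) : second_diff (node q i%:R) (k%:R * w) =
    b (i + k + k)%N + b i - 2 * b (i + k)%N.
  rewrite /second_diff -nodeD -scaleNr -mulNr -nodeD /b !natrD.
  by congr (g (node q _) + _ - 2 * g (node q _)); ring.
have inc (i : nat) : (i <= N.+1 + k + k)%N -> cube p (r + r) (node q (i%:R - k%:R)).
  move=> iN l; rewrite mxE; case: unliftP => [l' _|_].
    have /andP[] := natw (ltnW (ltn_ord (q l'))); rewrite ler_norml.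
    by move: (2 * r / N.+1%:R) => W; lra.
  have : 0 <= i%:R * w <= 2 * r + k%:R * w + k%:R * w.
    apply/andP; split; first by rewrite mulr_ge0// ltW.
    by rewrite -[X in _ <= X + _ + _]Nw -!mulrDl ler_pM2r// -!natrD ler_nat.
  rewrite mulrBl ler_norml; move: kw kw0.
  by move: (2 * r / N.+1%:R) => W; lra.
have bD (i : nat) : (i <= N.+1 + k)%N -> `|b (i + k)%N - b i| <= Lc * (k%:R * w).
  move=> iN; apply: g_lip => //.
  - by apply: inc; rewrite leq_add2r.
  - by apply: inc; exact: leq_trans (leq_addr _ _).
  - have := cube_delta (node q i%:R) (- k%:R * w) j.
    by rewrite -nodeD mulNr normrN gtr0_norm// natrD addrK.
have H := sum_second_diff_ge bD.
rewrite -(ler_pM2r w0) mulr_suml.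
have : \sum_(i < N.+1) ((bad q i)%:R * w) <=
       \sum_(i < N.+1) - second_diff (node q i%:R) (k%:R * w).
  apply: ler_sum => i _; case: (boolP (bad q i)) => [/bad_diff|_].
    by rewrite mul1r lerNr.
  by rewrite mul0r oppr_ge0; exact/second_diff_node/ltnW.
move=> /le_trans; apply.
under eq_bigr do rewrite bE.
rewrite sumrN lerNl; apply: le_trans H.
by rewrite le_eqVlt; apply/orP; left; apply/eqP; ring.
Qed.

(** There are [N.+1 ^ n] columns, each with boundedly many bad cells of volume [w ^+ n.+1], so one
    factor [w] is left over. *)
Lemma kink_set_outer_le : (lebesgue_outer (kink_set eps) <=
  (w * ((2 * r) ^+ n * (2 * k%:R * (Lc * k%:R))))%:E)%E.
Proof.
pose cells := [seq qi <- enum (({ffun 'I_n -> 'I_N.+1} * 'I_N.+1)%type : finType) |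
  bad qi.1 qi.2].
pose s := [seq (node qi.1 (qi.2 : 'I_N.+1)%:R,
                node qi.1 (qi.2 : 'I_N.+1)%:R + const_mx w) | qi <- cells].
apply: le_trans (@lebesgue_outer_seq _ _ _ s _ _) _.
- by move=> _ /mapP[qi _ ->] l; rewrite /= !mxE lerDl ltW.
- move=> x xk; have [px _] := xk.
  have /fin_all_exists[f fP] : forall l, exists i : 'I_N.+1,
      i%:R * w <= x 0 l - (p 0 l - r) <= (i%:R + 1) * w.
    move=> l; have := px l; rewrite ler_norml => pl.
    by apply: grid_index; rewrite ?Nw//; lra.
  pose q : {ffun 'I_n -> 'I_N.+1} := [ffun l => f (lift j l)].
  have xc : cell q (f j) x.
    move=> l; rewrite !mxE; case: unliftP => [l' ->|->].
      rewrite ffunE; have := fP (lift j l').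
      by move: (2 * r / N.+1%:R) => W; lra.
    by have := fP j; move: (2 * r / N.+1%:R) => W; lra.
  exists (node q (f j)%:R, node q (f j)%:R + const_mx w); last exact: xc.
  apply/mapP; exists (q, f j) => //; rewrite mem_filter mem_enum andbT.
  by apply/asboolP; exists x.
rewrite lee_fin big_map big_filter big_enum_cond/=.
rewrite (eq_bigr (fun=> w ^+ n.+1)); last first.
  move=> qi _; rewrite (eq_bigr (fun=> w)); last first.
    by move=> l _; rewrite !mxE addrAC subrr add0r.
  by rewrite prodr_const card_ord.
rewrite big_mkcond/= (eq_bigr (fun qi => (bad qi.1 qi.2)%:R * w ^+ n.+1)); last first.
  by move=> qi _; case: ifP; rewrite ?mul1r ?mul0r.
rewrite -mulr_suml -(pair_bigA _ (fun q i => (bad q i)%:R))/=.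
apply: (@le_trans _ _ ((\sum_(q : {ffun 'I_n -> 'I_N.+1})
    2 * k%:R * (Lc * k%:R)) * w ^+ n.+1)).
  rewrite ler_pM2r ?exprn_gt0//; apply: ler_sum => q _; exact: column_bound.
have -> : (2 * r) ^+ n = N.+1%:R ^+ n * w ^+ n by rewrite -exprMn Nw.
rewrite sumr_const card_ffun !card_ord -[X in X * _ <= _]mulr_natr natrX exprS.
by rewrite le_eqVlt; apply/orP; left; apply/eqP; ring.
Qed.
End grid.

Lemma kink_set_null eps : 0 < eps -> lebesgue_outer (kink_set eps) = 0%E.
Proof.
move=> eps0; apply/eqP; rewrite eq_le lebesgue_outer_ge0 andbT.
apply/lee_addgt0Pr => eta eta0; rewrite add0e.
pose k := Num.bound ((4 * Lc + 1) / eps).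
have k_eps : 4 * Lc + 1 <= k%:R * eps.
  rewrite -ler_pdivrMr// ltW//; apply: archi_boundP.
  by apply: divr_ge0; [have := Lc0; lra|exact: ltW].
pose C := (2 * r) ^+ n * (2 * k%:R * (Lc * k%:R)).
have C0 : 0 <= C by rewrite !mulr_ge0// exprn_ge0// mulr_ge0// ltW.
(* The summand [2 * k] makes [k] grid steps fit into [r]; the other one brings the bound below
   [eta]. *)
pose N := (2 * k + Num.bound (2 * r * C / eta))%N.
have N0 : 0 < N.+1%:R :> R by rewrite ltr0n.
have kw : k%:R * (2 * r / N.+1%:R) <= r.
  rewrite mulrA ler_pdivrMr// mulrA [k%:R * 2]mulrC [leRHS]mulrC.
  apply: ler_wpM2r; first exact: ltW.
  by rewrite -natrM ler_nat -addnS leq_addr.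
have H := kink_set_outer_le k_eps kw.
apply: (le_trans H).
rewrite lee_fin -/C mulrAC ler_pdivrMr// [leRHS]mulrC -ler_pdivrMr//.
have : 2 * r * C / eta < (Num.bound (2 * r * C / eta))%:R.
  apply: archi_boundP; apply: divr_ge0; last exact: ltW.
  by rewrite mulr_ge0// mulr_ge0// ltW.
move=> /ltW H'; apply: (le_trans H'); rewrite ler_nat.
by rewrite /N -addnS; apply: leq_trans (leq_addl _ _); rewrite leqnSn.
Qed.
End kinks.

Lemma concave_on_second_diff (R : realType) n (C : set 'rV[R]_n) g j y h :
  concave_on C g -> C (y + h *: delta_mx 0 j) -> C (y - h *: delta_mx 0 j) ->
  second_diff g j y h <= 0.
Proof.
move=> gc Cp Cm; have := gc _ _ (2^-1) Cp Cm.
have t01 : 0 <= (2^-1 : R) <= 1 by lra.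
have -> : 2^-1 *: (y + h *: delta_mx 0 j) + (1 - 2^-1) *: (y - h *: delta_mx 0 j) = y.
  by apply/rowP => l; rewrite !mxE; lra.
by move=> /(_ t01); rewrite /second_diff; lra.
Qed.

(** The radii are nested: a bound on radius [4 * r] gives a Lipschitz constant on radius [2 * r],
    which leaves room for steps up to [r] from points of the cube of radius [r]. *)
Lemma concave_kink_set (R : realType) n (p : 'rV[R]_n) (r B : R)
    (g : 'rV[R]_n -> R) (j : 'I_n) (eps : R) :
  0 < r -> 0 < eps -> concave_on (cube p (4 * r)) g ->
  (forall y, cube p (4 * r) y -> `|g y| <= B) ->
  closed (kink_set g j p r eps) /\ lebesgue_outer (kink_set g j p r eps) = 0%E.
Proof.
case: n => [|n] in p g j *; first by case: j.
move=> r0 eps0; have -> : 4 * r = (r + r) + (r + r) by ring.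
move=> gc gB; have rr0 : 0 < r + r by rewrite addr_gt0.
have B0 : 0 <= B.
  by apply: le_trans (gB p _) => //; apply: cube_refl; rewrite ltW// addr_gt0.
have L0 : 0 <= 2 * B / (r + r) by rewrite divr_ge0 ?mulr_ge0// ltW.
have lip := concave_bounded_lipschitz rr0 gc gB.
have mid y h : 0 < h -> cube p (r + r) (y + h *: delta_mx 0 j) ->
    cube p (r + r) (y - h *: delta_mx 0 j) -> second_diff g j y h <= 0.
  have sub : cube p (r + r) `<=` cube p (r + r + (r + r)).
    by apply: cubeS; rewrite lerDl ltW.
  by move=> _ /sub yp /sub ym; exact: (concave_on_second_diff gc yp ym).
split; first by apply: (closed_kink_set r0 L0 lip).
by apply: (kink_set_null r0 L0 lip mid).
Qed.

(** * Supergradients at kink-free points *)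

Lemma concave_mean (R : realType) n (C : set 'rV[R]_n) (g : 'rV[R]_n -> R)
    (s : seq 'rV[R]_n) :
  (forall y z (t : R), C y -> C z -> 0 <= t <= 1 -> C (t *: y + (1 - t) *: z)) ->
  concave_on C g -> (forall y, y \in s -> C y) -> (0 < size s)%N ->
  C ((size s)%:R^-1 *: \sum_(y <- s) y) /\
  (size s)%:R^-1 * \sum_(y <- s) g y <= g ((size s)%:R^-1 *: \sum_(y <- s) y).
Proof.
move=> Cc gc; elim: s => // y s IH Cs _.
case: s => [|z s] in IH Cs *.
  by rewrite /= !big_seq1 invr1 scale1r mul1r; split=> //; apply: Cs; rewrite inE.
have [||Cm gm] := IH; [by move=> x xs; apply: Cs; rewrite inE xs orbT|by []|].
set k : R := (size (z :: s))%:R in Cm gm *.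
have k0 : 0 < k by rewrite ltr0n.
have -> : (size (y :: z :: s))%:R = k + 1 :> R by rewrite natr1.
have k1 : 0 < k + 1 by rewrite addr_gt0.
have Cy : C y by apply: Cs; rewrite inE eqxx.
have t01 : 0 <= (k + 1)^-1 <= 1.
  by apply/andP; split; [rewrite invr_ge0 ltW|rewrite invf_le1// lerDr ltW].
have -> : (k + 1)^-1 *: \sum_(y0 <- [:: y, z & s]) y0 =
    (k + 1)^-1 *: y + (1 - (k + 1)^-1) *: (k^-1 *: \sum_(y0 <- z :: s) y0).
  rewrite big_cons scalerDr; congr (_ + _); rewrite scalerA; congr (_ *: _).
  by field; rewrite !gt_eqF.
split; first exact: Cc.
apply: le_trans (gc _ _ _ Cy Cm t01).
rewrite big_cons mulrDr lerD2l.
have -> : (k + 1)^-1 * \sum_(j <- z :: s) g j =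
    (1 - (k + 1)^-1) * (k^-1 * \sum_(j <- z :: s) g j).
  by rewrite mulrA; congr (_ * _); field; rewrite !gt_eqF.
by apply: ler_wpM2l => //; rewrite subr_ge0; case/andP: t01.
Qed.

Section supergradient.
Context (R : realType) (n : nat).
Variables (G : 'rV[R]_n -> R) (y0 : 'rV[R]_n) (r : R).
Hypothesis r0 : 0 < r.
Hypothesis Gc : concave_on (cube y0 r) G.

Definition kink_free j := forall eps, 0 < eps ->
  exists2 h, 0 < h <= r & - (eps * h) < second_diff G j y0 h.

Let in_cube j t : `|t| <= r -> cube y0 r (y0 + t *: delta_mx 0 j).
Proof. by move=> tr; apply: cubeS tr _ _; exact: cube_delta. Qed.

Let axis_concave j (s t u : R) : `|s| <= r -> `|t| <= r -> 0 <= u <= 1 ->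
  u * G (y0 + s *: delta_mx 0 j) + (1 - u) * G (y0 + t *: delta_mx 0 j) <=
  G (y0 + (u * s + (1 - u) * t) *: delta_mx 0 j).
Proof.
move=> sr tr u01; apply: le_trans (Gc (in_cube _ sr) (in_cube _ tr) u01) _.
rewrite le_eqVlt; apply/orP; left; apply/eqP; congr G; apply/rowP => l.
by rewrite !mxE; ring.
Qed.

(** By concavity right difference quotients never exceed left ones, so the supremum [a] of the
    former lies between. A step [h] with a kink below [eps * h] pins both quotients at [h] to within
    [eps] of [a], and interpolation between 0 and [h] or [- h] covers the shorter displacements. *)
Lemma kink_free_partial j : kink_free j -> exists a : R, forall eps, 0 < eps ->
  exists2 h, 0 < h <= r & forall t, `|t| <= h ->
    G y0 + a * t - eps * `|t| <= G (y0 + t *: delta_mx 0 j).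
Proof.
move=> kf; pose f t := G (y0 + t *: delta_mx 0 j).
have f0 : f 0 = G y0 by rewrite /f scale0r addr0.
have fc s t u : `|s| <= r -> `|t| <= r -> 0 <= u <= 1 ->
    u * f s + (1 - u) * f t <= f (u * s + (1 - u) * t) by exact: axis_concave.
pose A := [set (f h - f 0) / h | h in [set h | 0 < h <= r]].
have lr h h' : 0 < h <= r -> 0 < h' <= r ->
    (f h - f 0) / h <= (f 0 - f (- h')) / h'.
  move=> /andP[h0 hr] /andP[h'0 h'r].
  have s0 : 0 < h + h' by rewrite addr_gt0.
  have u01 : 0 <= h' / (h + h') <= 1.
    by apply/andP; split; [apply: divr_ge0; exact: ltW|rewrite ler_pdivrMr//; lra].
  have := fc h (- h') _ _ _ u01; rewrite normrN !gtr0_norm// => /(_ hr h'r).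
  have -> : h' / (h + h') * h + (1 - h' / (h + h')) * - h' = 0.
    by field; rewrite gt_eqF.
  have -> : 1 - h' / (h + h') = h / (h + h') by field; rewrite gt_eqF.
  move=> H; rewrite ler_pdivrMr// mulrAC ler_pdivlMr//.
  have : (h + h') * (h' / (h + h') * f h + h / (h + h') * f (- h')) <= (h + h') * f 0.
    by rewrite ler_pM2l.
  have -> : (h + h') * (h' / (h + h') * f h + h / (h + h') * f (- h')) =
    h' * f h + h * f (- h') by field; rewrite gt_eqF.
  lra.
have r1 : 0 < r <= r by rewrite r0 lexx.
have Aub : has_sup A.
  split; first by exists ((f r - f 0) / r); exists r.
  by exists ((f 0 - f (- r)) / r) => _ [h hr <-]; exact: lr.
exists (sup A) => eps eps0; have [h hr kh] := kf eps eps0.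
have [h0 hr'] := andP hr.
have supge : (f h - f 0) / h <= sup A by apply: ub_le_sup; [case: Aub|exists h].
have suple : sup A <= (f 0 - f (- h)) / h.
  by apply: ge_sup; [case: Aub|move=> _ [h' h'r <-]; exact: lr].
have gap : (f 0 - f (- h)) / h - eps < (f h - f 0) / h.
  rewrite ltrBlDr ltr_pdivrMr// mulrDl divfK ?gt_eqF//.
  have fN : G (y0 - h *: delta_mx 0 j) = f (- h) by rewrite /f scaleNr.
  by move: kh; rewrite /second_diff fN -/(f h) -f0; lra.
exists h => // t th; rewrite -f0 -/(f t).
have [t0|t0|t0] := ltgtP t 0.
- have u01 : 0 <= - t / h <= 1.
    apply/andP; split; first by rewrite divr_ge0 ?ltW// oppr_gt0.
    by rewrite ler_pdivrMr// mul1r -(ltr0_norm t0).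
  have := fc (- h) 0 _ _ _ u01; rewrite normrN normr0 gtr0_norm// => /(_ hr' (ltW r0)).
  have -> : - t / h * - h + (1 - - t / h) * 0 = t by field; rewrite gt_eqF.
  rewrite ltr0_norm// => H.
  have E : - t / h * f (- h) + (1 - - t / h) * f 0 =
     f 0 + t * ((f 0 - f (- h)) / h) by ring.
  rewrite E in H; apply: le_trans H.
  have := suple; have := supge; have := gap.
  by move: ((f 0 - f (- h)) / h) ((f h - f 0) / h) (sup A) => X Y Z; nra.
- have u01 : 0 <= t / h <= 1.
    apply/andP; split; first by rewrite divr_ge0 ?ltW.
    by rewrite ler_pdivrMr// mul1r -(gtr0_norm t0).
  have := fc h 0 _ _ _ u01; rewrite normr0 gtr0_norm// => /(_ hr' (ltW r0)).
  have -> : t / h * h + (1 - t / h) * 0 = t by field; rewrite gt_eqF.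
  rewrite gtr0_norm// => H.
  have E : t / h * f h + (1 - t / h) * f 0 = f 0 + t * ((f h - f 0) / h) by ring.
  rewrite E in H; apply: le_trans H.
  have := suple; have := supge; have := gap.
  by move: ((f 0 - f (- h)) / h) ((f h - f 0) / h) (sup A) => X Y Z; nra.
- by rewrite t0 normr0 !mulr0 addr0 subr0.
Qed.

(* A displacement is the mean of [n] displacements along the axes. *)
Lemma kink_free_supergradient : (forall j, kink_free j) ->
  exists a : 'rV[R]_n, forall eps, 0 < eps -> exists2 d, 0 < d <= r &
    forall eta (v : 'rV[R]_n), 0 < eta <= d -> (forall j, `|v 0 j| <= eta) ->
      G y0 + \sum_j a 0 j * v 0 j - eps * eta <= G (y0 + v).
Proof.
move=> kf; have /fin_all_exists[a aP] := fun j => kink_free_partial (kf j).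
exists (\row_j a j) => eps eps0.
case: (posnP n) => [n0|n_gt0].
  exists r; first by rewrite r0 lexx.
  move=> eta v /andP[eta0 _] _.
  have -> : v = 0 by apply/rowP => -[j jn]; exfalso; rewrite n0 in jn.
  rewrite addr0 big1 ?addr0; last by move=> j _; rewrite [X in _ * X]mxE mulr0.
  by rewrite gerBl mulr_ge0// ltW.
have nR : 0 < n%:R :> R by rewrite ltr0n.
have en0 : 0 < eps / n%:R by rewrite divr_gt0.
have /fin_all_exists2[h hr hP] := fun j => aP j _ en0.
(* The inverse of a sum of inverses is a positive radius below every [h j] and below [r]. It is
   later divided by [n] because the axis displacements are [n] times the coordinates of [v]. *)
pose S := \sum_j (h j)^-1 + r^-1.
have h0 j : 0 < h j by have /andP[] := hr j.
have S0 : 0 < S.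
  by apply: ltr_wpDl; [apply: sumr_ge0 => j _; rewrite invr_ge0 ltW|rewrite invr_gt0].
have Sh j : S^-1 <= h j.
  rewrite -[leRHS]invrK lef_pV2 ?posrE ?invr_gt0// /S (bigD1 j)//= -addrA lerDl.
  by apply: addr_ge0; [apply: sumr_ge0 => l _|]; rewrite invr_ge0 ltW.
have Sr : S^-1 <= r.
  rewrite -[leRHS]invrK lef_pV2 ?posrE ?invr_gt0// /S lerDr.
  by apply: sumr_ge0 => l _; rewrite invr_ge0 ltW.
have n1 : 1 <= n%:R :> R by rewrite ler1n.
exists (S^-1 / n%:R).
  rewrite divr_gt0 ?invr_gt0//= ler_pdivrMr//; apply: le_trans Sr _.
  by rewrite ler_peMr// ltW.
move=> eta v /andP[eta0 etaS] vP.
have nv j : `|n%:R * v 0 j| <= n%:R * eta by rewrite normrM gtr0_norm// ler_pM2l.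
have neta : n%:R * eta <= S^-1 by rewrite mulrC -ler_pdivlMr.
pose w j := y0 + (n%:R * v 0 j) *: (delta_mx 0 j : 'rV[R]_n).
have Cw y : y \in [seq w j | j <- enum 'I_n] -> cube y0 r y.
  move=> /mapP[j _ ->]; apply: in_cube.
  exact: le_trans (nv j) (le_trans neta Sr).
have := concave_mean (@cube_conv _ _ y0 r) Gc Cw.
rewrite size_map size_enum_ord => /(_ n_gt0)[_].
have -> : n%:R^-1 *: \sum_(y <- [seq w j | j <- enum 'I_n]) y = y0 + v.
  rewrite big_map big_enum/= /w big_split/= sumr_const card_ord scalerDr.
  rewrite -[y0 *+ n]scaler_nat scalerA mulVf ?gt_eqF// scale1r; congr (_ + _).
  rewrite [in RHS](row_sum_delta v) scaler_sumr; apply: eq_bigr => j _.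
  by rewrite scalerA mulKf ?gt_eqF.
move=> /(le_trans _); apply.
rewrite big_map big_enum/=.
have : \sum_(j < n) (G y0 + n%:R * (a j * v 0 j) - eps * eta) <= \sum_(j < n) G (w j).
  apply: ler_sum => j _.
  have /(hP j) : `|n%:R * v 0 j| <= h j.
    exact: le_trans (nv j) (le_trans neta (Sh j)).
  apply: le_trans.
  have : eps / n%:R * `|n%:R * v 0 j| <= eps / n%:R * (n%:R * eta).
    by rewrite ler_pM2l.
  have -> : eps / n%:R * (n%:R * eta) = eps * eta by field; rewrite gt_eqF.
  by move: (eps / n%:R * `|n%:R * v 0 j|) => X; lra.
rewrite !big_split/= !sumr_const card_ord -mulr_sumr.
have -> : \sum_j (\row_j a j) 0 j * v 0 j = \sum_j a j * v 0 j.
  by apply: eq_bigr => j _; rewrite mxE.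
rewrite -[G y0 *+ n]mulr_natl -[(- _) *+ n]mulr_natl => H.
rewrite [leRHS]mulrC ler_pdivlMr//; apply: le_trans H; lra.
Qed.
End supergradient.

(** * From first-order estimates to differentials *)

Section first_order_estimate.
Context (R : realType) (n : nat).
Implicit Types (b v : 'rV[R]_n).

Definition row_form b (v : 'rV[R]_n) : R := \sum_j b 0 j * v 0 j.

Let row_form_linear b : linear_for *%R (row_form b).
Proof.
move=> a u v; rewrite /row_form mulr_sumr -big_split/=; apply: eq_bigr => j _.
by rewrite !mxE; ring.
Qed.

HB.instance Definition _ b :=
  GRing.isLinear.Build R 'rV[R]_n R *%R (row_form b) (row_form_linear b).

Lemma row_form_continuous b : continuous (row_form b).
Proof.
move=> v; rewrite /row_form.
apply: (@cvg_big R 'I_n +%R 0 xpredT) => [||j _];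
  [exact: add_continuous|exact: nbhs_filter|].
apply: (@cvgM R _ (nbhs v) _ (fun=> b 0 j) (fun u : 'rV[R]_n => u 0 j));
  [exact: cvg_cst|exact: coord_continuous].
Qed.

Lemma coord_le_norm v j : `|v 0 j| <= `|v|.
Proof.
have [->|v0] := eqVneq v 0; first by rewrite mxE normr0.
have vn : 0 < `|v| by rewrite normr_gt0.
apply/ler_addgt0Pr => e e0.
have : ball (0 : 'rV[R]_n) (`|v| + e) v.
  by rewrite -ball_normE/= sub0r normrN ltrDl.
by move=> /ball_rVP -/(_ (addr_gt0 vn e0))/(_ j); rewrite mxE subr0 => /ltW.
Qed.

Lemma estimate_differentiable (f : 'rV[R]_n -> R) y0 b :
  (forall eps, 0 < eps -> exists2 d, 0 < d & forall eta v, 0 < eta <= d ->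
    (forall j, `|v 0 j| <= eta) ->
    `|f (y0 + v) - f y0 - row_form b v| <= eps * eta) ->
  differentiable f y0 /\ 'd f y0 = row_form b :> ('rV[R]_n -> R).
Proof.
move=> fb.
have fE : f \o shift y0 = cst (f y0) + row_form b +o_ (0 : 'rV[R]_n) id.
  apply/eqaddoP => eps eps0; have [d d0 fd] := fb eps eps0.
  near=> v; rewrite /= [X in `|X|](_ : _ = f (y0 + v) - f y0 - row_form b v); last first.
    by rewrite !fctE/= [v + y0]addrC opprD addrA.
  have [->|v0] := eqVneq v 0.
    rewrite addr0 subrr sub0r /row_form big1 ?oppr0 ?normr0 ?mulr0//.
    by move=> j _; rewrite mxE mulr0.
  apply: fd => [|j]; last exact: coord_le_norm.
  rewrite normr_gt0 v0/=; near: v.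
  by apply/nbhs_ballP; exists d => //= u; rewrite -ball_normE/= sub0r normrN => /ltW.
have dE := diff_unique (@row_form_continuous b) fE.
split=> //; apply/diff_locallyP; rewrite dE; split=> //.
exact: row_form_continuous.
Unshelve. all: by end_near. Qed.

End first_order_estimate.

Definition sqsum (R : realType) n (y : 'rV[R]_n) : R := \sum_j y 0 j ^+ 2.

Lemma sqsumD (R : realType) n (y v : 'rV[R]_n) :
  sqsum (y + v) = sqsum y + 2 * row_form y v + sqsum v.
Proof.
rewrite /sqsum /row_form mulr_sumr -!big_split/=; apply: eq_bigr => j _.
by rewrite !mxE; ring.
Qed.

(* A semiconcave [f] touching [g] from above inherits its supergradient as
   differential, which therefore does not depend on [f]. *)
Lemma touching_differentiable (R : realType) n (f g : 'rV[R]_n -> R)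
    (y0 a : 'rV[R]_n) (r K : R) :
  0 < r -> concave_on (cube y0 r) (fun y => f y - K * sqsum y) ->
  (forall eps, 0 < eps -> exists2 d, 0 < d <= r &
    forall eta (v : 'rV[R]_n), 0 < eta <= d -> (forall j, `|v 0 j| <= eta) ->
      g y0 - K * sqsum y0 + \sum_j a 0 j * v 0 j - eps * eta <=
      g (y0 + v) - K * sqsum (y0 + v)) ->
  (forall y, cube y0 r y -> g y <= f y) -> g y0 = f y0 ->
  differentiable f y0 /\
  'd f y0 = row_form (a + (2 * K) *: y0) :> ('rV[R]_n -> R).
Proof.
move=> r0 fc ga gf g0; apply: estimate_differentiable => eps eps0.
have e20 : 0 < eps / 2 by rewrite divr_gt0.
have [d /andP[d0 dr] gd] := ga _ e20.
(* With [eta <= eps / 2 / C] the quadratic remainder [K * sqsum v] costs at most half of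
   [eps * eta]. *)
pose C := `|K| * n%:R + 1.
have C0 : 0 < C by rewrite ltr_wpDl// mulr_ge0.
exists (Num.min d (eps / 2 / C)); first by rewrite lt_min d0 !divr_gt0.
move=> eta v; rewrite le_min => /and3P[eta0 etad etaC] vP.
have vN j : `|(- v) 0 j| <= eta by rewrite mxE normrN.
have etaP : 0 < eta <= d by rewrite eta0.
have inr (w : 'rV[R]_n) : (forall j, `|w 0 j| <= eta) -> cube y0 r (y0 + w).
  move=> wP j; rewrite !mxE [X in `|X|](_ : _ = w 0 j); last by ring.
  exact: le_trans (wP j) (le_trans etad dr).
have up := gd eta v etaP vP; have dn := gd eta (- v) etaP vN.
have gfp := gf _ (inr v vP); have gfn := gf _ (inr (- v) vN).
have t01 : 0 <= (2^-1 : R) <= 1 by lra.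
(* The lower bound on [f] at [y0 + v] comes from [g] directly. The upper bound comes from concavity
   at the midpoint [y0], with [f] bounded below by [g] at [y0 - v]. *)
have := fc _ _ _ (inr v vP) (inr (- v) vN) t01.
have -> : 2^-1 *: (y0 + v) + (1 - 2^-1) *: (y0 - v) = y0.
  by apply/rowP => l; rewrite !mxE; lra.
move=> mid.
have sN : \sum_j a 0 j * (- v) 0 j = - row_form a v.
  by rewrite -sumrN; apply: eq_bigr => j _; rewrite mxE mulrN.
rewrite sN in dn; rewrite -/(row_form a v) in up.
have sq : `|K * sqsum v| <= eps / 2 * eta.
  have s0 : 0 <= sqsum v by apply: sumr_ge0 => j _; exact: sqr_ge0.
  have sv : sqsum v <= n%:R * eta ^+ 2.
    apply: (@le_trans _ _ (\sum_(j < n) eta ^+ 2)).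
      by apply: ler_sum => j _; rewrite -real_normK ?num_real// ler_sqr ?nnegrE// ltW.
    by rewrite sumr_const card_ord mulr_natl.
  rewrite normrM (ger0_norm s0).
  apply: (@le_trans _ _ (`|K| * (n%:R * eta ^+ 2))); first by rewrite ler_wpM2l.
  rewrite expr2 !mulrA ler_pM2r//.
  apply: (@le_trans _ _ (C * eta)); first by rewrite ler_pM2r// lerDl.
  by rewrite mulrC -ler_pdivlMr.
have rf : row_form (a + (2 * K) *: y0) v = row_form a v + 2 * K * row_form y0 v.
  rewrite /row_form mulr_sumr -big_split/=; apply: eq_bigr => j _.
  by rewrite !mxE; ring.
have sv := sqsumD y0 v; have svn := sqsumD y0 (- v).
have rfN : row_form y0 (- v) = - row_form y0 v.
  by rewrite /row_form -sumrN; apply: eq_bigr => j _; rewrite mxE mulrN.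
have sqN : sqsum (- v) = sqsum v.
  by apply: eq_bigr => j _; rewrite mxE sqrrN.
rewrite rf; rewrite rfN sqN in svn; rewrite sv svn in mid; rewrite sv in up.
rewrite svn in dn; move: sq; rewrite !ler_norml g0 in up dn *.
by move: (f (y0 + v)) (f (y0 - v)) (f y0) (sqsum y0) (sqsum v) (row_form y0 v)
  (row_form a v) (g (y0 + v)) (g (y0 - v)) up dn mid gfp gfn => *; nra.
Qed.

(** * Splitting pairs *)

Section splitting_pairs.
Context (R : realType) (m : nat) (M : 'I_m.+1 -> smoothManifold R).
Local Notation X := (prod_mfd M).
Variable c : X -> R.
Hypothesis c_continuous : continuous c.

(** On a noncompact product [c] may be unbounded below, yet Borel potentials must satisfy their
    inequality everywhere. Each factor is exhausted by compact sets [E i k], and [kap] is the first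
    index reached. All coordinates of a point lie in the sets of its largest index, so the bound of
    [c] there is one of the summands. *)
Lemma separable_lower_bound : exists h : forall i, M i -> R,
  [/\ forall i, measurable_fun setT (h i : borel (M i) -> R),
      forall i y, 0 <= h i y & forall x : X, - (\sum_i h i (x i)) <= c x].
Proof.
have /fin_all_exists[B /fin_all_exists[Z BZ]] :=
  fun i => manifold_compact_base (M i).
pose E i k := \big[setU/set0]_(l < k.+1) Z i l.
have kE i k : compact (E i k).
  by apply: bigsetU_compact => l _; have [] := BZ i.
have cE i k : closed (E i k).
  by apply: closed_bigsetU => l _; have [] := BZ i.
have Ele i k l : (k <= l)%N -> E i k `<=` E i l.
  move=> kl y; rewrite /E -!bigcup_mkord => -[q /= qk Zq]; exists q => //=.
  exact: leq_trans qk _.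
have Eex i y : exists k, `[< E i k y >].
  have [_ _ _ BsubZ /(_ setT y openT I)[k Bk _]] := BZ i.
  exists k; apply/asboolP; rewrite /E big_ord_recr/=; right; exact: BsubZ.
pose kap i y := ex_minn (Eex i y).
have kapE i y : E i (kap i y) y.
  by rewrite /kap; case: ex_minnP => k /asboolP.
have kap_eq i k : kap i @^-1` [set k] =
    E i k `\` \big[setU/set0]_(l < k) E i l.
  apply/seteqP; split=> y /=; rewrite /kap.
    case: ex_minnP => q /asboolP Eq qmin <-; split=> //.
    rewrite -bigcup_mkord => -[l /= lq El].
    by have := qmin l (asboolT El); rewrite leqNgt lq.
  case: ex_minnP => q /asboolP Eq qmin [Ek nE].
  apply/eqP; rewrite eqn_leq qmin; last exact/asboolP.
  rewrite leqNgt; apply/negP => qk; apply: nE.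
  by rewrite -bigcup_mkord; exists q.
have /choice[b bP] : forall k, exists b, forall x : X,
    (forall i, E i k (x i)) -> `|c x| <= b.
  by move=> k; exact: (continuous_bounded_rect c_continuous (fun i => kE i k)).
exists (fun i y => `|b (kap i y)|); split=> [i|i y|x]; last 2 first.
- exact: normr_ge0.
- pose j := [arg max_(i > ord0) kap i (x i)]%N.
  have jmax i : (kap i (x i) <= kap j (x j))%N.
    by rewrite /j; case: arg_maxnP => // j' _; apply.
  have xE i : E i (kap j (x j)) (x i) by exact: Ele (jmax i) _ (kapE i (x i)).
  have := bP _ _ xE; rewrite ler_norml => /andP[+ _].
  apply: le_trans; rewrite lerN2 (bigD1 j)//=.
  apply: le_trans (ler_norm _) _; rewrite lerDl.
  by apply: sumr_ge0 => i _.
- move=> _ V mV; rewrite setTI.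
  have -> : (fun y => `|b (kap i y)|) @^-1` V =
      \bigcup_(k in [set k | V `|b k|]) (kap i @^-1` [set k]).
    by apply/seteqP; split=> [y Vy|y [k Vk /= ->]]; [exists (kap i y)|].
  apply: bigcup_measurable => k _; rewrite kap_eq; apply: measurableD.
    exact: borel_closed.
  by apply: bigsetU_measurable => l _; exact: borel_closed.
Qed.

Lemma measurable_update (T : ptopologicalType) (f : borel T -> R) (a : T) (b : R) :
  closed [set a] -> measurable_fun setT f ->
  measurable_fun setT ((fun y => if y == a then b else f y) : borel T -> R).
Proof.
move=> ca mf _ V mV; rewrite setTI.
have ma : measurable ([set a] : set (borel T)) by exact: borel_closed.
have -> : (fun y => if y == a then b else f y) @^-1` V =
    ([set a] `&` [set _ | V b]) `|` (f @^-1` V `\` [set a]).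
  apply/seteqP; split=> y /=.
    by case: eqP => [->|ya] ?; [left|right].
  by case=> [[-> Vb]|[Vf ya]]; rewrite ?eqxx//; case: eqP.
apply: measurableU.
  apply: measurableI => //; have [Vb|Vb] := pselect (V b).
    rewrite (_ : mkset _ = setT); first exact: measurableT.
    by apply/seteqP; split.
  rewrite (_ : mkset _ = set0); first exact: measurable0.
  by apply/seteqP; split.
apply: measurableD => //; rewrite -[_ @^-1` _]setTI; exact: mf.
Qed.

(** A point mixing coordinates of [z] and [z'] is still in the product of the [K i], where [u] obeys
    the constraint. At any other point some coordinate [j] contributes minus [h j] minus the sum of
    all [D i], and [D i] bounds what another coordinate can add beyond minus [h i]. Only finitely
    many values of [u] enter, so the new potentials are Borel even if [u] is not. *)
Lemma pair_c_splitting (K : forall i, set (M i)) (u : forall i, M i -> R)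
    (z z' : X) :
  (forall x : X, (forall i, K i (x i)) -> \sum_i u i (x i) <= c x) ->
  (forall i, K i (z i)) -> (forall i, K i (z' i)) ->
  \sum_i u i (z i) = c z -> \sum_i u i (z' i) = c z' ->
  c_splitting c [set z; z'].
Proof.
move=> uc Kz Kz' uz uz'; have [h [mh h0 hc]] := separable_lower_bound.
pose D i := `|u i (z i)| + `|u i (z' i)| + h i (z i) + h i (z' i).
have D0 i : 0 <= D i by rewrite !addr_ge0.
pose w i y := if y == z i then u i (z i) else
  if y == z' i then u i (z' i) else -1 * h i y - \sum_j D j.
have w_on i y : (y == z i) || (y == z' i) -> w i y = u i y.
  by rewrite /w; case: eqP => [->//|_]; case: eqP => [->|].
exists w; split=> [i|x|x].
- have c1 (a : M i) : closed [set a].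
    by apply: compact_closed; [exact: mfd_hausdorff|exact: compact_set1].
  do 2 apply: measurable_update => //.
  by apply: measurable_funD => //; apply: measurable_funM.
- have [xon|/existsNP[j /negP jout]] :=
      pselect (forall i, (x i == z i) || (x i == z' i)).
    rewrite (eq_bigr (fun i => u i (x i))); last by move=> i _; exact: w_on.
    by apply: uc => i; case/orP: (xon i) => /eqP ->.
  apply: le_trans (hc x).
  rewrite -subr_le0 opprK -big_split/= (bigD1 j)//=.
  have -> : w j (x j) + h j (x j) = - \sum_i D i.
    rewrite /w; move: jout; rewrite negb_or => /andP[/negbTE -> /negbTE ->].
    by ring.
  rewrite addrC subr_le0 [leRHS](bigD1 j)//= -[leLHS]add0r; apply: lerD => //.
  apply: ler_sum => i _; rewrite /w /D.
  have := h0 i (z i); have := h0 i (z' i).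
  have := ler_norm (u i (z i)); have := ler_norm (u i (z' i)).
  have := normr_ge0 (u i (z i)); have := normr_ge0 (u i (z' i)).
  case: eqP => [->|_]; first by lra.
  case: eqP => [->|_]; first by lra.
  have : 0 <= \sum_j D j by apply: sumr_ge0.
  by lra.
- case=> ->; rewrite -?uz -?uz'; apply: eq_bigr => i _; apply: w_on;
    by rewrite eqxx ?orbT.
Qed.

End splitting_pairs.

(** * Semiconcave slices and the graph property *)

Lemma sqsum_convex (R : realType) n (y z : 'rV[R]_n) (t : R) : 0 <= t <= 1 ->
  sqsum (t *: y + (1 - t) *: z) <= t * sqsum y + (1 - t) * sqsum z.
Proof.
move=> t01; rewrite /sqsum !mulr_sumr -big_split/=; apply: ler_sum => j _.
rewrite !mxE -subr_ge0.
have -> : t * y 0 j ^+ 2 + (1 - t) * z 0 j ^+ 2 -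
  (t * y 0 j + (1 - t) * z 0 j) ^+ 2 = t * (1 - t) * (y 0 j - z 0 j) ^+ 2 by ring.
by rewrite mulr_ge0 ?sqr_ge0// mulr_ge0// ?subr_ge0; case/andP: t01.
Qed.

Lemma concave_sub_sqsum (R : realType) n (C D : set 'rV[R]_n)
    (f : 'rV[R]_n -> R) (K K' : R) : D `<=` C -> K <= K' ->
  concave_on C (fun y => f y - K * sqsum y) ->
  concave_on D (fun y => f y - K' * sqsum y).
Proof.
move=> DC KK' fc y z t /DC Cy /DC Cz t01; have := fc y z t Cy Cz t01.
have sc := sqsum_convex y z t01.
have : (K' - K) * sqsum (t *: y + (1 - t) *: z) <=
       (K' - K) * (t * sqsum y + (1 - t) * sqsum z).
  by apply: ler_wpM2l => //; rewrite subr_ge0.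
by lra.
Qed.

Section slices.
Context (R : realType) (m : nat) (M : 'I_m.+1 -> smoothManifold R).
Local Notation X := (prod_mfd M).
Variable c : X -> R.
Hypothesis c_semiconcave : semiconcave c.
Variables (phi : chart R (M ord0) (mfd_dim (M ord0))) (x1 : M ord0).
Hypotheses (phi_atlas : mfd_atlas phi) (phi_x1 : chart_dom phi x1).

(** Joint semiconcavity in a product chart is used with all coordinates but the first frozen at
    those of [z']; their squares add up to a constant [s], which drops out. *)
Let local_slice (z : X) : z ord0 = x1 -> exists (U : set X) (r K : R),
  [/\ nbhs z U, 0 < r & forall z', U z' ->
    concave_on (ball (phi x1) r) (fun y => first_slice c phi z' y - K * sqsum y)].
Proof.
move=> z0; have /fin_all_exists[psi0 psi0P] : forall i,
    exists psi, mfd_atlas psi /\ chart_dom psi (z i).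
  by move=> i; have [psi] := mfd_cover (z i); exists psi.
pose psi := @dfwith _ (fun i => chart R (M i) (mfd_dim (M i))) psi0 ord0 phi.
have psiE : psi ord0 = phi by exact: dfwithin.
have psiP i : mfd_atlas (psi i) /\ chart_dom (psi i) (z i).
  by rewrite /psi; case: dfwithP => [|j _]; [rewrite z0|exact: psi0P].
have [r [K [r0 [_ Fc]]]] := c_semiconcave psiP.
pose U : set X := [set z' : X | forall i,
  (chart_dom (psi i) `&` (psi i @^-1` ball (psi i (z i)) r)) (z' i)].
exists U, r, K; split=> // [|z' Uz'].
  have := @filter_forall _ _ (fun i => [set z' : X |
    (chart_dom (psi i) `&` (psi i @^-1` ball (psi i (z i)) r)) (z' i)]) (nbhs z).
  apply=> i; apply: (@prod_mfd_proj_continuous _ _ M i).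
  have [_ dz] := psiP i.
  apply: filterI; first by apply: open_nbhs_nbhs; split=> //; exact: chart_dom_open.
  by apply: chart_fun_continuous => //; exact: nbhsx_ballx.
pose Y y := @dfwith _ (fun i => 'rV[R]_(mfd_dim (M i))) (fun i => psi i (z' i)) ord0 y.
have BY y : ball (phi x1) r y -> forall i, ball (psi i (z i)) r (Y y i).
  move=> yb i; rewrite /Y; case: dfwithP => [|j _]; first by rewrite psiE z0.
  by have [] := Uz' j.
have inv_Y y : (fun i => chart_inv (psi i) (Y y i)) = dfwith z' ord0 (chart_inv phi y).
  apply: functional_extensionality_dep => i; have [->|i0] := eqVneq i ord0.
    by rewrite /Y !dfwithin psiE.
  rewrite /Y !dfwithout 1?eq_sym// chart_funK//.
  by have [] := Uz' i.
pose s := \sum_(i | i != ord0) sqsum (psi i (z' i)).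
have sum_Y y : \sum_i \sum_j Y y i 0 j ^+ 2 = sqsum y + s.
  rewrite (bigD1 ord0)//= /Y dfwithin; congr (_ + _); apply: eq_bigr => i i0.
  by apply: eq_bigr => j _; rewrite dfwithout// eq_sym.
have conv_Y y y' t i : t *: Y y i + (1 - t) *: Y y' i =
    Y (t *: y + (1 - t) *: y') i.
  rewrite /Y; have [->|i0] := eqVneq i ord0; first by rewrite !dfwithin.
  by rewrite !dfwithout 1?eq_sym// -scalerDl subrKC scale1r.
move=> y y' t yb y'b t01; have /= := Fc _ _ _ (BY y yb) (BY y' y'b) t01.
have -> : (fun i => chart_inv (psi i) (t *: Y y i + (1 - t) *: Y y' i)) =
    dfwith z' ord0 (chart_inv phi (t *: y + (1 - t) *: y')).
  by rewrite -inv_Y; apply: functional_extensionality_dep => i; rewrite conv_Y.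
have -> : \sum_i \sum_j (t *: Y y i + (1 - t) *: Y y' i) 0 j ^+ 2 =
    sqsum (t *: y + (1 - t) *: y') + s.
  by rewrite -sum_Y; apply: eq_bigr => i _; rewrite conv_Y.
by rewrite !inv_Y !sum_Y /first_slice !mulrDr; lra.
Qed.

(* The neighbourhood and the semiconcavity constant shrink and grow together
   along [k], which makes compactness of the other factors applicable. *)
Lemma slice_semiconcave (K : forall i, set (M i)) : (forall i, compact (K i)) ->
  exists rho C : R, [/\ 0 < rho, cube (phi x1) rho `<=` phi @` chart_dom phi
    & forall x : X, (forall i, K i (x i)) -> concave_on (cube (phi x1) rho)
        (fun y => first_slice c phi x y - C * sqsum y)].
Proof.
move=> kK; have : nbhs (phi x1) (phi @` chart_dom phi).
  by apply: open_nbhs_nbhs; split; [exact: chart_img_open|exists x1].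
move=> /nbhs_cubeP[r0 r0_gt0 r0_img].
(* A slice ignores the first coordinate of its base point, so that coordinate is pinned to [x1],
   where [local_slice] applies. *)
pose K' := @dfwith _ (fun i => set (M i)) K ord0 [set x1].
pose P (k : nat) (z : X) := concave_on (cube (phi x1) k.+1%:R^-1)
  (fun y => first_slice c phi z y - k%:R * sqsum y).
have kP : compact [set z : X | forall i, K' i (z i)].
  apply: (@tychonoff _ (fun i => M i : topologicalType) K') => i.
  by rewrite /K'; case: dfwithP => // ; exact: compact_set1.
have Pnear : \forall k \near \oo, [set z : X | forall i, K' i (z i)] `<=` P k.
  have /compact_near_coveringP := kP; apply=> z Kz.
  have z0 : z ord0 = x1 by have := Kz ord0; rewrite /K' dfwithin.
  have [U [r [C [zU r_gt0 UC]]]] := local_slice z0.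
  pose N := (Num.bound r^-1 + Num.bound `|C|)%N.
  exists (U, [set k | (N <= k)%N]) => /=; first by split=> //; exists N.
  move=> [z' k] /= [Uz' Nk]; apply: concave_sub_sqsum (UC z' Uz').
    move=> y yc; apply/ball_rVP => // j; apply: le_lt_trans (yc j) _.
    rewrite -[ltRHS]invrK ltf_pV2 ?posrE ?invr_gt0//.
    apply: (lt_le_trans (archi_boundP _)); first by rewrite invr_ge0 ltW.
    rewrite ler_nat; apply: leq_trans (leqnSn _).
    exact: leq_trans (leq_addr _ _) Nk.
  apply: le_trans (ler_norm _) _; apply: ltW.
  apply: (lt_le_trans (archi_boundP _)) => //.
  by rewrite ler_nat; exact: leq_trans (leq_addl _ _) Nk.
have [k kP' kr0] : exists2 k, [set z : X | forall i, K' i (z i)] `<=` P k &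
    k.+1%:R^-1 <= r0.
  have [N _ NP] := Pnear; pose k := (N + Num.bound r0^-1)%N.
  exists k; first by apply: NP => /=; exact: leq_addr.
  rewrite -[leRHS]invrK lef_pV2 ?posrE ?invr_gt0//.
  apply: le_trans (ltW (archi_boundP _)) _; first by rewrite invr_ge0 ltW.
  by rewrite ler_nat; apply: leq_trans (leqnSn _); exact: leq_addl.
exists k.+1%:R^-1, k%:R; split=> // [|x Kx].
  by apply: subset_trans r0_img; exact: cubeS.
have := kP' (dfwith x ord0 x1 : X).
have H i : K' i (dfwith x ord0 x1 i).
  rewrite /K'; have [->|i0] := eqVneq i ord0; first by rewrite !dfwithin.
  by rewrite !dfwithout// eq_sym.
move=> /(_ H); rewrite /P /first_slice.
suff E y : dfwith (dfwith x ord0 x1) ord0 y = dfwith x ord0 y.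
  by under eq_fun do rewrite E.
apply: functional_extensionality_dep => i.
have [->|i0] := eqVneq i ord0; first by rewrite !dfwithin.
by rewrite !dfwithout// eq_sym.
Qed.

End slices.

Section graph_property.
Context (R : realType) (m : nat) (M : 'I_m.+1 -> smoothManifold R).
Local Notation X := (prod_mfd M).
Variable mu : forall i, probability (borel (M i)) R.
Arguments mu : clear implicits.
Hypothesis mu_compact : forall i, compactly_supported (mu i).
Variable c : X -> R.
Hypotheses (c_continuous : continuous c) (c_semiconcave : semiconcave c).
Hypothesis c_twisted : twisted_on_splitting_sets c.
Hypothesis mu1_ac : abs_continuous_in_charts (mu ord0).
Local Notation PK := (prod_support mu).

Variables (S : set X) (u : forall i, M i -> R) (A : R).
Arguments u : clear implicits.
Hypothesis S_sub : S `<=` PK.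
Hypothesis u_bounded : forall i y, `|u i y| <= A.
Hypothesis u_le : forall x, PK x -> \sum_i u i (x i) <= c x.
Hypothesis u_eq : forall x, S x -> \sum_i u i (x i) = c x.

Let s (x : X) := \sum_(i | i != ord0) u i (x i).

(* The [c]-conjugate of the potentials on the other factors; it agrees with
   [u ord0] on the projection of [S]. *)
Let v (y : M ord0) := inf [set c (dfwith x ord0 y) - s x | x in PK].

Let dfwith_self (x : X) : dfwith x ord0 (x ord0) = x.
Proof.
apply: functional_extensionality_dep => i; have [->|i0] := eqVneq i ord0.
  by rewrite dfwithin.
by rewrite dfwithout// eq_sym.
Qed.

Let slices_bounded (Y : set (M ord0)) : compact Y -> exists B,
  forall y x, Y y -> PK x -> `|c (dfwith x ord0 y) - s x| <= B.
Proof.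
move=> kY.
pose K' := @dfwith _ (fun i => set (M i)) (fun i => msupport (mu i)) ord0 Y.
have kK' i : compact (K' i).
  by rewrite /K'; case: dfwithP => // j _; exact: mu_compact.
have [B HB] := continuous_bounded_rect c_continuous kK'.
exists (B + \sum_(i < m.+1 | i != ord0) A) => y x Yy Kx.
apply: le_trans (ler_normB _ _) _; apply: lerD.
  apply: HB => i; rewrite /K'; have [->|i0] := eqVneq i ord0; first by rewrite !dfwithin.
  by rewrite !dfwithout 1?eq_sym//; exact: Kx.
by apply: le_trans (ler_norm_sum _ _ _) _; exact: ler_sum.
Qed.

Let v_le y x : PK x -> v y <= c (dfwith x ord0 y) - s x.
Proof.
move=> Kx; have [B HB] := slices_bounded (@compact_set1 _ y).
apply: ge_inf; last by exists x.
exists (- B) => _ [z Kz <-]; have := HB y z erefl Kz.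
by rewrite ler_norml => /andP[].
Qed.

Let v_ge y b : (forall x, PK x -> b <= c (dfwith x ord0 y) - s x) -> b <= v y.
Proof.
move=> H; apply: lb_le_inf; last by move=> _ [x Kx <-]; exact: H.
have [x Kx] := prod_support_neq0 mu.
by exists (c (dfwith x ord0 y) - s x), x.
Qed.

Let v_bounded (Y : set (M ord0)) : compact Y ->
  exists B, forall y, Y y -> `|v y| <= B.
Proof.
move=> /slices_bounded[B HB]; exists B => y Yy; rewrite ler_norml.
have [x Kx] := prod_support_neq0 mu.
apply/andP; split.
  by apply: v_ge => z Kz; have := HB y z Yy Kz; rewrite ler_norml => /andP[].
apply: le_trans (v_le y Kx) _.
by have := HB y x Yy Kx; rewrite ler_norml => /andP[].
Qed.

(** Replacing the first coordinate of a point of [PK] by that of [x] stays in [PK], so the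
    constraint makes [u ord0 (x ord0)] a lower bound for the infimum, attained at [x] by equality on
    [S]. *)
Let v_S x : S x -> v (x ord0) + s x = c x.
Proof.
move=> Sx; have Kx := S_sub Sx.
have sumE z : \sum_i u i (z i) = u ord0 (z ord0) + s z by rewrite (bigD1 ord0).
apply/eqP; rewrite eq_le; apply/andP; split.
  by have := v_le (x ord0) Kx; rewrite dfwith_self; lra.
rewrite -lerBlDr; apply: v_ge => z Kz.
have Kz' : PK (dfwith z ord0 (x ord0)).
  move=> i; have [->|i0] := eqVneq i ord0; first by rewrite dfwithin; exact: Kx.
  by rewrite dfwithout 1?eq_sym//; exact: Kz.
have := u_le Kz'; have := u_eq Sx; rewrite !sumE dfwithin.
have -> : s (dfwith z ord0 (x ord0)) = s z.
  by apply: eq_bigr => i i0; rewrite dfwithout// eq_sym.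
lra.
Qed.

(** The statement is local because the chart and the constant [C] are; the infimum [v] inherits [C]
    since all slices over the cube share it. *)
Let local_graph (x1 : M ord0) : exists (W N : set (M ord0)),
  [/\ nbhs x1 W, (mu ord0).-negligible N & forall z z', S z -> S z' ->
    W (z ord0) -> ~ N (z ord0) -> z ord0 = z' ord0 -> z = z'].
Proof.
have [phi phi_atlas phi_x1] := mfd_cover x1.
have [rho [C [rho0 rho_img rhoC]]] := slice_semiconcave c_semiconcave
  phi_atlas phi_x1 (fun i => mu_compact (i := i)).
set p := phi x1 in rho_img rhoC.
pose g y := v (chart_inv phi y) - C * sqsum y.
have gc : concave_on (cube p rho) g.
  move=> y z t yp zp t01.
  suff : t * v (chart_inv phi y) + (1 - t) * v (chart_inv phi z) -
      C * (t * sqsum y + (1 - t) * sqsum z - sqsum (t *: y + (1 - t) *: z)) <=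
      v (chart_inv phi (t *: y + (1 - t) *: z)) by rewrite /g; lra.
  apply: v_ge => x Kx; have := rhoC x Kx y z t yp zp t01; rewrite /first_slice.
  have [t0 t1] := andP t01.
  have := ler_wpM2l t0 (v_le (chart_inv phi y) Kx).
  have t1' : 0 <= 1 - t by rewrite subr_ge0.
  have := ler_wpM2l t1' (v_le (chart_inv phi z) Kx).
  lra.
(* [concave_kink_set] asks for concavity on a cube four times larger. *)
pose r := rho / 4.
have r0 : 0 < r by rewrite divr_gt0.
have r4 : 4 * r = rho by rewrite /r; lra.
have inv_cont y : cube p rho y -> {for y, continuous (chart_inv phi)}.
  by move=> /rho_img; exact: chart_inv_continuous.
have compact_img (D : set 'rV[R]_(mfd_dim (M ord0))) : compact D ->
    D `<=` cube p rho -> compact (chart_inv phi @` D).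
  move=> kD Dp; apply: continuous_compact kD.
  by apply/continuous_in_subspaceT => y; rewrite inE => /Dp; exact: inv_cont.
have invK y : cube p rho y ->
    phi (chart_inv phi y) = y /\ chart_dom phi (chart_inv phi y).
  by move=> /rho_img[x dx <-]; rewrite chart_funK.
have [B gB] : exists B, forall y, cube p (4 * r) y -> `|g y| <= B.
  have [B HB] := v_bounded (compact_img _ (@compact_cube _ _ p rho) (fun _ => id)).
  exists (B + `|C| * \sum_j (`|p 0 j| + rho) ^+ 2) => y; rewrite r4 => yp.
  apply: le_trans (ler_normB _ _) _; apply: lerD; first by apply: HB; exists y.
  rewrite normrM; apply: ler_wpM2l => //.
  have s0 : 0 <= sqsum y by apply: sumr_ge0 => j _; exact: sqr_ge0.
  rewrite (ger0_norm s0); apply: ler_sum => j _.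
  rewrite -real_normK ?num_real// ler_sqr ?nnegrE//; last by rewrite addr_ge0// ltW.
  have := ler_norm (p 0 j); have := ler_norm (- p 0 j).
  by have := yp j; rewrite normrN !ler_norml; lra.
have gc4 : concave_on (cube p (4 * r)) g by rewrite r4.
have e0 (k : nat) : 0 < k.+1%:R^-1 :> R by rewrite invr_gt0.
(* Kinks of any positive size are caught by the sizes [k.+1%:R^-1], so countably many compact sets
   suffice. *)
pose N j k := chart_inv phi @` kink_set g j p r k.+1%:R^-1.
have r_rho : cube p r `<=` cube p rho by apply: cubeS; rewrite /r; lra.
have N0 j k : (mu ord0).-negligible (N j k : set (borel (M ord0))).
  have [clN outN] := concave_kink_set j r0 (e0 k) gc4 gB.
  have subN : kink_set g j p r k.+1%:R^-1 `<=` cube p rho by move=> y [/r_rho].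
  have kN : compact (N j k).
    apply: compact_img subN; apply: subclosed_compact clN (@compact_cube _ _ p r) _.
    by move=> y [].
  have mN : measurable (N j k : set (borel (M ord0))).
    by apply: borel_closed; apply: compact_closed kN; exact: mfd_hausdorff.
  apply/negligibleP => //; apply: (mu1_ac phi_atlas) => //.
    by move=> _ [y /subN/invK[_ dy] <-].
  rewrite (_ : phi @` N j k = kink_set g j p r k.+1%:R^-1)//.
  apply/seteqP; split=> [_ [_ [y Ny <-] <-]|y Ny].
    by rewrite (invK _ (subN _ Ny)).1.
  by exists (chart_inv phi y); [exists y|rewrite (invK _ (subN _ Ny)).1].
exists (chart_dom phi `&` phi @^-1` cube p r),
  (\bigcup_k \big[setU/set0]_j N j k); split.
- apply: filterI; first by apply: open_nbhs_nbhs; split=> //; exact: chart_dom_open.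
  by apply: chart_fun_continuous => //; apply/nbhs_cubeP; exists r.
- apply: negligible_bigcup => k.
  by apply: big_ind => [|? ?|j _]; [exact: negligible_set0|exact: negligibleU|exact: N0].
move=> z z' Sz Sz' [dz pz] nN zz'.
set y0 := phi (z ord0) in pz.
have y0K : chart_inv phi y0 = z ord0 by exact: chart_funK.
have sub : cube y0 r `<=` cube p rho.
  by move=> y yy; apply: cubeS (cube_trans pz yy); rewrite /r; lra.
have gc0 : concave_on (cube y0 r) g.
  by move=> y y' t /sub yp /sub y'p; exact: gc.
have kf j : kink_free g y0 r j.
  move=> eps eps0; apply: contrapT => nh; apply: nN.
  pose k := Num.bound eps^-1.
  have ke : k.+1%:R^-1 <= eps.
    rewrite -[leRHS]invrK lef_pV2 ?posrE ?invr_gt0//.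
    apply: le_trans (ltW (archi_boundP _)) _; first by rewrite invr_ge0 ltW.
    by rewrite ler_nat.
  exists k => //; rewrite -bigcup_seq; exists j => /=; first by rewrite mem_index_enum.
  exists y0; last exact: chart_funK.
  split=> // h hr; apply: (@le_trans _ _ (- (eps * h))).
    by rewrite leNgt; apply/negP => kh; apply: nh; exists h.
  rewrite lerN2; apply: ler_wpM2r => //.
  by have /andP[/ltW] := hr.
have [a aP] := kink_free_supergradient r0 gc0 kf.
have diffS w : S w -> w ord0 = z ord0 ->
    differentiable (first_slice c phi w) y0 /\
    'd (first_slice c phi w) y0 = row_form (a + (2 * C) *: y0) :> (_ -> R).
  move=> Sw w0; have Kw := S_sub Sw.
  (* The touching function is [v] raised by the constant [s w]; the resulting covector comes from
     [v] alone, so it is the same for [z] and [z']. *)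
  apply: (@touching_differentiable _ _ _ (fun y => v (chart_inv phi y) + s w) _ _ r).
  - exact: r0.
  - by move=> y y' t /sub yp /sub y'p; exact: rhoC.
  - move=> eps /aP[d dr H]; exists d => // eta h etad hP.
    by have := H eta h etad hP; rewrite /g; lra.
  - by move=> y _; rewrite -lerBrDr; exact: v_le.
  - by rewrite y0K -w0 v_S// /first_slice y0K -w0 dfwith_self.
have Szz : c_splitting c [set z; z'].
  apply: (@pair_c_splitting _ _ _ _ c_continuous (fun i => msupport (mu i)) u) => //.
  - exact: S_sub.
  - exact: S_sub.
  - exact: u_eq.
  - exact: u_eq.
have /c_twisted/(_ Szz phi phi_atlas dz) inj :
    [set z; z'] `<=` [set x : X | x ord0 = z ord0] by move=> x [->|->].
have [dfz dz'] := diffS z Sz erefl.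
have [dfz' dz''] := diffS z' Sz' (esym zz').
apply: inj; rewrite ?inE.
- by split; [left|exact: dfz].
- by split; [right|exact: dfz'].
- by rewrite dz' dz''.
Qed.

(** Compactness of the support of [mu ord0] leaves finitely many local null sets, whose union lies
    in a Borel null set. *)
Lemma graph_property : exists N : set (borel (M ord0)),
  [/\ measurable N, mu ord0 N = 0%E & forall z z' : X, S z -> S z' ->
    ~ N (z ord0) -> z ord0 = z' ord0 -> z = z'].
Proof.
have /choice[W WP] := local_graph; have /choice[N NP] := WP.
have [D _ DK] : finite_subset_cover [set: M ord0] (fun x => interior (W x))
    (msupport (mu ord0)).
  have := mu_compact (i := ord0); rewrite /compactly_supported compact_cover.
  apply=> [x _|x _]; first exact: open_interior.
  by exists x => //; have [] := NP x.
have : (mu ord0).-negligible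
    (\big[setU/set0]_(x <- finmap.enum_fset D) N x : set (borel (M ord0))).
  apply: big_ind => [|? ?|x _]; [exact: negligible_set0|exact: negligibleU|].
  by have [] := NP x.
move=> [N' [mN' N'0 DN']]; exists N'; split=> // z z' Sz Sz' nN zz'.
have Kz : msupport (mu ord0) (z ord0) by apply: (S_sub Sz).
have [x xD /interior_subset Wz] := DK _ Kz.
have [_ _ H] := NP x; apply: H => // Nz; apply: nN; apply: DN'.
by rewrite -bigcup_seq; exists x.
Qed.

End graph_property.

(** * Uniqueness *)

Section uniqueness_on_graphs.
Context (R : realType) (m : nat) (M : 'I_m.+1 -> smoothManifold R).
Local Notation X := (prod_mfd M).
Variables (mu : forall i, probability (borel (M i)) R) (G : set (borel X)).
Hypothesis mG : measurable G.
Hypothesis G_graph : forall z z' : X, G z -> G z' -> z ord0 = z' ord0 -> z = z'.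

(* On a compact part [C] of the graph, a plan takes the value of the first
   marginal on the (compact) projection of [C]. *)
Lemma graph_compact_measure (gamma : probability (borel X) R) (C : set X) :
  coupling mu gamma -> gamma (~` G) = 0%E -> compact C -> C `<=` G ->
  gamma C = mu ord0 ((fun x : X => x ord0) @` C).
Proof.
move=> cg G0 kC CG; set P := _ @` C.
have mP : measurable (P : set (borel (M ord0))).
  apply: borel_closed; apply: compact_closed; first exact: mfd_hausdorff.
  apply: continuous_compact kC; apply: continuous_subspaceT.
  exact: (@prod_mfd_proj_continuous _ _ M ord0).
have mQ : measurable ([set x : X | P (x ord0)] : set (borel X)).
  rewrite -[mkset _]setTI.
  exact: (@prod_mfd_proj_measurable _ _ M ord0 measurableT P mP).
rewrite -(cg ord0 P mP) -(measure_full_support mG G0 mQ); congr (gamma _).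
apply/seteqP; split=> [x Cx|x [[z Cz zx] Gx]].
  by split; [exists x|exact: CG].
by rewrite -(G_graph (CG _ Cz) Gx zx).
Qed.

(** The projection of a Borel set may fail to be Borel, so plans are compared on compact sets and
    inner regularity of [gamma1] does the rest. Exchanging the plans gives equality. *)
Lemma graph_plan_le (gamma1 gamma2 : probability (borel X) R) (A : set (borel X)) :
  coupling mu gamma1 -> coupling mu gamma2 ->
  gamma1 (~` G) = 0%E -> gamma2 (~` G) = 0%E -> measurable A ->
  (gamma1 A <= gamma2 A)%E.
Proof.
move=> c1 c2 G1 G2 mA; apply/lee_addgt0Pr => e e0.
have mAG : measurable (A `&` G) by exact: measurableI.
have [C [kC clC CA Ce]] :=
  @inner_regular _ _ gamma1 (@prod_mfd_compact_base _ _ M) _ _ mAG e0.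
have mC : measurable C by exact: borel_closed.
have CG : C `<=` G by move=> x /CA[].
rewrite -(measure_full_support mG G1 mA).
have -> : A `&` G = C `|` ((A `&` G) `\` C) by rewrite setDUK.
apply: (@le_trans _ _ (gamma1 C + gamma1 ((A `&` G) `\` C))%E).
  exact: measureU2 mC (measurableD mAG mC).
apply: leeD; last exact: ltW.
rewrite (graph_compact_measure c1 G1 kC CG) -(graph_compact_measure c2 G2 kC CG).
by apply: le_measure; rewrite ?inE// => x /CA[].
Qed.
End uniqueness_on_graphs.

Theorem theorem3p1 (R : realType) (m : nat) (M : 'I_m.+1 -> smoothManifold R)
    (mu : forall i, probability (borel (M i)) R) (c : prod_mfd M -> R)
    (mu_compact : forall i, compactly_supported (mu i))
    (c_continuous : continuous c) (c_semiconcave : semiconcave c)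
    (c_twisted : twisted_on_splitting_sets c)
    (mu1_ac : abs_continuous_in_charts (mu ord0)) :
  exists gamma : probability (borel (prod_mfd M)) R,
    [/\ kantorovich_solution mu c gamma,
        induces_monge gamma
      & forall gamma' : probability (borel (prod_mfd M)) R,
          kantorovich_solution mu c gamma' ->
          forall A : set (borel (prod_mfd M)), measurable A ->
            gamma' A = gamma A].
Proof.
have [gamma [og [S [u [A [[mS SK uA uc uS] full]]]]]] :=
  optimal_potentials mu_compact c_continuous.
have [N [mN N0 NG]] := graph_property mu_compact c_continuous c_semiconcave
  c_twisted mu1_ac SK uA uc uS.
(* Removing the fibres over the null set [N] leaves a Borel graph that still carries the full mass
   of every optimal plan. *)
pose G : set (borel (prod_mfd M)) := S `\` [set x : prod_mfd M | N (x ord0)].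
have mN' : measurable ([set x : prod_mfd M | N (x ord0)] : set (borel (prod_mfd M))).
  rewrite -[mkset _]setTI.
  exact: (@prod_mfd_proj_measurable _ _ M ord0 measurableT N mN).
have mG : measurable G by exact: measurableD.
have Gfull gamma' : kantorovich_solution mu c gamma' -> gamma' (~` G) = 0%E.
  move=> og'; rewrite /G setCD; apply/negligibleP.
    by apply: measurableU => //; exact: measurableC.
  apply: negligibleU; apply/negligibleP => //; first exact: measurableC.
    exact: full.
  exact: etrans (og'.1 ord0 N mN) N0.
have G_graph (z z' : prod_mfd M) : G z -> G z' -> z ord0 = z' ord0 -> z = z'.
  by move=> [Sz nN] [Sz' _]; exact: NG.
exists gamma; split=> //.
(* The map picks the unique point of [G] over [x1] if there is one, and the default point elsewhere;
   such [x1] lie under no point of [G]. *)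
- pose w x1 : prod_mfd M := xget point [set z : prod_mfd M | G z /\ z ord0 = x1].
  exists (fun x1 i => w x1 (lift ord0 i)).
  have nG : gamma.-negligible (~` G).
    by apply/negligibleP; [exact: measurableC|exact: Gfull].
  apply: negligibleS nG => x nx Gx; apply: nx => i; rewrite /w.
  case: xgetP => [z _ [Gz zx]|/(_ x)]; last by case.
  by rewrite (G_graph z x).
- move=> gamma' og' B mB; apply/eqP; rewrite eq_le; apply/andP; split.
    exact: (graph_plan_le mG G_graph og'.1 og.1 (Gfull _ og') (Gfull _ og) mB).
  exact: (graph_plan_le mG G_graph og.1 og'.1 (Gfull _ og) (Gfull _ og') mB).
Qed.
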